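(* Let $n\ge 0$, let $0\le k,l,m\leq n$ be integers, and let $\lambda\vdash k$, $\mu\vdash l$ and $\nu\vdash m$ be partitions. Let $\mathbf{k}_{\lambda,\mu}^\nu$ denote the multiplicity of the simple $\Bbbk[IS_n]$-module $\mathbf{N}^\nu$ in the $\Bbbk[IS_n]$-module $\mathbf{N}^\lambda\otimes_\Bbbk\mathbf{N}^\mu$. (a) If $m<\max\{k,l\}$ or $m>k+l$, then $\mathbf{k}_{\lambda,\mu}^\nu=0$. (b) If $\max\{k,l\}\leq m\leq k+l$, set $b:=k+l-m$, $a:=k-b$ and $c:=l-b$. Then $$\mathbf{k}_{\lambda,\mu}^\nu= \sum_{\alpha\vdash a}\sum_{\beta\vdash b}\sum_{\gamma\vdash c}\sum_{\delta\vdash b}\sum_{\epsilon\vdash b}\sum_{\kappa\vdash a+b}\mathbf{c}_{\alpha,\beta}^\lambda\,\mathbf{c}_{\gamma,\delta}^\mu\,\mathbf{g}_{\beta,\delta}^\epsilon\,\mathbf{c}_{\alpha,\epsilon}^\kappa\,\mathbf{c}_{\kappa,\gamma}^\nu .$$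
   Context: $\Bbbk$ is an algebraically closed field of characteristic zero. $\underline{n}=\{1,\dots,n\}$, $\underline{0}=\varnothing$. $\mathbf{S}^\lambda$ is the Specht $\Bbbk[S_n]$-module for $\lambda\vdash n$. Kronecker coefficients: for $\lambda,\mu,\nu\vdash n$, $\mathbf{g}_{\lambda,\mu}^\nu$ is the multiplicity of $\mathbf{S}^\nu$ in $\mathbf{S}^\lambda\otimes_\Bbbk\mathbf{S}^\mu$ (diagonal action of $S_n$). Littlewood--Richardson coefficients: for $\lambda\vdash n$, $\mu\vdash m$, $\nu\vdash n+m$, $\mathbf{c}_{\lambda,\mu}^\nu$ is the multiplicity of $\mathbf{S}^\nu$ in $\mathrm{Ind}_{\Bbbk[S_n\times S_m]}^{\Bbbk[S_{n+m}]}(\mathbf{S}^\lambda\otimes_\Bbbk\mathbf{S}^\mu)$, where $S_n\times S_m$ is the Young subgroup ($S_n$ acting on the first $n$ points, $S_m$ on the last $m$ points). $IS_n$ is the symmetric inverse semigroup: all bijections between subsets of $\underline{n}$, under composition (right to left) of partially defined maps. For $0\le k\le n$, let $\mathbf{L}_k$ be the set of all $\sigma\in IS_n$ with domain $\underline{k}$ (a left cell, i.e. an $\mathcal{L}$-class). The cell module $\Bbbk[\mathbf{L}_k]$ has basis $\mathbf{L}_k$ and action, for $\sigma\in IS_n$, $\pi\in\mathbf{L}_k$: $\sigma\cdot\pi=\sigma\pi$ if $\sigma\pi\in\mathbf{L}_k$, and $\sigma\cdot\pi=0$ otherwise. The group $S_k$ (identified with the bijections $\underline{k}\to\underline{k}$)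 acts on $\mathbf{L}_k$ by right multiplication, making $\Bbbk[\mathbf{L}_k]$ a $\Bbbk[IS_n]$-$\Bbbk[S_k]$-bimodule. For $\lambda\vdash k$ set $\mathbf{N}^\lambda:=\Bbbk[\mathbf{L}_k]\otimes_{\Bbbk[S_k]}\mathbf{S}^\lambda$; these modules, for $\lambda\vdash k$ and $0\le k\leq n$, form a complete irredundant list of simple $\Bbbk[IS_n]$-modules up to isomorphism, and $\Bbbk[IS_n]$ is semisimple. The tensor product over $\Bbbk$ of two $\Bbbk[IS_n]$-modules is a $\Bbbk[IS_n]$-module via $\sigma\mapsto\sigma\otimes\sigma$ for $\sigma\in IS_n$. *)

(* Defs.v *)
From HB Require Import structures.
From mathcomp Require Import all_boot all_order all_algebra all_fingroup.
From mathcomp Require Import boolp.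
From mathcomp Require classical_sets.

Set Implicit Arguments.
Unset Strict Implicit.
Unset Printing Implicit Defensive.

Import GRing.Theory.
Import VectorInternalTheory.

Local Open Scope ring_scope.

(* Weakly decreasing sequences of n nonnegative integers of sum n: partitions
   of n, padded with zeros to length n. *)
Record intpart (n : nat) := IntPart {
  part_tuple : n.-tuple 'I_n.+1;
  _ : sorted geq (map val part_tuple) && (sumn (map val part_tuple) == n) }.
HB.instance Definition _ n := [isSub for @part_tuple n].
HB.instance Definition _ n := [Finite of intpart n by <:].

Definition parts n (lam : intpart n) : seq nat := map val (part_tuple lam).
Coercion parts : intpart >-> seq.

(* MathComp composes permutations from left to right; [symg n] is the symmetric
   group with right-to-left composition, so that left modules over it are
   left modules in the usual sense. *)
Definition symg (n : nat) : Type := {perm 'I_n}.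
HB.instance Definition _ n := Finite.on (symg n).

Definition sperm n (s : symg n) : {perm 'I_n} := s.
Coercion sperm : symg >-> perm_of.

Section SymGroup.
Variable n : nat.
Implicit Types s t : symg n.

Definition symg_mul s t : symg n := (sperm t * sperm s)%g.
Definition symg_one : symg n := (1 : {perm 'I_n})%g.
Definition symg_inv s : symg n := (sperm s)^-1%g.

Lemma symg_mulA : associative symg_mul.
Proof. by move=> s t u; rewrite /symg_mul mulgA. Qed.
Lemma symg_mul1 : left_id symg_one symg_mul.
Proof. by move=> s; apply: mulg1. Qed.
Lemma symg_mulV : left_inverse symg_one symg_inv symg_mul.
Proof. by move=> s; apply: mulgV. Qed.
HB.instance Definition _ :=
  Finite_isGroup.Build (symg n) symg_mulA symg_mul1 symg_mulV.

Lemma sperm1 x : (1%g : symg n) x = x.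
Proof. exact: perm1. Qed.
Lemma spermM s t x : (s * t)%g x = s (t x).
Proof. exact: permM. Qed.
Lemma spermVK s x : (s^-1)%g (s x) = x.
Proof. exact: permK. Qed.
Lemma spermKV s x : s ((s^-1)%g x) = x.
Proof. exact: permKV. Qed.
Lemma odd_spermM s t : odd_perm (s * t)%g = odd_perm s (+) odd_perm t.
Proof. by rewrite [LHS]odd_permM addbC. Qed.
Lemma odd_spermV s : odd_perm (s^-1)%g = odd_perm s.
Proof. exact: odd_permV. Qed.
End SymGroup.

(* The symmetric inverse semigroup IS_n: [f x = None] when x is not in the
   domain of f; the product is right-to-left composition of partial maps. *)
Section InverseSemigroup.
Variable n : nat.

Definition pinj (f : {ffun 'I_n -> option 'I_n}) :=
  [forall x, forall y, isSome (f x) && (f x == f y) ==> (x == y)].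

Record isn := Isn { isn_fun :> {ffun 'I_n -> option 'I_n}; _ : pinj isn_fun }.
HB.instance Definition _ := [isSub for isn_fun].
HB.instance Definition _ := [Finite of isn by <:].
Implicit Types f g h : isn.

Lemma isnP f x y z : f x = Some z -> f y = Some z -> x = y.
Proof.
by move=> fx fy; have /forallP/(_ x)/forallP/(_ y) := valP f;
  rewrite /= fx fy eqxx => /eqP.
Qed.

Lemma pinjI (f : {ffun 'I_n -> option 'I_n}) :
  (forall x y z, f x = Some z -> f y = Some z -> x = y) -> pinj f.
Proof.
move=> fP; apply/forallP => x; apply/forallP => y; apply/implyP.
case Dfx: (f x) => [z|] //= /eqP Dfy.
by apply/eqP/(fP x y z).
Qed.

Lemma isn_mul_proof f g : pinj [ffun x => obind f (g x)].
Proof.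
apply: pinjI => x y z; rewrite !ffunE.
case Dgx: (g x) => [u|] //=; case Dgy: (g y) => [v|] //= fu fv.
by move: Dgx; rewrite (isnP fu fv) => Dgx; apply: isnP Dgx Dgy.
Qed.
Definition isn_mul f g := Isn (isn_mul_proof f g).

Lemma isn_one_proof : pinj [ffun x => Some x].
Proof. by apply: pinjI => x y z; rewrite !ffunE => [[->] [->]]. Qed.
Definition isn_one := Isn isn_one_proof.

Lemma isn_mulA : associative isn_mul.
Proof.
by move=> f g h; apply/val_inj/ffunP => x; rewrite !ffunE; case: (h x) => //= y;
  rewrite ffunE.
Qed.
Lemma isn_mul1l : left_id isn_one isn_mul.
Proof.
by move=> f; apply/val_inj/ffunP => x; rewrite !ffunE; case: (f x) => //= y;
  rewrite ffunE.
Qed.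
Lemma isn_mul1r : right_id isn_one isn_mul.
Proof. by move=> f; apply/val_inj/ffunP => x; rewrite !ffunE /= ?ffunE. Qed.
HB.instance Definition _ := isMonoid.Build isn isn_mulA isn_mul1l isn_mul1r.

Lemma isnM f g x : (f * g)%g x = obind f (g x).
Proof. by rewrite [LHS]ffunE. Qed.
Lemma isn1 x : (1%g : isn) x = Some x.
Proof. by rewrite [LHS]ffunE. Qed.

Definition isn_dom f : {set 'I_n} := [set x | isSome (f x)].

Lemma isn_domM f g : isn_dom (f * g)%g \subset isn_dom g.
Proof. by apply/subsetP => x; rewrite !inE isnM; case: (g x). Qed.

End InverseSemigroup.

(* Points are numbered from 0, so the initial segment of size k is x < k. *)
Definition lcell_pred (n k : nat) (f : isn n) : bool :=
  isn_dom f == [set x : 'I_n | x < k]%N.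
Definition lcell (n k : nat) : finType := {f : isn n | lcell_pred k f}.

Section Reps.
Variable F : fieldType.

(* A finite-dimensional left module over the monoid algebra F[M]. *)
Record rep (M : monoidType) := Rep {
  rspace :> vectType F;
  ract : M -> 'End(rspace);
  ract1 : ract 1%g = \1%VF;
  ractM : forall x y, ract (x * y)%g = (ract x \o ract y)%VF }.

Section Modules.
Variable M : monoidType.
Implicit Types V W N : rep M.

Definition stable V (U : {vspace V}) : Prop :=
  forall x, (ract V x @: U <= U)%VS.

Lemma stableP V (U : {vspace V}) :
  stable U <-> (forall x v, v \in U -> ract V x v \in U).
Proof.
split=> [stU x v Uv | stU x].
  by apply: (subvP (stU x)); rewrite memv_img.
by apply/subvP => _ /memv_imgP[v Uv ->]; apply: stU.
Qed.

Section Sub.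
Variables (V : rep M) (U : {vspace V}) (stU : stable U).

Definition subrep_act (x : M) : 'End(subvs_of U) :=
  (linfun (@vsproj _ _ U) \o ract V x \o linfun (@vsval _ _ U))%VF.

Lemma subrep_actE x (u : subvs_of U) : vsval (subrep_act x u) = ract V x (vsval u).
Proof.
rewrite !comp_lfunE !lfunE /= vsprojK //.
by apply: (proj1 (stableP U) stU); apply: subvsP.
Qed.

Lemma subrep_act1 : subrep_act 1%g = \1%VF.
Proof. by apply/lfunP => u; apply: val_inj; rewrite /= subrep_actE ract1 !lfunE. Qed.
Lemma subrep_actM x y : subrep_act (x * y)%g = (subrep_act x \o subrep_act y)%VF.
Proof.
apply/lfunP => u; apply: val_inj.
by rewrite /= comp_lfunE !subrep_actE ractM comp_lfunE.
Qed.
Definition subrep : rep M := Rep subrep_act1 subrep_actM.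
End Sub.

(* The quotient V / U is realized on the complement U^C, via the projection
   onto U^C along U. *)
Section Quot.
Variables (V : rep M) (U : {vspace V}) (stU : stable U).

Definition qproj : 'Hom(V, subvs_of (U^C)%VS) :=
  (linfun (@vsproj _ _ (U^C)%VS) \o daddv_pi (U^C)%VS U)%VF.

Lemma capCv : (U^C :&: U = 0)%VS.
Proof. by rewrite capvC capv_compl. Qed.

Lemma val_qproj v : vsval (qproj v) = daddv_pi (U^C)%VS U v.
Proof. by rewrite comp_lfunE lfunE /= vsprojK ?memv_pi. Qed.

Lemma qproj_val w : qproj (vsval w) = w.
Proof.
by apply: val_inj; rewrite /= val_qproj daddv_pi_id ?capCv //; apply: subvsP.
Qed.

Lemma sub_qproj v : v - vsval (qproj v) \in U.
Proof.
have UCv : v \in (U^C + U)%VS by rewrite addvC addv_complf memvf.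
rewrite val_qproj -{1}(daddv_pi_add capCv UCv).
by rewrite [X in X - _]addrC addrK memv_pi.
Qed.

Lemma qproj_eq0 v : v \in U -> qproj v = 0.
Proof.
move=> Uv; have UCv : vsval (qproj v) \in (U :&: U^C)%VS.
  rewrite memv_cap subvsP andbT -[X in X \in U](subKr v).
  by rewrite memvB // sub_qproj.
by apply: val_inj; move: UCv; rewrite capv_compl memv0 => /eqP.
Qed.

Definition quorep_act (x : M) : 'End(subvs_of (U^C)%VS) :=
  (qproj \o ract V x \o linfun (@vsval _ _ (U^C)%VS))%VF.

Lemma quorep_act_qproj x v : quorep_act x (qproj v) = qproj (ract V x v).
Proof.
rewrite /quorep_act comp_lfunE (comp_lfunE qproj) (lfunE (vsval (U := _))) /=.
have: qproj (ract V x (v - vsval (qproj v))) = 0.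
  by apply/qproj_eq0/(proj1 (stableP U) stU)/sub_qproj.
by rewrite !linearB => /eqP; rewrite subr_eq0 => /eqP.
Qed.

Lemma quorep_act1 : quorep_act 1%g = \1%VF.
Proof. by apply/lfunP => w; rewrite -(qproj_val w) quorep_act_qproj ract1 !lfunE. Qed.
Lemma quorep_actM x y : quorep_act (x * y)%g = (quorep_act x \o quorep_act y)%VF.
Proof.
apply/lfunP => w; rewrite -(qproj_val w) comp_lfunE !quorep_act_qproj.
by rewrite ractM comp_lfunE.
Qed.
Definition quorep : rep M := Rep quorep_act1 quorep_actM.
End Quot.

Definition rep_iso V W : Prop :=
  exists f : 'Hom(V, W),
    [/\ lker f = 0%VS, limg f = fullv
      & forall x v, f (ract V x v) = ract W x (f v)].

Definition rep_simple V : Prop :=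
  (fullv : {vspace V}) <> 0%VS /\
  forall U : {vspace V}, stable U -> U = 0%VS \/ U = fullv.

(* V has a decomposition into simple submodules of which exactly r are
   isomorphic to N. *)
Definition has_mult V N (r : nat) : Prop :=
  exists (p : nat) (U : 'I_p -> {vspace V}) (stU : forall i, stable (U i)),
    [/\ directv (\sum_(i < p) U i), (\sum_(i < p) U i)%VS = fullv,
        forall i, rep_simple (subrep (stU i))
      & #|[set i | `[< rep_iso (subrep (stU i)) N >]]| = r].

(* The multiplicity of the simple module N in the semisimple module V (by the
   Krull-Schmidt theorem, [has_mult V N] holds of exactly one number; the
   default value 0 is only used when V is not semisimple). *)
Definition mult V N : nat := classical_sets.xget 0%N (has_mult V N).

End Modules.

(* V (x) W is realized as matrices in the coordinates [v2r] of V and W. *)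
Section Tensor.
Variables V W : vectType F.

Definition tens : vectType F := 'M[F]_(dim V, dim W).

Definition pure_tens (v : V) (w : W) : tens := (v2r v)^T *m v2r w.

Definition tens_fun (f : 'End(V)) (g : 'End(W)) (A : tens) : tens :=
  (f2mx f)^T *m A *m f2mx g.
Lemma tens_fun_linear f g : linear (tens_fun f g).
Proof.
move=> a A B; rewrite /tens_fun mulmxDr mulmxDl.
by rewrite -scalemxAr -scalemxAl.
Qed.
HB.instance Definition _ f g :=
  GRing.isLinear.Build F tens tens _ (tens_fun f g) (tens_fun_linear f g).

Definition tens_end f g : 'End(tens) := linfun (tens_fun f g).

Lemma f2mxE (V1 V2 : vectType F) (f : 'Hom(V1, V2)) v :
  v2r (f v) = v2r v *m f2mx f.
Proof. by rewrite unlock /= r2vK. Qed.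

Lemma tens_end_pure f g v w :
  tens_end f g (pure_tens v w) = pure_tens (f v) (g w).
Proof. by rewrite lfunE /= /tens_fun /pure_tens !f2mxE trmx_mul !mulmxA. Qed.

Lemma f2mx_comp (V1 V2 V3 : vectType F) (f : 'Hom(V2, V3)) (g : 'Hom(V1, V2)) :
  f2mx (f \o g)%VF = f2mx g *m f2mx f.
Proof.
apply/row_matrixP => i; rewrite !rowE.
by rewrite -[delta_mx _ _]r2vK -f2mxE mulmxA -!f2mxE comp_lfunE.
Qed.

Lemma f2mx1 (V1 : vectType F) : f2mx (\1%VF : 'End(V1)) = 1%:M.
Proof.
apply/row_matrixP => i; rewrite !rowE.
by rewrite -[delta_mx _ _]r2vK -f2mxE mulmx1 lfunE.
Qed.

Lemma tens_end1 : tens_end \1%VF \1%VF = \1%VF.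
Proof.
by apply/lfunP => A; rewrite !lfunE /= /tens_fun !f2mx1 trmx1 mul1mx mulmx1.
Qed.

Lemma tens_endM f f' g g' :
  tens_end (f \o f')%VF (g \o g')%VF = (tens_end f g \o tens_end f' g')%VF.
Proof.
apply/lfunP => A; rewrite comp_lfunE !lfunE /= /tens_fun !f2mx_comp.
by rewrite trmx_mul !mulmxA.
Qed.

End Tensor.

Section TensorReps.

Section Inner.
Variables (M : monoidType) (V W : rep M).
Definition inner_act (x : M) := tens_end (ract V x) (ract W x).
Lemma inner_act1 : inner_act 1%g = \1%VF.
Proof. by rewrite /inner_act !ract1 tens_end1. Qed.
Lemma inner_actM x y : inner_act (x * y)%g = (inner_act x \o inner_act y)%VF.
Proof. by rewrite /inner_act !ractM tens_endM. Qed.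
Definition inner_tens : rep M := Rep inner_act1 inner_actM.
End Inner.

Section Outer.
Variables (G H : finGroupType) (V : rep G) (W : rep H).
Definition outer_act (x : (G * H)%type) := tens_end (ract V x.1) (ract W x.2).
Lemma outer_act1 : outer_act 1%g = \1%VF.
Proof. by rewrite /outer_act !ract1 tens_end1. Qed.
Lemma outer_actM x y : outer_act (x * y)%g = (outer_act x \o outer_act y)%VF.
Proof. by rewrite /outer_act !ractM tens_endM. Qed.
Definition outer_tens : rep (G * H)%type := Rep outer_act1 outer_actM.
End Outer.

(* F[M]-F[H]-bimodules; [bright h] is the map a |-> a h. *)
Record bimod (M : monoidType) (H : finGroupType) := Bimod {
  bleft :> rep M;
  bright : H -> 'End(bleft);
  bright1 : bright 1%g = \1%VF;
  brightM : forall g h, bright (g * h)%g = (bright h \o bright g)%VF;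
  bcomm : forall x h, (ract bleft x \o bright h)%VF = (bright h \o ract bleft x)%VF }.

(* A (x)_{F[H]} V, as the quotient of A (x) V by the span of the elements
   (a h) (x) v - a (x) (h v). *)
Section Balanced.
Variables (M : monoidType) (H : finGroupType) (A : bimod M H) (V : rep H).

Definition left_act (x : M) := tens_end (ract A x) (\1%VF : 'End(V)).
Lemma left_act1 : left_act 1%g = \1%VF.
Proof. by rewrite /left_act !ract1 tens_end1. Qed.
Lemma left_actM x y : left_act (x * y)%g = (left_act x \o left_act y)%VF.
Proof. by rewrite /left_act ractM -tens_endM comp_lfun1l. Qed.
Definition left_tens : rep M := Rep left_act1 left_actM.

Definition bal_rel : {vspace left_tens} :=
  (\sum_(h : H) limg (tens_end (bright A h) \1%VF - tens_end \1%VF (ract V h)))%VS.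

Lemma bal_rel_stable : stable bal_rel.
Proof.
move=> x; rewrite limg_sum; apply/subv_sumP => h _.
apply: subv_trans (sumv_sup h _ (subvv _)) => //.
apply/subvP => _ /memv_imgP[_ /memv_imgP[A0 _ ->] ->].
rewrite /= -comp_lfunE /left_act comp_lfunDr comp_lfunNr -!tens_endM.
rewrite !(comp_lfun1l, comp_lfun1r) bcomm.
have -> : tens_end (ract A x) (ract V h)
        = (tens_end \1%VF (ract V h) \o tens_end (ract A x) \1%VF)%VF.
  by rewrite -tens_endM comp_lfun1l comp_lfun1r.
have -> : tens_end (bright A h \o ract A x)%VF \1%VF
        = (tens_end (bright A h) \1%VF \o tens_end (ract A x) (\1%VF : 'End(V)))%VF.
  by rewrite -tens_endM comp_lfun1l.
by rewrite -comp_lfunNl -comp_lfunDl comp_lfunE memv_img ?memvf.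
Qed.

Definition bal_tens : rep M := quorep bal_rel_stable.
End Balanced.

End TensorReps.

(* The vector space with basis X, and the linear extension of a partial map
   X -> Y: a basis vector outside the domain is sent to 0. *)
Section Free.

Definition free (X : finType) : vectType F := {ffun X -> F^o}.
Definition ket (X : finType) (x : X) : free X := [ffun y => (x == y)%:R].

Section PartialMap.
Variables (X Y : finType) (phi : X -> option Y).

Definition lin_pmap_fun (v : free X) : free Y :=
  [ffun y => \sum_(x | phi x == Some y) (v : {ffun X -> F^o}) x].
Lemma lin_pmap_linear : linear lin_pmap_fun.
Proof.
move=> a u v; apply/ffunP => y; rewrite !ffunE scaler_sumr -big_split /=.
by apply: eq_bigr => x _; rewrite !ffunE.
Qed.
HB.instance Definition _ :=
  GRing.isLinear.Build F (free X) (free Y) _ lin_pmap_fun lin_pmap_linear.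

Definition lin_pmap : 'Hom(free X, free Y) := linfun lin_pmap_fun.

Lemma lin_pmap_ket x :
  lin_pmap (ket x) = if phi x is Some y then ket y else 0.
Proof.
rewrite lfunE /=; apply/ffunP => y; rewrite ffunE big_mkcond (bigD1 x) //=.
rewrite big1 ?addr0 => [|z /negbTE zx]; last by rewrite ffunE (eq_sym x) zx if_same.
by rewrite ffunE eqxx; case: (phi x) => [z|]; rewrite !ffunE // (inj_eq Some_inj);
  case: eqP.
Qed.
End PartialMap.

Lemma free_expand (X : finType) (v : free X) :
  v = \sum_x (v : {ffun X -> F^o}) x *: ket x.
Proof.
apply/ffunP => y; rewrite sum_ffunE (bigD1 y) //= !ffunE eqxx big1 ?addr0.
  by rewrite /GRing.scale /= mulr1.
by move=> z /negbTE zy; rewrite !ffunE zy scaler0.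
Qed.

Lemma ket_lfunP (X : finType) (V : vectType F) (f g : 'Hom(free X, V)) :
  (forall x, f (ket x) = g (ket x)) -> f = g.
Proof.
move=> fg; apply/lfunP => v; rewrite (free_expand v) !linear_sum.
by apply: eq_bigr => x _; rewrite !linearZ /= fg.
Qed.

Lemma lin_pmap_comp (X Y Z : finType) (phi : X -> option Y) (psi : Y -> option Z) :
  lin_pmap (fun x => obind psi (phi x)) = (lin_pmap psi \o lin_pmap phi)%VF.
Proof.
apply: ket_lfunP => x; rewrite comp_lfunE !lin_pmap_ket.
by case: (phi x) => [y|] /=; rewrite ?lin_pmap_ket ?linear0.
Qed.

Lemma lin_pmap_id (X : finType) : lin_pmap (@Some X) = \1%VF.
Proof. by apply: ket_lfunP => x; rewrite lin_pmap_ket lfunE. Qed.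

Lemma eq_lin_pmap (X Y : finType) (phi psi : X -> option Y) :
  phi =1 psi -> lin_pmap phi = lin_pmap psi.
Proof. by move=> E; apply: ket_lfunP => x; rewrite !lin_pmap_ket E. Qed.

End Free.

Section Specht.
Variable n : nat.

(* A tabloid is encoded by the function sending each entry to its row index;
   s in S_n sends the tabloid r to r o s^-1. *)
Definition tabloid : finType := {ffun 'I_n -> 'I_n}.

Definition tabloid_act (s : symg n) (r : tabloid) : tabloid :=
  [ffun x => r ((s^-1)%g x)].

Definition tabloid_lin (s : symg n) : 'End(free tabloid) :=
  lin_pmap (fun r => Some (tabloid_act s r)).

Lemma tabloid_act1 r : tabloid_act 1%g r = r.
Proof. by apply/ffunP => x; rewrite ffunE invg1 sperm1. Qed.
Lemma tabloid_actM s t r :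
  tabloid_act (s * t)%g r = tabloid_act s (tabloid_act t r).
Proof. by apply/ffunP => x; rewrite !ffunE invMg spermM. Qed.

Lemma tabloid_lin1 : tabloid_lin 1%g = \1%VF.
Proof.
by rewrite -lin_pmap_id; apply: eq_lin_pmap => r; rewrite tabloid_act1.
Qed.
Lemma tabloid_linM s t :
  tabloid_lin (s * t)%g = (tabloid_lin s \o tabloid_lin t)%VF.
Proof.
by rewrite -lin_pmap_comp; apply: eq_lin_pmap => r /=; rewrite tabloid_actM.
Qed.
Definition tabloid_rep : rep (symg n) := Rep tabloid_lin1 tabloid_linM.

Variable lam : seq nat.

(* A lam-tableau is encoded by the function sending each entry to its cell
   (row, column) in the diagram of lam (all indices start at 0); when lam is a
   partition of n an injective such function is a bijection. *)
Definition tableau_pred (t : {ffun 'I_n -> 'I_n * 'I_n}) : bool :=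
  injectiveb t && [forall x, (t x).2 < nth 0 lam (t x).1]%N.
Definition tableau : finType := {t : {ffun 'I_n -> 'I_n * 'I_n} | tableau_pred t}.

Implicit Types t : tableau.

Definition rows_of t : tabloid := [ffun x => (val t x).1].
Definition col_stab t : {set symg n} :=
  [set s : symg n | [forall x, (val t (s x)).2 == (val t x).2]].

Definition polytabloid t : free tabloid :=
  \sum_(s in col_stab t) (-1) ^+ odd_perm s *: ket (tabloid_act s (rows_of t)).

Definition specht_space : {vspace tabloid_rep} :=
  <<[seq polytabloid t | t : tableau]>>%VS.

Lemma tableau_act_proof (s : symg n) t :
  tableau_pred [ffun x => val t ((s^-1)%g x)].
Proof.
have /andP[/injectiveP t_inj /forallP t_in] := valP t.
apply/andP; split; last by apply/forallP => x; rewrite ffunE.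
apply/injectiveP => x y; rewrite !ffunE => /t_inj E.
by rewrite -(spermKV s x) E spermKV.
Qed.
Definition tableau_act s t : tableau := Sub _ (tableau_act_proof s t).

Lemma polytabloid_act s t :
  tabloid_lin s (polytabloid t) = polytabloid (tableau_act s t).
Proof.
rewrite linear_sum /polytabloid.
rewrite [RHS](reindex_inj (h := fun u : symg n => (s * u * s^-1)%g)) /=; last first.
  by move=> u v /mulIg/mulgI.
apply: eq_big => [u | u _].
  rewrite !inE; apply/forallP/forallP => H x.
    by rewrite !ffunE !spermM spermVK.
  by have := H (s x); rewrite !ffunE !spermM !spermVK.
rewrite linearZ /= lin_pmap_ket !odd_spermM odd_spermV addbAC addbb addFb.
congr (_ *: ket _).
apply/ffunP => x; rewrite !ffunE !invMg invgK !spermM; congr (val t _).1.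
by rewrite spermVK.
Qed.

Lemma specht_stable : stable specht_space.
Proof.
move=> s; rewrite limg_span; apply/span_subvP => _ /mapP[_ /mapP[t _ ->] ->].
by rewrite /= polytabloid_act memv_span // map_f ?mem_enum.
Qed.

Definition specht : rep (symg n) := subrep specht_stable.
End Specht.

Definition kronecker (n : nat) (lam mu nu : seq nat) : nat :=
  mult (inner_tens (specht n lam) (specht n mu)) (specht n nu).

Section Young.
Variables n m : nat.

Definition young_fun (h : (symg n * symg m)%type) (x : 'I_(n + m)) : 'I_(n + m) :=
  match fintype.split x with
  | inl i => lshift m (h.1 i)
  | inr j => rshift n (h.2 j)
  end.

Lemma young_fun1 x : young_fun 1%g x = x.
Proof.
by rewrite /young_fun -[RHS]splitK; case: fintype.split => i /=; rewrite sperm1.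
Qed.
Lemma young_funM g h x : young_fun (g * h)%g x = young_fun g (young_fun h x).
Proof.
rewrite /young_fun; case: (fintype.split x) => i /=; rewrite spermM.
  by rewrite (unsplitK (inl _)).
by rewrite (unsplitK (inr _)).
Qed.
Lemma young_inj h : injective (young_fun h).
Proof.
by move=> x y /(congr1 (young_fun h^-1)%g); rewrite -!young_funM mulVg !young_fun1.
Qed.

Definition young (h : (symg n * symg m)%type) : symg (n + m) := perm (@young_inj h).

Lemma young1 : young 1%g = 1%g.
Proof. by apply/permP => x; rewrite permE young_fun1 [RHS]sperm1. Qed.
Lemma youngM g h : young (g * h)%g = (young g * young h)%g.
Proof. by apply/permP => x; rewrite [RHS]spermM !permE young_funM. Qed.

Definition reg_left (s : symg (n + m)) : 'End(free (symg (n + m))) :=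
  lin_pmap (fun u => Some (s * u)%g).
Definition reg_right (h : (symg n * symg m)%type) : 'End(free (symg (n + m))) :=
  lin_pmap (fun u => Some (u * young h)%g).

Lemma reg_left1 : reg_left 1%g = \1%VF.
Proof. by rewrite -lin_pmap_id; apply: eq_lin_pmap => u; rewrite mul1g. Qed.
Lemma reg_leftM s t : reg_left (s * t)%g = (reg_left s \o reg_left t)%VF.
Proof. by rewrite -lin_pmap_comp; apply: eq_lin_pmap => u /=; rewrite mulgA. Qed.
Definition reg_rep := Rep reg_left1 reg_leftM.

Lemma reg_right1 : reg_right 1%g = \1%VF.
Proof. by rewrite -lin_pmap_id; apply: eq_lin_pmap => u; rewrite young1 mulg1. Qed.
Lemma reg_rightM g h : reg_right (g * h)%g = (reg_right h \o reg_right g)%VF.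
Proof.
by rewrite -lin_pmap_comp; apply: eq_lin_pmap => u /=; rewrite youngM mulgA.
Qed.
Lemma reg_comm s h : (reg_left s \o reg_right h)%VF = (reg_right h \o reg_left s)%VF.
Proof. by rewrite -!lin_pmap_comp; apply: eq_lin_pmap => u /=; rewrite mulgA. Qed.

(* F[S_(n+m)] as an F[S_(n+m)]-F[S_n x S_m]-bimodule. *)
Definition young_bimod : bimod (symg (n + m)) (symg n * symg m)%type :=
  @Bimod _ _ reg_rep reg_right reg_right1 reg_rightM reg_comm.

Definition young_ind (V : rep (symg n * symg m)%type) : rep (symg (n + m)) :=
  bal_tens young_bimod V.

Definition lrcoef (lam mu nu : seq nat) : nat :=
  mult (young_ind (outer_tens (specht n lam) (specht m mu))) (specht (n + m) nu).
End Young.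

Section CellModule.
Variables (n k : nat) (hk : (k <= n)%N).

Definition cell_left_map (f : isn n) (p : lcell n k) : option (lcell n k) :=
  insub (f * val p)%g.
Definition cell_left (f : isn n) : 'End(free (lcell n k)) :=
  lin_pmap (cell_left_map f).

(* s in S_k as a bijection of the initial segment of size k. *)
Definition isn_of_sym_fun (s : symg k) : {ffun 'I_n -> option 'I_n} :=
  [ffun x : 'I_n => omap (fun i : 'I_k => widen_ord hk (s i)) (insub (x : nat))].

Lemma isn_of_sym_proof s : pinj (isn_of_sym_fun s).
Proof.
apply: pinjI => x y z; rewrite !ffunE.
case: insubP => [i _ ix|] //= [<-]; case: insubP => [j _ jy|] //= [].
move=> /ord_inj/perm_inj ji; apply: val_inj.
by rewrite /= -ix -jy ji.
Qed.
Definition isn_of_sym s : isn n := Isn (isn_of_sym_proof s).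

Lemma lcell_dom (p : lcell n k) (x : 'I_n) : isSome (val p x) = (x < k)%N.
Proof. by have /eqP/setP/(_ x) := valP p; rewrite !inE. Qed.

Lemma isn_of_sym_lt s (x : 'I_n) (hx : (x < k)%N) :
  isn_of_sym s x = Some (widen_ord hk (s (Ordinal hx))).
Proof. by rewrite ffunE insubT. Qed.
Lemma isn_of_sym_ge s (x : 'I_n) : ~~ (x < k)%N -> isn_of_sym s x = None.
Proof. by move=> hx; rewrite ffunE insubN. Qed.

Lemma cell_right_proof (p : lcell n k) (s : symg k) :
  lcell_pred k (val p * isn_of_sym s)%g.
Proof.
apply/eqP/setP => x; rewrite !inE isnM.
case: (boolP (x < k)%N) => hx; last by rewrite isn_of_sym_ge.
by rewrite isn_of_sym_lt /= lcell_dom /= ltn_ord.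
Qed.
Definition cell_right_map (s : symg k) (p : lcell n k) : lcell n k :=
  Sub _ (cell_right_proof p s).
Definition cell_right (s : symg k) : 'End(free (lcell n k)) :=
  lin_pmap (fun p => Some (cell_right_map s p)).

Lemma cell_left1 : cell_left 1%g = \1%VF.
Proof.
rewrite -lin_pmap_id; apply: eq_lin_pmap => p.
by rewrite /cell_left_map mul1g valK.
Qed.

Lemma cell_leftM f g : cell_left (f * g)%g = (cell_left f \o cell_left g)%VF.
Proof.
rewrite -lin_pmap_comp; apply: eq_lin_pmap => p.
rewrite /cell_left_map; case: (insubP _ (g * val p)%g) => [q _ Dq | gp] /=.
  by rewrite Dq mulgA.
rewrite insubN // -mulgA; apply: contra gp => /eqP fgp.
apply/eqP/eqP; rewrite eqEsubset; apply/andP; split.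
  by apply: subset_trans (isn_domM _ _) _; rewrite (eqP (valP p)).
by apply: subset_trans _ (isn_domM f _); rewrite fgp.
Qed.
Definition cell_rep : rep (isn n) := Rep cell_left1 cell_leftM.

Lemma isn_of_symM s t : isn_of_sym (s * t)%g = (isn_of_sym s * isn_of_sym t)%g.
Proof.
apply/val_inj/ffunP => x; rewrite [RHS]isnM.
case: (boolP (x < k)%N) => hx; last by rewrite !isn_of_sym_ge.
rewrite !(isn_of_sym_lt _ hx) /=.
have hy : (widen_ord hk (t (Ordinal hx)) < k)%N := ltn_ord (t (Ordinal hx)).
rewrite (isn_of_sym_lt s hy) spermM; congr (Some (widen_ord hk (s _))).
exact: val_inj.
Qed.

Lemma cell_right1 : cell_right 1%g = \1%VF.
Proof.
rewrite -lin_pmap_id; apply: eq_lin_pmap => p; congr Some; apply: val_inj => /=.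
apply/val_inj/ffunP => x; rewrite [LHS]isnM.
case: (boolP (x < k)%N) => hx.
  by rewrite isn_of_sym_lt /= sperm1; congr (val p _); apply: val_inj.
by rewrite isn_of_sym_ge //=; move: hx; rewrite -(lcell_dom p); case: (val p x).
Qed.
Lemma cell_rightM s t : cell_right (s * t)%g = (cell_right t \o cell_right s)%VF.
Proof.
rewrite -lin_pmap_comp; apply: eq_lin_pmap => p; congr Some; apply: val_inj => /=.
by rewrite isn_of_symM mulgA.
Qed.

Lemma cell_comm f s :
  (cell_left f \o cell_right s)%VF = (cell_right s \o cell_left f)%VF.
Proof.
rewrite -!lin_pmap_comp; apply: eq_lin_pmap => p; rewrite /cell_left_map /=.
rewrite mulgA; case: (insubP _ (f * val p)%g) => [q _ Dq | fp] /=.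
  have -> : (f * val p * isn_of_sym s)%g = val (cell_right_map s q) by rewrite /= Dq.
  by rewrite valK.
rewrite insubN //; apply: contra fp => /eqP fps.
apply/eqP/eqP; rewrite eqEsubset; apply/andP; split.
  by apply: subset_trans (isn_domM _ _) _; rewrite (eqP (valP p)).
apply/subsetP => x; rewrite inE => hx.
set i := (s^-1)%g (Ordinal hx).
have hi : (widen_ord hk i < k)%N := ltn_ord i.
have /setP/(_ (widen_ord hk i)) := fps.
rewrite !inE hi (isnM (f * val p)%g) (isn_of_sym_lt s hi) /=.
have -> : Ordinal hi = i by apply: val_inj.
by rewrite spermKV; have -> : widen_ord hk (Ordinal hx) = x by apply: val_inj.
Qed.

Definition cell_bimod : bimod (isn n) (symg k) :=
  @Bimod _ _ cell_rep cell_right cell_right1 cell_rightM cell_comm.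

Definition isn_simple (lam : seq nat) : rep (isn n) :=
  bal_tens cell_bimod (specht k lam).
End CellModule.

End Reps.

Arguments specht F n lam : clear implicits.
Arguments kronecker F n lam mu nu : clear implicits.
Arguments lrcoef F n m lam mu nu : clear implicits.
Arguments isn_simple F [n k] hk lam.

(* Main.v *)
(* Everything is computed with traces in F.  If the monoid algebra has a
   separability idempotent \sum_i L_i (x) R_i, then its modules are semisimple
   and the multiplicity of a simple module N with scalar endomorphisms in V is
   \sum_i tr_V(L_i) tr_N(R_i).  For a finite group take 1/|G| \sum_g g (x) g^-1;
   for IS_n, Moebius inversion over the partial identities e_B gives the
   idempotent \sum_k 1/k! \sum_(p in L_k) p f_k (x) f_k p^-1, where
   f_k = \sum_(B <= [k]) (-1)^(k - |B|) e_B.  Hence the multiplicity of N^nu in V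
   is the multiplicity of S^nu in the S_m-module f_m V.  For V = N^lam (x) N^mu
   the character of f_m V at s counts, with weights chi_lam(h) chi_mu(h'), the
   jointly surjective pairs of injections f : [k] -> [m], g : [l] -> [m] with
   s f = f h and s g = g h'.  There are none outside max(k,l) <= m <= k + l;
   otherwise S_m x S_k x S_l permutes these pairs transitively with point
   stabilizer S_a x S_b x S_c, so that the multiplicity is the average of
   chi_nu(xyz) chi_lam((xy)^-1) chi_mu((zy)^-1) over S_a x S_b x S_c.  The sum of
   products of coefficients has the same value because the Specht characters
   form an orthonormal basis of the class functions of S_n: they are orthonormal
   by the column antisymmetrizers, and there are at least as many of them as
   cycle types. *)
Require Import Defs.
From mathcomp Require Import all_boot all_order all_algebra all_fingroup.
From HB Require Import structures.
From mathcomp Require Import boolp.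
From mathcomp Require classical_sets.
(* Imported again because [action.v] also defines [ract]. *)
Require Import Defs.
Set Implicit Arguments.
Unset Strict Implicit.
Unset Printing Implicit Defensive.
Import GRing.Theory VectorInternalTheory.
Local Open Scope ring_scope.

(** * Traces of endomorphisms *)

Section Trace.
Variable F : fieldType.
Implicit Types V W U : vectType F.

Definition lftrace V (f : 'End(V)) : F := \tr (f2mx f).

Lemma f2mxD V W (f g : 'Hom(V, W)) : f2mx (f + g) = f2mx f + f2mx g.
Proof.
by apply/row_matrixP => i; rewrite !rowE mulmxDr -[delta_mx _ _]r2vK -!f2mxE
  add_lfunE linearD.
Qed.
Lemma f2mxZ V W a (f : 'Hom(V, W)) : f2mx (a *: f) = a *: f2mx f.
Proof.
by apply/row_matrixP => i; rewrite !rowE -scalemxAr -[delta_mx _ _]r2vK -!f2mxE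
  scale_lfunE linearZ.
Qed.

Lemma lftrace_linear V : linear (@lftrace V : 'End(V) -> F^o).
Proof. by move=> a f g; rewrite /lftrace f2mxD f2mxZ linearP. Qed.
HB.instance Definition _ V :=
  GRing.isLinear.Build F 'End(V) F^o _ (@lftrace V) (@lftrace_linear V).

Lemma lftrace_sum V (I : Type) (r : seq I) (P : pred I) (f : I -> 'End(V)) :
  lftrace (\sum_(i <- r | P i) f i) = \sum_(i <- r | P i) lftrace (f i).
Proof. exact: (linear_sum (@lftrace V : {linear 'End(V) -> F^o})). Qed.

Lemma lftraceZ V a (f : 'End(V)) : lftrace (a *: f) = a * lftrace f.
Proof. exact: (linearZ_LR (@lftrace V : {linear 'End(V) -> F^o})). Qed.

Lemma lftraceC V W (f : 'Hom(V, W)) (g : 'Hom(W, V)) :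
  lftrace (f \o g)%VF = lftrace (g \o f)%VF.
Proof. by rewrite /lftrace !f2mx_comp mxtrace_mulC. Qed.

Section Dual.
Variables (V : vectType F) (I : finType) (b : I -> V) (c : I -> V -> F^o).
Hypothesis c_lin : forall i, linear (c i).
Hypothesis cb : forall v, v = \sum_i c i v *: b i.
HB.instance Definition _ i := GRing.isLinear.Build F V F^o _ (c i) (c_lin i).

(* Only the expansion of v in the b_i is needed: the b_i may be linearly dependent. *)
Lemma lftrace_dual (f : 'End(V)) : lftrace f = \sum_i c i (f (b i)).
Proof.
transitivity (\sum_j v2r (f (r2v (delta_mx 0 j))) 0 j).
  by apply: eq_bigr => j _; rewrite f2mxE r2vK -rowE mxE.
under eq_bigr => j _ do rewrite [f _]cb linear_sum summxE.
rewrite exchange_big; apply: eq_bigr => i _ /=.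
have bE : b i = \sum_j v2r (b i) 0 j *: r2v (delta_mx 0 j).
  by rewrite -[LHS]v2rK {1}[v2r (b i)]row_sum_delta linear_sum;
    apply: eq_bigr => j _; rewrite linearZ.
rewrite [in RHS]bE !linear_sum; apply: eq_bigr => j _.
by rewrite !linearZ /= !mxE mulrC.
Qed.
End Dual.

Lemma mxtrace_lmul_delta m n (A : 'M[F]_m) (B : 'M[F]_n) :
  \sum_(ij : 'I_m * 'I_n) (A *m delta_mx ij.1 ij.2 *m B) ij.1 ij.2 = \tr A * \tr B.
Proof.
rewrite /mxtrace big_distrlr pair_bigA; apply: eq_bigr => -[i j] _ /=.
rewrite -(mul_delta_mx (0 : 'I_1)) !mulmxA -mulmxA -colE -rowE.
by rewrite mxE big_ord1 !mxE.
Qed.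

Lemma lftrace_tens V W (f : 'End(V)) (g : 'End(W)) :
  lftrace (tens_end f g) = lftrace f * lftrace g.
Proof.
pose b (ij : 'I_(dim V) * 'I_(dim W)) : tens V W := delta_mx ij.1 ij.2.
pose c (ij : 'I_(dim V) * 'I_(dim W)) (A : tens V W) : F^o :=
  (A : 'M_(_, _)) ij.1 ij.2.
rewrite (lftrace_dual (b := b) (c := c)).
- rewrite [in RHS]/lftrace -(mxtrace_tr (f2mx f)) -mxtrace_lmul_delta.
  by apply: eq_bigr => ij _; rewrite lfunE.
- by move=> ij a A B; rewrite /c !mxE.
by move=> A; rewrite [LHS]matrix_sum_delta pair_bigA.
Qed.

Lemma comp_lfun_suml U V W (I : Type) (r : seq I) (P : pred I)
    (f : I -> 'Hom(V, W)) (g : 'Hom(U, V)) :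
  ((\sum_(i <- r | P i) f i) \o g = \sum_(i <- r | P i) (f i \o g))%VF.
Proof.
apply/lfunP => u; rewrite comp_lfunE !sum_lfunE; apply: eq_bigr => i _.
by rewrite comp_lfunE.
Qed.

Lemma comp_lfun_sumr U V W (I : Type) (r : seq I) (P : pred I)
    (f : 'Hom(V, W)) (g : I -> 'Hom(U, V)) :
  (f \o (\sum_(i <- r | P i) g i) = \sum_(i <- r | P i) (f \o g i))%VF.
Proof.
apply/lfunP => u; rewrite comp_lfunE !sum_lfunE linear_sum.
by apply: eq_bigr => i _; rewrite /= comp_lfunE.
Qed.

Definition sandwich_fun V W (A : 'End(V)) (B : 'End(W)) (f : 'Hom(V, W)) :=
  (B \o f \o A)%VF.
Lemma sandwich_linear V W (A : 'End(V)) (B : 'End(W)) : linear (sandwich_fun A B).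
Proof.
move=> a f g; rewrite /sandwich_fun.
by rewrite comp_lfunDr comp_lfunDl -comp_lfunZr -comp_lfunZl.
Qed.
HB.instance Definition _ V W A B := GRing.isLinear.Build F 'Hom(V, W) 'Hom(V, W)
  _ (sandwich_fun A B) (sandwich_linear A B).

Lemma lftrace_sandwich V W (A : 'End(V)) (B : 'End(W)) :
  lftrace (linfun (sandwich_fun A B)) = lftrace A * lftrace B.
Proof.
pose b (ij : 'I_(dim V) * 'I_(dim W)) : 'Hom(V, W) :=
  Hom (delta_mx ij.1 ij.2).
pose c (ij : 'I_(dim V) * 'I_(dim W)) (f : 'Hom(V, W)) : F^o := f2mx f ij.1 ij.2.
rewrite (lftrace_dual (b := b) (c := c)).
- rewrite -mxtrace_lmul_delta; apply: eq_bigr => ij _.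
  by rewrite /c lfunE /= !f2mx_comp mulmxA.
- by move=> ij a f g; rewrite /c f2mxD f2mxZ !mxE.
move=> f; apply: val_inj => /=; rewrite [f2mx f in LHS]matrix_sum_delta pair_bigA.
elim/big_rec2: _ => [|ij C g _ ->]; last by rewrite f2mxD f2mxZ.
by apply/matrixP => i j; rewrite -(scale0r (0 : 'Hom(V, W))) f2mxZ !mxE mul0r.
Qed.

Lemma lftrace_pmap (X : finType) (phi : X -> option X) :
  lftrace (lin_pmap F phi) = #|[pred x | phi x == Some x]|%:R.
Proof.
rewrite (lftrace_dual (b := @ket F X) (c := fun x v => (v : {ffun X -> F^o}) x)).
- rewrite -sum1_card natr_sum [RHS]big_mkcond; apply: eq_bigr => x _.
  rewrite lin_pmap_ket inE; case: (phi x) => [y|]; rewrite !ffunE //.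
  by rewrite (inj_eq Some_inj); case: eqP.
- by move=> x a u v; rewrite !ffunE.
exact: free_expand.
Qed.

Lemma lftrace1 V : lftrace (\1%VF : 'End(V)) = (dim V)%:R.
Proof. by rewrite /lftrace f2mx1 mxtrace1. Qed.

Lemma lftrace_idem V (P : 'End(V)) : (P \o P)%VF = P -> lftrace P = (\dim (limg P))%:R.
Proof.
move=> PP; pose p : 'Hom(V, subvs_of (limg P)) := (linfun (@vsproj _ _ (limg P)) \o
  P)%VF.
pose i : 'Hom(subvs_of (limg P), V) := linfun (@vsval _ _ (limg P)).
have PE : P = (i \o p)%VF.
  by apply/lfunP => v; rewrite !comp_lfunE !lfunE /= vsprojK // memv_img ?memvf.
have pi : (p \o i)%VF = \1%VF.
  apply/lfunP => u; apply: val_inj; rewrite /= !comp_lfunE !lfunE /=.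
  have /memv_imgP[v _ uE] := subvsP u.
  by rewrite uE -comp_lfunE PP vsprojK // memv_img ?memvf.
by rewrite [in LHS]PE lftraceC pi lftrace1.
Qed.

Lemma natr_inj : [pchar F] =i pred0 -> injective (fun n : nat => n%:R : F).
Proof.
move=> /pcharf0P charF m n /=; wlog le_mn : m n / (m <= n)%N.
  by case: (leqP m n) => [le_mn|/ltnW le_nm] H E; [apply: H | apply/esym/H].
move=> E; apply/eqP; rewrite eqn_leq le_mn -subn_eq0 -charF natrB // E subrr.
exact: eqxx.
Qed.

End Trace.

(** * Semisimplicity and multiplicities *)

Section Separable.
Variables (F : fieldType) (M : monoidType).
Implicit Types V W N : rep F M.

Definition equivariant V W (f : 'Hom(V, W)) : Prop :=
  forall x, (f \o ract V x = ract W x \o f)%VF.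

(* A separability idempotent \sum_i L_i (x) R_i of the monoid algebra, presented
   by the natural action of the L_i and R_i on all modules. *)
Record sepsys := Sepsys {
  sindex : finType;
  sleft : forall V : rep F M, sindex -> 'End(V);
  sright : forall V : rep F M, sindex -> 'End(V);
  sleft_nat : forall V W (f : 'Hom(V, W)) i, equivariant f ->
    (f \o sleft V i = sleft W i \o f)%VF;
  sright_nat : forall V W (f : 'Hom(V, W)) i, equivariant f ->
    (f \o sright V i = sright W i \o f)%VF;
  sep_comm : forall V W (f : 'Hom(V, W)),
    equivariant (\sum_i (sleft W i \o f \o sright V i))%VF;
  sep_one : forall V, (\sum_i (sleft V i \o sright V i))%VF = \1%VF }.

Definition rep_incl V (U : {vspace V}) (stU : stable U) : 'Hom(subrep stU, V) :=
  linfun (@vsval _ _ U).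

Lemma rep_inclE V (U : {vspace V}) (stU : stable U) u : rep_incl stU u = vsval u.
Proof. by rewrite lfunE. Qed.

Lemma rep_incl_equivariant V (U : {vspace V}) (stU : stable U) :
  equivariant (rep_incl stU).
Proof.
move=> x; apply/lfunP => u.
by rewrite (comp_lfunE (rep_incl stU)) rep_inclE (comp_lfunE (ract V x)) rep_inclE;
  apply: subrep_actE.
Qed.

Lemma rep_incl_inj V (U : {vspace V}) (stU : stable U) : injective (rep_incl stU).
Proof. by move=> u v; rewrite !rep_inclE => /val_inj. Qed.

Definition irreducible_sub V (W : {vspace V}) : Prop :=
  [/\ stable W, W <> 0%VS
    & forall U : {vspace V}, stable U -> (U <= W)%VS -> U = 0%VS \/ U = W].

Lemma irreducible_subrep V (W : {vspace V}) (stW : stable W) :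
  irreducible_sub W -> rep_simple (subrep stW).
Proof.
case=> _ W0 irrW; set i := rep_incl stW; have i0 : lker i == 0%VS.
  by apply/lker0P; apply: rep_incl_inj.
split=> [full0|U stU].
  apply: W0; apply/eqP; rewrite -subv0; apply/subvP => w Ww.
  have: (vsproj W w : subrep stW) \in fullv by apply: memvf.
  rewrite full0 memv0 => /eqP/(congr1 (@vsval _ _ W)); rewrite vsprojK // => ->.
  exact: mem0v.
have sub_iW : (i @: U <= W)%VS.
  by apply/subvP => _ /memv_imgP[u _ ->]; rewrite /i rep_inclE; apply: subvsP.
have stiU : stable (i @: U)%VS.
  apply/stableP => x _ /memv_imgP[u Uu ->].
  rewrite -comp_lfunE -(rep_incl_equivariant stW x) comp_lfunE memv_img //.
  by apply: (proj1 (stableP U) stU).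
have [E|E] := irrW _ stiU sub_iW; [left | right]; apply/eqP.
  rewrite -subv0; apply/subvP => u Uu; have := memv_img i Uu.
  by rewrite E !memv0 => /eqP iu0; apply/eqP/(rep_incl_inj (stU := stW));
    rewrite -/i iu0 linear0.
rewrite eqEsubv subvf; apply/subvP => u _.
have : i u \in (i @: U)%VS by rewrite E /i rep_inclE; apply: subvsP.
by case/memv_imgP => v Uv /rep_incl_inj->.
Qed.

Section System.
Variable S : sepsys.

Definition avg V W (f : 'Hom(V, W)) : 'Hom(V, W) :=
  (\sum_(i : sindex S) (sleft W i \o f \o sright V i))%VF.

Lemma avg_linear V W : linear (@avg V W).
Proof.
move=> a f g; rewrite /avg scaler_sumr -big_split; apply: eq_bigr => i _ /=.
by rewrite comp_lfunDr comp_lfunDl -comp_lfunZr -comp_lfunZl.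
Qed.
HB.instance Definition _ V W :=
  GRing.isLinear.Build F 'Hom(V, W) 'Hom(V, W) _ (@avg V W) (@avg_linear V W).

Lemma avg_id V W (f : 'Hom(V, W)) : equivariant f -> avg f = f.
Proof.
move=> fE; rewrite /avg; under eq_bigr => i _ do rewrite -sleft_nat // -comp_lfunA.
by rewrite -[RHS]comp_lfun1r -(sep_one S V) comp_lfun_sumr.
Qed.

Definition homsp V W : {vspace 'Hom(V, W)} := limg (linfun (@avg V W)).

Lemma homspP V W (f : 'Hom(V, W)) : reflect (equivariant f) (f \in homsp V W).
Proof.
apply: (iffP memv_imgP) => [[g _ ->]|fE].
  by rewrite lfunE; apply: sep_comm.
by exists f; rewrite ?memvf // lfunE /= avg_id.
Qed.

(* The trace of the projector [avg] of Hom(V, W) onto the equivariant maps. *)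
Definition pairing V W : F := \sum_(i : sindex S) lftrace (sright V i) * lftrace
  (sleft W i).

Lemma pairing_dim V W : pairing V W = (\dim (homsp V W))%:R.
Proof.
rewrite -lftrace_idem; last first.
  apply/lfunP => f; rewrite comp_lfunE !(lfunE (@avg V W)) /= avg_id //.
  exact: sep_comm.
have -> : linfun (@avg V W) =
    \sum_(i : sindex S) linfun (sandwich_fun (sright V i) (sleft W i)).
  apply/lfunP => f; rewrite sum_lfunE lfunE; apply: eq_bigr => i _.
  by rewrite lfunE.
by rewrite lftrace_sum; apply: eq_bigr => i _; rewrite lftrace_sandwich.
Qed.

Lemma stable_left V (U : {vspace V}) i v :
  stable U -> v \in U -> sleft V (i : sindex S) v \in U.
Proof.
move=> stU Uv; have := rep_incl_equivariant stU =>
  /sleft_nat-/(_ S i)/lfunP/(_ (vsproj U v)).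
by rewrite (comp_lfunE (rep_incl stU)) (comp_lfunE (sleft V i)) !rep_inclE vsprojK //
  => <-; apply: subvsP.
Qed.

Lemma stable_right V (U : {vspace V}) i v :
  stable U -> v \in U -> sright V (i : sindex S) v \in U.
Proof.
move=> stU Uv; have := rep_incl_equivariant stU =>
  /sright_nat-/(_ S i)/lfunP/(_ (vsproj U v)).
by rewrite (comp_lfunE (rep_incl stU)) (comp_lfunE (sright V i)) !rep_inclE vsprojK
  // => <-; apply: subvsP.
Qed.

Lemma equivariant_projector V (U : {vspace V}) : stable U ->
  exists P : 'End(V), [/\ equivariant P, limg P = U & {in U, forall u, P u = u}].
Proof.
move=> stU; pose P := avg (projv U : 'Hom(V, V)).
have PU v : P v \in U.
  rewrite sum_lfunE memv_suml // => i _; rewrite !comp_lfunE.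
  by apply: stable_left => //; apply: memv_proj.
have Pid : {in U, forall u, P u = u}.
  move=> u Uu; rewrite sum_lfunE -[RHS](id_lfunE u) -(sep_one S V) sum_lfunE.
  apply: eq_bigr => i _; rewrite !comp_lfunE projv_id //; exact: stable_right.
exists P; split=> //; first exact: sep_comm.
apply/eqP; rewrite eqEsubv; apply/andP; split; apply/subvP => v.
  by case/memv_imgP => w _ ->.
by move=> Uv; rewrite -(Pid v Uv) memv_img ?memvf.
Qed.

Lemma stable_lker V W (f : 'Hom(V, W)) : equivariant f -> stable (lker f).
Proof.
move=> fE; apply/stableP => x v; rewrite !memv_ker => /eqP fv0.
by rewrite -comp_lfunE fE comp_lfunE fv0 linear0.
Qed.

Lemma stable_limg V W (f : 'Hom(V, W)) : equivariant f -> stable (limg f).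
Proof.
move=> fE; apply/stableP => x _ /memv_imgP[v _ ->].
by rewrite -comp_lfunE -fE comp_lfunE memv_img ?memvf.
Qed.

Lemma stable_cap V (U W : {vspace V}) : stable U -> stable W -> stable (U :&: W)%VS.
Proof.
move=> /stableP stU /stableP stW; apply/stableP => x v.
by rewrite !memv_cap => /andP[/stU-> /stW->].
Qed.

Lemma stable_complement V (U W : {vspace V}) : stable U -> stable W -> (W <= U)%VS ->
  exists W' : {vspace V}, [/\ stable W', (W + W')%VS = U & (W :&: W' = 0)%VS].
Proof.
move=> stU stW sWU; have [P [PE PW Pid]] := equivariant_projector stW.
exists (U :&: lker P)%VS; split; first exact/stable_cap/stable_lker.
  apply/eqP; rewrite eqEsubv subv_add sWU capvSl /=; apply/subvP => v Uv.
  have WPv : P v \in W by rewrite -PW memv_img ?memvf.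
  rewrite -(subrK (P v) v) addrC memv_add // memv_cap memvB //= ?(subvP sWU) //.
  by rewrite memv_ker linearB /= (Pid (P v)) ?subrr.
apply/eqP; rewrite -subv0; apply/subvP => v; rewrite !memv_cap memv_ker.
by case/and3P=> Wv _; rewrite Pid // memv0.
Qed.

Lemma semisimple_sub V (U : {vspace V}) : stable U ->
  exists Us : seq {vspace V},
    [/\ forall X, X \in Us -> irreducible_sub X, (\sum_(X <- Us) X)%VS = U
      & \dim U = (\sum_(X <- Us) \dim X)%N].
Proof.
have [d] := ubnP (\dim U); elim: d U => // d IH U; rewrite ltnS => Ud stU.
have [U0|/eqP U0] := eqVneq U 0%VS.
  by exists [::]; rewrite !big_nil U0 dimv0.
have [irrU|] := EM (irreducible_sub U).
  exists [:: U]; rewrite !big_seq1; split=> // W.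
  by rewrite inE => /eqP->.
move=> nirrU; have [W [stW sWU W0 WU]] : exists W : {vspace V},
    [/\ stable W, (W <= U)%VS, W <> 0%VS & W <> U].
  apply: contrapT => nW; apply: nirrU; split=> // W stW sWU.
  have [->|/eqP W0] := eqVneq W 0%VS; first by left.
  have [->|/eqP WU] := eqVneq W U; first by right.
  by case: nW; exists W.
have [W' [stW' WW'U WW'0]] := stable_complement stU stW sWU.
have dimU : (\dim U = \dim W + \dim W')%N by rewrite -WW'U dimv_disjoint_sum.
have [Wd W'd] : (\dim W < d /\ \dim W' < d)%N.
  have W_gt0 : (0 < \dim W)%N by rewrite lt0n dimv_eq0; apply/eqP.
  have W_lt : (\dim W < \dim U)%N.
    rewrite ltn_neqAle dimvS // andbT; apply: contra_notN WU => /eqP E.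
    by apply/eqP; rewrite eqEdim sWU E /=.
  split; first exact: leq_trans W_lt _.
  by apply: leq_trans _ Ud; rewrite dimU -addn1 addnC leq_add2r.
have [Us [irrUs sumUs dimUs]] := IH W Wd stW.
have [Us' [irrUs' sumUs' dimUs']] := IH W' W'd stW'.
exists (Us ++ Us'); split.
- by move=> X; rewrite mem_cat => /orP[/irrUs|/irrUs'].
- by rewrite big_cat /= sumUs sumUs'.
by rewrite big_cat /= dimU dimUs dimUs'.
Qed.

Lemma has_mult_ex V N : exists r, has_mult V N r.
Proof.
have stf : stable (fullv : {vspace V}) by move=> x; apply: subvf.
have [Us [irrUs sumUs dimUs]] := semisimple_sub stf.
pose U (i : 'I_(size Us)) := tnth (in_tuple Us) i.
have irrU i : irreducible_sub (U i) by apply/irrUs/mem_tnth.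
have stU i : stable (U i) by case: (irrU i).
have sumU : (\sum_i U i)%VS = fullv.
  by rewrite -sumUs [RHS](big_tnth _ _ Us).
eexists; exists (size Us), U, stU; split=> //.
  by rewrite directvE /= sumU dimUs [X in X == _](big_tnth _ _ Us).
by move=> i; apply: irreducible_subrep.
Qed.

Lemma lftrace_directv V p (U : 'I_p -> {vspace V}) (stU : forall i, stable (U i))
    (T : 'End(V)) (Ti : forall i, 'End(subrep (stU i))) :
  directv (\sum_i U i) -> (\sum_i U i)%VS = fullv ->
  (forall i, rep_incl (stU i) \o Ti i = T \o rep_incl (stU i))%VF ->
  lftrace T = \sum_i lftrace (Ti i).
Proof.
move=> dxU sumU TiE.
pose pi i : 'End(V) := sumv_pi_for (esym sumU) i.
have piU i v : pi i v \in U i by apply: memv_sum_pi.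
have pi_id i v : v \in U i -> pi i v = v.
  move=> Uv; have /directv_sum_unique dxU' := dxU.
  have := dxU' (pi^~ v) (fun j => if j == i then v else 0).
  rewrite sumv_pi_sum ?memvf // -big_mkcond big_pred1_eq eqxx.
  move=> /(_ (fun j _ => piU j v)) H; symmetry.
  have /forall_inP : [forall (j | true), pi j v == if j == i then v else 0].
    by rewrite -H // => j _; case: eqP => [->|_] //; apply: mem0v.
  by move=> /(_ i isT); rewrite eqxx => /eqP->.
pose q i : 'Hom(V, subrep (stU i)) := (linfun (@vsproj _ _ (U i)) \o pi i)%VF.
have iq i : (rep_incl (stU i) \o q i)%VF = pi i.
  by apply/lfunP => v; rewrite (comp_lfunE (rep_incl _)) rep_inclE comp_lfunE lfunE
    /= vsprojK.
have qi i : (q i \o rep_incl (stU i))%VF = \1%VF.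
  apply/lfunP => u; rewrite (comp_lfunE (q i)) id_lfunE comp_lfunE rep_inclE pi_id
    ?subvsP //.
  by rewrite lfunE /= vsvalK.
have -> : T = \sum_i (T \o (rep_incl (stU i) \o q i))%VF.
  rewrite -comp_lfun_sumr -[LHS]comp_lfun1r; congr (_ \o _)%VF.
  apply/lfunP => v; rewrite sum_lfunE id_lfunE -[LHS](sumv_pi_sum (esym sumU)) ?memvf
    //.
  by apply: eq_bigr => i _; rewrite iq.
rewrite lftrace_sum; apply: eq_bigr => i _.
by rewrite comp_lfunA -TiE -comp_lfunA lftraceC -comp_lfunA qi comp_lfun1r.
Qed.

Lemma pairing_directv N V p (U : 'I_p -> {vspace V}) (stU : forall i, stable (U i)) :
  directv (\sum_i U i) -> (\sum_i U i)%VS = fullv ->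
  pairing N V = \sum_i pairing N (subrep (stU i)).
Proof.
move=> dxU sumU; rewrite [RHS]exchange_big; apply: eq_bigr => j _ /=.
rewrite -mulr_sumr (lftrace_directv (Ti := fun i => sleft (subrep (stU i)) j) dxU) //.
by move=> i; apply/sleft_nat/rep_incl_equivariant.
Qed.

Lemma pairing_iso N V W : rep_iso V W -> pairing N V = pairing N W.
Proof.
case=> f [/eqP kf imf fE]; apply: eq_bigr => i _; congr (_ * _).
have fEq : equivariant f by move=> x; apply/lfunP => v; rewrite !comp_lfunE fE.
have fK : (f^-1 \o f)%VF = \1%VF by apply: lker0_compVf.
have fVK : (f \o f^-1)%VF = \1%VF.
  by apply/lfunP => w; rewrite comp_lfunE limg_lfunVK ?imf ?memvf // id_lfunE.
rewrite -[sleft W i]comp_lfun1r -fVK comp_lfunA -sleft_nat // lftraceC.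
by rewrite comp_lfunA fK comp_lfun1l.
Qed.

Lemma schur V W (f : 'Hom(V, W)) : rep_simple V -> rep_simple W ->
  equivariant f -> f != 0 -> rep_iso V W.
Proof.
move=> [_ irrV] [_ irrW] fE f0; exists f; split.
- have [//|kf] := irrV _ (stable_lker fE); case/eqP: f0.
  by apply/lfunP => v; rewrite lfunE /=; apply/eqP; rewrite -memv_ker kf memvf.
- have [imf|//] := irrW _ (stable_limg fE); case/eqP: f0.
  apply/lfunP => v; rewrite lfunE /=; apply/eqP.
  by rewrite -memv0 -imf memv_img ?memvf.
by move=> x v; rewrite -!comp_lfunE fE.
Qed.

Hypothesis charF : [pchar F] =i pred0.

Lemma pairing1_simple N : pairing N N = 1 -> rep_simple N.
Proof.
rewrite pairing_dim => E; have dim1 : \dim (homsp N N) = 1%N := @natr_inj F charF _ 1 E.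
have idN : (\1%VF : 'End(N)) \in homsp N N.
  by apply/homspP => x; rewrite comp_lfun1l comp_lfun1r.
have scal f : f \in homsp N N -> exists c, f = c *: (\1%VF : 'End(N)).
  move=> fH; have N0 : (\1%VF : 'End(N)) != 0.
    apply: contra_eq_neq dim1 => N0.
    suff -> : homsp N N = 0%VS by rewrite dimv0.
    apply/eqP; rewrite -subv0; apply/subvP => g _; rewrite memv0.
    by rewrite -[g]comp_lfun1l N0 comp_lfun0l.
  have : homsp N N = <[\1%VF]>%VS.
    by apply/esym/eqP; rewrite eqEdim -memvE idN dim_vline N0 dim1.
  by move=> HE; move: fH; rewrite HE => /vlineP.
split=> [full0|U stU].
  have : homsp N N = 0%VS.
    apply/eqP; rewrite -subv0; apply/subvP => g _; rewrite memv0.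
    apply/eqP/lfunP => v; have := memvf v; rewrite full0 memv0 => /eqP->.
    by rewrite !linear0.
  by move=> HE; move: dim1; rewrite HE dimv0.
have [P [PE PU Pid]] := equivariant_projector stU.
have /homspP/scal[c Pc] := PE.
have [c0|c0] := eqVneq c 0.
  left; apply/eqP; rewrite -subv0; apply/subvP => u /Pid<-.
  by rewrite Pc c0 scale0r lfunE memv0.
right; apply/eqP; rewrite eqEsubv subvf; apply/subvP => v _.
rewrite -PU; apply/memv_imgP; exists (c^-1 *: v); rewrite ?memvf //.
by rewrite Pc scale_lfunE id_lfunE scalerA divff ?scale1r.
Qed.

Lemma mult_pairing V N : pairing N N = 1 -> (mult V N)%:R = pairing N V.
Proof.
move=> N1; have simN := pairing1_simple N1.
have : has_mult V N (mult V N) by apply: classical_sets.xgetPex; apply: has_mult_ex.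
case=> p [U [stU [dxU sumU simU <-]]].
rewrite (pairing_directv N stU dxU sumU) -sum1_card natr_sum big_mkcond.
apply: eq_bigr => i _; rewrite inE; case: asboolP => [/pairing_iso->//|niso].
rewrite pairing_dim; suff -> : homsp N (subrep (stU i)) = 0%VS by rewrite dimv0.
apply/eqP; rewrite -subv0; apply/subvP => f /homspP fE; rewrite memv0.
apply/negPn/negP => f0; apply: niso.
have [g [kg img gE]] := schur simN (simU i) fE f0.
have gK : (g^-1 \o g)%VF = \1%VF by apply/lker0_compVf/eqP.
have gVK : (g \o g^-1)%VF = \1%VF.
  by apply/lfunP => w; rewrite comp_lfunE limg_lfunVK ?img ?memvf // id_lfunE.
exists (g^-1)%VF; split.
- apply/eqP/lker0P => u v E.
  by rewrite -[u]id_lfunE -[v]id_lfunE -gVK !comp_lfunE E.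
- apply/eqP; rewrite eqEsubv subvf; apply/subvP => v _.
  by rewrite -[v]id_lfunE -gK comp_lfunE memv_img ?memvf.
move=> x v; rewrite -{1}[v]id_lfunE -gVK comp_lfunE -gE -comp_lfunE gK.
by rewrite id_lfunE.
Qed.

End System.
End Separable.

(** * Characters *)

Section Characters.
Variable F : fieldType.

(* Locked: otherwise rewriting with [mulr_sumr] unfolds the trace into a sum. *)
Fact chi_key : unit. Proof. exact: tt. Qed.
Definition chi (M : monoidType) (V : rep F M) (x : M) : F :=
  locked_with chi_key (lftrace (ract V x)).
Lemma chiE (M : monoidType) (V : rep F M) x : chi V x = lftrace (ract V x).
Proof. by rewrite /chi unlock. Qed.

Lemma chi_quorep (M : monoidType) (V : rep F M) (U : {vspace V}) (stU : stable U)
    (e : 'End(V)) x :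
  {in U, forall u, e u = 0} -> (forall v, v - e v \in U) ->
  chi (quorep stU) x = lftrace (ract V x \o e)%VF.
Proof.
move=> eU Ue; pose i : 'Hom(subvs_of (U^C)%VS, V) := linfun (@vsval _ _ (U^C)%VS).
set f := ract V x.
have eiq : (e \o i \o qproj U)%VF = e.
  apply/lfunP => v; rewrite !(comp_lfunE (e \o i)%VF) (comp_lfunE e) lfunE /=;
    apply/eqP.
  by rewrite -subr_eq0 -opprB oppr_eq0 -linearB /= eU ?sub_qproj.
have qfe : (qproj U \o f \o e)%VF = (qproj U \o f)%VF.
  apply/lfunP => v; rewrite !(comp_lfunE (qproj U \o f)%VF) !(comp_lfunE (qproj U));
    apply/eqP.
  by rewrite -subr_eq0 -opprB oppr_eq0 -!linearB /= qproj_eq0 // (proj1 (stableP U)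
    stU).
rewrite chiE; change (lftrace (qproj U \o f \o i)%VF = lftrace (f \o e)%VF).
move: qfe eiq; generalize (qproj U) => q qfe eiq.
by rewrite -qfe -!comp_lfunA [LHS]lftraceC -!comp_lfunA (comp_lfunA e) eiq.
Qed.

Lemma chi_inner (M : monoidType) (V W : rep F M) x :
  chi (inner_tens V W) x = chi V x * chi W x.
Proof. by rewrite !chiE; apply: lftrace_tens. Qed.

Lemma chi_outer (G H : finGroupType) (V : rep F G) (W : rep F H) x y :
  chi (outer_tens V W) (x, y) = chi V x * chi W y.
Proof. by rewrite !chiE; apply: lftrace_tens. Qed.

Hypothesis charF : [pchar F] =i pred0.

Lemma natr_neq0 n : (0 < n)%N -> n%:R != 0 :> F.
Proof. by move: charF => /pcharf0P ->; rewrite lt0n. Qed.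

Lemma card_group_neq0 (G : finGroupType) : #|G|%:R != 0 :> F.
Proof. by apply/natr_neq0/card_gt0P; exists 1%g. Qed.

Section Balanced.
Variables (M : monoidType) (H : finGroupType) (A : bimod F M H) (V : rep F H).

Lemma chi_bal_tens x :
  chi (bal_tens A V) x =
  #|H|%:R^-1 * \sum_(h : H) lftrace (ract A x \o bright A h^-1)%VF * chi V h.
Proof.
pose t h := tens_end (bright A h^-1%g) (ract V h).
pose e : 'End(left_tens A V) := #|H|%:R^-1 *: \sum_(h : H) t h.
rewrite (chi_quorep _ (e := e)).
- rewrite /e -comp_lfunZr lftraceZ comp_lfun_sumr lftrace_sum; congr (_ * _).
  apply: eq_bigr => h _; rewrite /= /left_act /t -tens_endM comp_lfun1l.
  by rewrite chiE; apply: lftrace_tens.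
- have eD h : (e \o (tens_end (bright A h) \1%VF - tens_end \1%VF (ract V h)))%VF = 0.
    rewrite /e -comp_lfunZl comp_lfunDr comp_lfunNr !comp_lfun_suml.
    rewrite (reindex_inj (mulIg h)) /= -sumrB big1 ?scaler0 // => g _.
    rewrite /t -!tens_endM !comp_lfun1r -ractM -brightM.
    by rewrite invMg mulgA mulgV mul1g subrr.
  move=> u /memv_sumP[w wP ->]; rewrite linear_sum big1 // => h _.
  have /memv_imgP[v _ ->] := wP h isT.
  by rewrite -[LHS](comp_lfunE e) eD zero_lfunE.
move=> v; rewrite /e scale_lfunE sum_lfunE.
have {1}-> : v = #|H|%:R^-1 *: \sum_(h : H) v.
  by rewrite sumr_const -scaler_nat scalerA mulVf ?scale1r ?card_group_neq0.
rewrite -scalerBr -sumrB memvZ // memv_suml // => h _.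
pose w := tens_end (bright A h^-1%g) (\1%VF : 'End(V)) v.
have -> : v - t h v =
    (tens_end (bright A h) \1%VF - tens_end \1%VF (ract V h))%VF w.
  rewrite add_lfunE opp_lfunE -!comp_lfunE -!tens_endM -brightM mulVg.
  by rewrite bright1 !comp_lfun1l comp_lfun1r tens_end1 id_lfunE.
by apply: (subvP (sumv_sup h isT (subvv _))); rewrite memv_img ?memvf.
Qed.
End Balanced.

Section GroupSystem.
Variable G : finGroupType.

Definition gleft (V : rep F G) (g : G) : 'End(V) := #|G|%:R^-1 *: ract V g.
Definition gright (V : rep F G) (g : G) : 'End(V) := ract V g^-1%g.

Lemma gleft_nat (V W : rep F G) (f : 'Hom(V, W)) g : equivariant f ->
  (f \o gleft V g = gleft W g \o f)%VF.
Proof. by move=> fE; rewrite /gleft -comp_lfunZr -comp_lfunZl fE. Qed.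

Lemma gright_nat (V W : rep F G) (f : 'Hom(V, W)) g : equivariant f ->
  (f \o gright V g = gright W g \o f)%VF.
Proof. by move=> fE; rewrite /gright fE. Qed.

Lemma gsep_comm (V W : rep F G) (f : 'Hom(V, W)) :
  equivariant (\sum_g (gleft W g \o f \o gright V g))%VF.
Proof.
move=> x; rewrite comp_lfun_suml comp_lfun_sumr.
rewrite (reindex_inj (mulgI x)); apply: eq_bigr => g _ /=.
rewrite /gleft /gright -!comp_lfunZl -comp_lfunZr; congr (_ *: _).
by rewrite ractM -!comp_lfunA -ractM invMg mulgKV.
Qed.

Lemma gsep_one (V : rep F G) : (\sum_g (gleft V g \o gright V g))%VF = \1%VF.
Proof.
under eq_bigr => g _ do
  rewrite /gleft /gright -comp_lfunZl -ractM mulgV ract1.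
by rewrite sumr_const -scaler_nat scalerA divff ?scale1r ?card_group_neq0.
Qed.

Definition group_sys : sepsys F G := Sepsys gleft_nat gright_nat gsep_comm gsep_one.

Definition cdot (phi psi : G -> F) : F :=
  locked_with chi_key (#|G|%:R^-1 * \sum_g phi g^-1%g * psi g).
Lemma cdotE phi psi : cdot phi psi = #|G|%:R^-1 * \sum_g phi g^-1%g * psi g.
Proof. by rewrite /cdot unlock. Qed.

Lemma cdotC phi psi : cdot phi psi = cdot psi phi.
Proof.
rewrite !cdotE (reindex_inj invg_inj); congr (_ * _); apply: eq_bigr => g _ /=.
by rewrite invgK mulrC.
Qed.

Lemma pairing_group (V W : rep F G) : pairing group_sys V W = cdot (chi V) (chi W).
Proof.
rewrite /pairing !cdotE mulr_sumr; apply: eq_bigr => g _.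
by rewrite !chiE /= /gright /gleft lftraceZ mulrCA.
Qed.

Lemma chiJ (V : rep F G) x y : chi V (x * y * x^-1)%g = chi V y.
Proof. by rewrite !chiE !ractM lftraceC comp_lfunA -ractM mulVg ract1 comp_lfun1l. Qed.

Lemma mult_cdot (V N : rep F G) :
  cdot (chi N) (chi N) = 1 -> (mult V N)%:R = cdot (chi V) (chi N).
Proof.
by move=> N1; rewrite (mult_pairing (S := group_sys)) ?pairing_group // cdotC.
Qed.

End GroupSystem.

Lemma youngV n m (h : (symg n * symg m)%type) : young h^-1%g = (young h)^-1%g.
Proof. by apply/(mulIg (young h)); rewrite -youngM !mulVg young1. Qed.

Lemma mult_young_ind n m (V : rep F (symg n * symg m)%type) (N : rep F (symg (n + m))) :
  cdot (chi N) (chi N) = 1 ->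
  (mult (young_ind V) N)%:R = cdot (chi V) (fun h => chi N (young h)).
Proof.
move=> N1; rewrite mult_cdot // cdotC !cdotE.
under eq_bigr => g _ do rewrite chi_bal_tens mulrCA mulr_sumr.
rewrite -mulr_sumr exchange_big mulrCA; congr (_ * _).
rewrite mulr_sumr [RHS](reindex_inj invg_inj); apply: eq_bigr => h _ /=.
rewrite invgK -[RHS](mulKf (card_group_neq0 (symg (n + m)))).
congr (_ * _); under eq_bigr => g _ do rewrite mulrA mulrC.
rewrite -mulr_sumr mulrCA; congr (_ * _).
have trE g : lftrace (reg_left F g \o reg_right F h^-1%g)%VF =
    \sum_(u | (g * (u * young h^-1) == u)%g) 1.
  rewrite -lin_pmap_comp lftrace_pmap -sum1_card natr_sum; apply: eq_bigl => u.
  by rewrite inE (inj_eq Some_inj).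
under eq_bigr => g _ do rewrite trE mulr_sumr.
rewrite (exchange_big_dep predT) //= -sum1_card natr_sum mulr_suml.
apply: eq_bigr => u _; rewrite (big_pred1 (u * young h * u^-1)%g) => [|g].
  by rewrite mulr1 mul1r !invMg invgK mulgA chiJ youngV.
rewrite youngV -[RHS](inj_eq (mulIg (u * (young h)^-1)%g)); congr (_ == _).
by rewrite !mulgA mulgKV mulgK.
Qed.

End Characters.

(** * Tableaux and Specht modules *)

Lemma perm_of_codom (T : finType) (Y : Type) (f g : T -> Y) :
  injective f -> (forall x, exists y, f x = g y) ->
  exists s : {perm T}, forall x, f x = g (s x).
Proof.
move=> f_inj /choice[h fE].
have h_inj : injective h by move=> x y E; apply: f_inj; rewrite !fE E.
by exists (perm h_inj) => x; rewrite permE.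
Qed.

Section Diagram.
Variable n : nat.
Implicit Types (lam mu : intpart n).

Lemma intpart_sum lam : (\sum_(i < n) nth 0 lam i)%N = n.
Proof.
have /andP[_ /eqP sumE] := valP lam; rewrite -[RHS]sumE -/(parts lam) sumnE.
by rewrite (big_nth 0%N) big_mkord size_map size_tuple.
Qed.

Lemma intpart_le lam i : (nth 0 lam i <= n)%N.
Proof.
have [le_ni|lt_in] := leqP (size lam) i; first by rewrite nth_default.
move: lt_in; rewrite size_map => lt_in; rewrite (nth_map ord0) // -ltnS; exact: ltn_ord.
Qed.

Lemma intpart_antimono lam i j : (i <= j)%N -> (nth 0 lam j <= nth 0 lam i)%N.
Proof.
move=> le_ij; have [le_nj|lt_jn] := leqP (size lam) j; first by rewrite nth_default.
have /andP[lam_sorted _] := valP lam.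
have geq_trans : transitive geq by move=> a b c ab /leq_trans; apply.
have := sorted_leq_nth geq_trans leqnn 0%N lam_sorted.
by apply; rewrite ?inE //; apply: leq_ltn_trans lt_jn.
Qed.

Definition diagram lam : {set 'I_n * 'I_n} := [set p : 'I_n * 'I_n | p.2 < nth 0 lam
  p.1]%N.
Definition below lam (i : nat) := #|[set p : 'I_n * 'I_n in diagram lam | p.1 < i]%N|.

Lemma belowE lam i : (i <= n)%N -> below lam i = (\sum_(j < n | j < i) nth 0 lam j)%N.
Proof.
move=> le_in; rewrite /below -sum1_card.
rewrite (eq_bigl (fun p : 'I_n * 'I_n => (p.1 < i) && (p.2 < nth 0 lam p.1))%N);
  last first.
  by move=> p; rewrite !inE andbC.
rewrite -(pair_big_dep (fun j : 'I_n => j < i)%N (fun j k : 'I_n =>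
  k < nth 0 lam j)%N (fun _ _ => 1%N)) /=.
apply: eq_bigr => j _.
by rewrite -(big_ord_widen _ (fun=> 1%N)) ?intpart_le // sum1_card card_ord.
Qed.

Lemma card_diagram lam : #|diagram lam| = n.
Proof.
transitivity (below lam n); first by apply: eq_card => p; rewrite !inE ltn_ord andbT.
by rewrite belowE // -[RHS](intpart_sum lam); apply: eq_bigl => j; rewrite ltn_ord.
Qed.

Lemma below_inj lam mu : (forall i, below lam i = below mu i) -> lam = mu.
Proof.
move=> E; apply/val_inj/val_inj/(inj_map val_inj); rewrite -!/(parts _).
apply: (eq_from_nth (x0 := 0%N)) => [|i]; first by rewrite !size_map !size_tuple.
rewrite size_map size_tuple => i_n.
have H (la : intpart n) : below la i.+1 = (below la i + nth 0 la i)%N.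
  rewrite !belowE //; last exact: ltnW.
  rewrite (bigD1 (Ordinal i_n)) ?ltnSn //= addnC; congr (_ + _)%N.
  by apply: eq_bigl => j; rewrite ltnS -(inj_eq val_inj) /= andbC -ltn_neqAle.
by apply/eqP; rewrite -(eqn_add2l (below lam i)) -H E {1}E -H.
Qed.

Lemma tableau_diagram lam (t : tableau n lam) p : p \in diagram lam ->
  exists x, val t x = p.
Proof.
have /andP[/injectiveP t_inj /forallP t_in] := valP t.
suff /setP <- : [set val t x | x : 'I_n] = diagram lam by case/imsetP => x _ ->;
  exists x.
apply/eqP; rewrite eqEcard card_imset // card_ord card_diagram leqnn andbT.
by apply/subsetP => _ /imsetP[x _ ->]; rewrite inE.
Qed.

Lemma tableau_ex lam : inhabited (tableau n lam).
Proof.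
have dn : size (enum (diagram lam)) = n by rewrite -cardE card_diagram.
suff tP : tableau_pred lam [ffun x : 'I_n => nth (x, x) (enum (diagram lam)) x].
  by split; apply: (Sub _ tP).
apply/andP; split; last first.
  by apply/forallP => x; rewrite ffunE; have := mem_nth (x, x) (_ : x < size (enum
    (diagram lam)))%N;
  rewrite dn ltn_ord mem_enum inE => ->.
apply/injectiveP => x y; rewrite !ffunE (set_nth_default (y, y)) ?dn // => /eqP.
by rewrite nth_uniq ?dn ?enum_uniq // => /eqP/val_inj.
Qed.

Definition shaped lam (r : tabloid n) : Prop :=
  forall i : nat, #|[set x | r x < i]%N| = below lam i.

Lemma shaped_rows lam (t : tableau n lam) : shaped lam (rows_of t).
Proof.
have /andP[/injectiveP t_inj /forallP t_in] := valP t.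
move=> i; rewrite /below -[LHS](card_imset _ t_inj); apply: eq_card => p;
  rewrite [RHS]inE.
apply/imsetP/idP => [[x + ->]|/andP[/(tableau_diagram t)[x <-] xi]].
  by rewrite !inE ffunE t_in.
by exists x; rewrite // inE ffunE.
Qed.

Lemma shaped_act lam s r : shaped lam r -> shaped lam (tabloid_act s r).
Proof.
move=> r_shaped i; rewrite -(r_shaped i) -[RHS](card_imset _ (@perm_inj _ (sperm s))).
apply: eq_card => x; rewrite inE ffunE; apply/idP/imsetP => [H|[y + ->]].
  by exists ((s^-1)%g x); rewrite ?inE ?spermKV.
by rewrite inE spermVK.
Qed.

Section Columns.
Variables (lam : intpart n) (t : tableau n lam) (r : tabloid n).
Hypothesis r_inj : forall x y, (val t x).2 = (val t y).2 -> r x = r y -> x = y.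

Let colr (c : 'I_n) i := [set x | ((val t x).2 == c) && (r x < i)]%N.
Let colt (c : 'I_n) i := [set x | ((val t x).2 == c) && ((val t x).1 < i)]%N.

Lemma card_columns (f : 'I_n -> 'I_n) (i : nat) :
  #|[set x | f x < i]%N| = (\sum_(c < n) #|[set x | ((val t x).2 == c) && (f x <
    i)]%N|)%N.
Proof.
rewrite -sum1_card (partition_big (fun x => (val t x).2) predT) //=.
apply: eq_bigr => c _; rewrite sum1_card; apply: eq_card => x.
by rewrite -topredE /= !inE andbC.
Qed.

(* An injection of the c-th column into the rows cannot put more than
   min(i, height of the column) entries in the first i rows. *)
Lemma card_column_le c i : (#|colr c i| <= #|colt c i|)%N.
Proof.
have [/existsP[x0 /andP[/eqP x0c le_ix0]]|] := boolP [exists x, ((val t x).2 == c) &&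
  (i <= (val t x).1)%N]; last first.
  rewrite negb_exists => /forallP H; apply/subset_leq_card/subsetP => x.
  by rewrite !inE => /andP[xc _]; have := H x; rewrite xc /= -ltnNge.
apply: (@leq_trans #|[set j : 'I_n | j < i]%N|).
  rewrite -(card_in_imset (f := r)); last first.
    by move=> x y; rewrite !inE => /andP[/eqP xc _] /andP[/eqP yc _]; apply: r_inj;
      rewrite xc yc.
  by apply/subset_leq_card/subsetP => _ /imsetP[x + ->]; rewrite !inE => /andP[].
apply: leq_trans (leq_imset_card (fun x => (val t x).1) _).
apply/subset_leq_card/subsetP => j; rewrite inE => ji.
have /(tableau_diagram t)[x xE] : (j, c) \in diagram lam.
  have /andP[_ /forallP t_in] := valP t.
  have := t_in x0; rewrite x0c inE /= => /leq_trans; apply.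
  by apply: intpart_antimono; apply: leq_trans (ltnW ji) le_ix0.
by apply/imsetP; exists x; rewrite ?xE // inE xE eqxx.
Qed.

Lemma shaped_dominated mu i : shaped mu r -> (below mu i <= below lam i)%N.
Proof.
move=> /(_ i) <-; rewrite -(shaped_rows t i) !card_columns; apply: leq_sum => c _.
apply: leq_trans (card_column_le c i) _.
by apply/subset_leq_card/subsetP => x; rewrite !inE ffunE.
Qed.

Lemma shaped_column_perm : shaped lam r ->
  exists2 s, s \in col_stab t & r = tabloid_act s (rows_of t).
Proof.
have /andP[/injectiveP t_inj /forallP t_in] := valP t.
move=> r_shaped; pose f x := (r x, (val t x).2).
have f_diag x : f x \in diagram lam.
  rewrite inE ltnNge; apply/negP => out.
  have col_below y : (val t y).2 = (val t x).2 -> ((val t y).1 < r x)%N.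
    move=> yx; rewrite ltnNge; apply/negP => /(intpart_antimono lam).
    move=> /leq_trans/(_ out); rewrite /= -yx leqNgt => /negP; apply.
    exact: t_in.
  have := r_shaped (r x); rewrite -(shaped_rows t) !card_columns.
  apply/eqP; rewrite neq_ltn; apply/orP; left.
  rewrite (bigD1 (val t x).2) //= [ltnRHS](bigD1 (val t x).2) //=.
  rewrite -addSn; apply: leq_add; last first.
    apply: leq_sum => c _; apply: leq_trans (card_column_le c _) _.
    by apply/subset_leq_card/subsetP => y; rewrite !inE ffunE.
  apply/proper_card/properP; split.
    by apply/subsetP => y; rewrite !inE ffunE => /andP[/eqP yx _];
      rewrite yx eqxx col_below.
  by exists x; rewrite !inE eqxx ?ltnn //= ffunE col_below.
have f_inj : injective f by move=> x y [rxy cxy]; apply: r_inj.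
have [s sE] : exists s : {perm 'I_n}, forall x, f x = val t (s x).
  apply: perm_of_codom => // x; have [y yE] := tableau_diagram t (f_diag x).
  by exists y.
exists (s^-1%g : symg n).
  rewrite inE; apply/forallP => x; rewrite -{2}(spermKV (s : symg n) x).
  by rewrite -(sE (s^-1%g x)).
by apply/ffunP => x; rewrite !ffunE invgK -sE.
Qed.

End Columns.
End Diagram.

Section Specht.
Variables (F : fieldType) (n : nat).
Hypothesis charF : [pchar F] =i pred0.
Implicit Types (lam mu : intpart n).
Local Notation M := (tabloid_rep F n).

Lemma col_stabM lam (t : tableau n lam) s u :
  u \in col_stab t -> ((s * u)%g \in col_stab t) = (s \in col_stab t).
Proof.
rewrite !inE => /forallP uP; apply/forallP/forallP => sP x.
  have := sP ((u^-1)%g x); rewrite spermM spermKV => /eqP->.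
  by have := uP ((u^-1)%g x); rewrite spermKV eq_sym.
by rewrite spermM (eqP (sP _)) uP.
Qed.

Lemma col_stab_gt0 lam (t : tableau n lam) : (0 < #|col_stab t|)%N.
Proof.
by apply/card_gt0P; exists 1%g; rewrite inE; apply/forallP => x; rewrite sperm1.
Qed.

Definition colsym lam (t : tableau n lam) (V : rep F (symg n)) : 'End(V) :=
  \sum_(s in col_stab t) (-1) ^+ odd_perm s *: ract V s.

Lemma colsym_nat lam (t : tableau n lam) (V W : rep F (symg n)) (f : 'Hom(V, W)) :
  equivariant f -> (f \o colsym t V = colsym t W \o f)%VF.
Proof.
move=> fE; rewrite comp_lfun_sumr comp_lfun_suml; apply: eq_bigr => s _.
by rewrite -comp_lfunZr -comp_lfunZl fE.
Qed.

Lemma colsym_ract lam (t : tableau n lam) (V : rep F (symg n)) u :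
  u \in col_stab t -> (colsym t V \o ract V u = (-1) ^+ odd_perm u *: colsym t V)%VF.
Proof.
move=> ut; rewrite comp_lfun_suml scaler_sumr [RHS](reindex_inj (mulIg u)) /=.
apply: eq_big => [s|s _]; first by rewrite col_stabM.
by rewrite -comp_lfunZl ractM scalerA odd_spermM signr_addb mulrCA -expr2 sqrr_sign
  mulr1.
Qed.

Lemma colsym_idem lam (t : tableau n lam) (V : rep F (symg n)) :
  (colsym t V \o colsym t V = #|col_stab t|%:R *: colsym t V)%VF.
Proof.
rewrite {2}/colsym comp_lfun_sumr.
rewrite (eq_bigr (fun=> colsym t V)) => [|u ut].
  by rewrite sumr_const scaler_nat.
by rewrite -comp_lfunZr colsym_ract // scalerA -expr2 sqrr_sign scale1r.
Qed.

Lemma colsym_ket lam (t : tableau n lam) :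
  colsym t M (ket F (rows_of t)) = polytabloid F t.
Proof.
by rewrite sum_lfunE; apply: eq_bigr => s _; rewrite scale_lfunE lin_pmap_ket.
Qed.

Lemma colsym_polytabloid lam (t : tableau n lam) :
  colsym t M (polytabloid F t) = #|col_stab t|%:R *: (polytabloid F t : M).
Proof. by rewrite -!colsym_ket -comp_lfunE colsym_idem scale_lfunE. Qed.

Lemma colsym_repeat lam (t : tableau n lam) (r : tabloid n) x y :
  x != y -> (val t x).2 = (val t y).2 -> r x = r y -> colsym t M (ket F r) = 0.
Proof.
move=> xy txy rxy; pose u : symg n := tperm x y.
have ut : u \in col_stab t.
  rewrite inE; apply/forallP => z; rewrite /u.
  by case: tpermP => [->|->|//]; rewrite txy.
have fix_r : ract M u (ket F r) = ket F r.
  rewrite lin_pmap_ket; congr ket; apply/ffunP => z; rewrite ffunE.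
  have -> : (u^-1)%g = u by apply: tpermV.
  by rewrite /u; case: tpermP => [->|->|].
have := congr1 (fun f : 'End(M) => f (ket F r)) (colsym_ract M ut).
rewrite comp_lfunE fix_r scale_lfunE odd_tperm xy expr1 scaleN1r.
move/eqP; rewrite -subr_eq0 opprK -mulr2n -scaler_nat scaler_eq0.
by move: charF => /pcharf0P -> /= /eqP.
Qed.

Lemma specht_shaped mu (v : M) r :
  v \in specht_space F n mu -> (v : {ffun _ -> F^o}) r != 0 -> shaped mu r.
Proof.
move=> Sv; apply: contra_neqP => nr.
pose c : M -> F^o := fun v => (v : {ffun _ -> F^o}) r.
have c_lin : linear c by move=> a u w; rewrite /c !ffunE.
pose cl := GRing.isLinear.Build F M F^o _ c c_lin.
pose cL : {linear M -> F^o} := HB.pack c cl.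
have: v \in lker (linfun cL).
  apply: (subvP _ _ Sv); apply/span_subvP => _ /mapP[t _ ->].
  rewrite memv_ker lfunE /= /c sum_ffunE big1 // => s st; rewrite !ffunE.
  by case: eqP => [rE|_]; [case: nr; rewrite -rE;
    apply/shaped_act/shaped_rows | rewrite scaler0].
by rewrite memv_ker lfunE => /eqP.
Qed.

Lemma polytabloid_in lam (t : tableau n lam) :
  (polytabloid F t : M) \in specht_space F n lam.
Proof. by rewrite memv_span // map_f ?mem_enum. Qed.

Lemma polytabloid_neq0 lam (t : tableau n lam) : polytabloid F t != 0.
Proof.
have /andP[/injectiveP t_inj _] := valP t.
apply/eqP => /ffunP/(_ (rows_of t)); rewrite sum_ffunE ffunE.
rewrite (bigD1 1%g) /=; last by rewrite inE; apply/forallP => x; rewrite sperm1.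
rewrite tabloid_act1 !ffunE eqxx odd_perm1 expr0 scale1r big1 => [|s].
  by rewrite addr0 => /eqP; rewrite oner_eq0.
case/andP=> st s1; rewrite !ffunE; case: eqP => [E|_]; last by rewrite scaler0.
case/eqP: s1; apply/permP => x; rewrite sperm1; apply: t_inj.
have /ffunP/(_ (s x)) := E; rewrite !ffunE spermVK => rE.
move: st; rewrite inE => /forallP/(_ x)/eqP cE.
by rewrite [LHS]surjective_pairing [RHS]surjective_pairing rE cE.
Qed.

Lemma polytabloid_orbit lam (t t' : tableau n lam) :
  exists s, polytabloid F t' = tabloid_lin F s (polytabloid F t).
Proof.
have /andP[/injectiveP t_inj /forallP t_in] := valP t.
have [s sE] : exists s : {perm 'I_n}, forall x, val t x = val t' (s x).
  by apply: perm_of_codom => // x; have [|y yE] := @tableau_diagram _ _ t' (val t x);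
   [rewrite inE; apply: t_in | exists y].
exists s; rewrite polytabloid_act; congr polytabloid.
by apply/val_inj/ffunP => x; rewrite ffunE sE spermKV.
Qed.

Lemma colsym_expand mu lam (t : tableau n lam) (v : M) :
  v \in specht_space F n mu ->
  colsym t M v = \sum_(r | `[< shaped mu r /\
    forall x y, (val t x).2 = (val t y).2 -> r x = r y -> x = y >])
      (v : {ffun _ -> F^o}) r *: colsym t M (ket F r).
Proof.
move=> Sv; rewrite {1}(free_expand v) linear_sum [RHS]big_mkcond.
apply: eq_bigr => r _; rewrite linearZ /=; case: asboolP => // nr.
have [->|vr] := eqVneq ((v : {ffun _ -> F^o}) r) 0; first by rewrite scale0r.
have [->|kr] := eqVneq (colsym t M (ket F r)) 0; first by rewrite scaler0.
case: nr; split=> [|x y txy rxy]; first exact: specht_shaped vr.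
by apply/eqP; apply: contraR kr => xy; rewrite (colsym_repeat xy txy rxy).
Qed.

Section HomFromSpecht.
Variables (lam mu : intpart n) (f : 'Hom(specht F n lam, specht F n mu)).
Hypothesis f_eq : equivariant f.

Let e (t : tableau n lam) : specht F n lam := vsproj _ (polytabloid F t).
Let i la : 'Hom(specht F n la, M) := rep_incl (@specht_stable F n la).

Let i_e t : i lam (e t) = polytabloid F t.
Proof. by rewrite rep_inclE vsprojK // polytabloid_in. Qed.

Let image_colsym t :
  #|col_stab t|%:R *: i mu (f (e t)) = colsym t M (i mu (f (e t))).
Proof.
have E : colsym t (specht F n lam) (e t) = #|col_stab t|%:R *: e t.
  apply/(rep_incl_inj (stU := @specht_stable F n lam)).
  rewrite -/(i lam) -comp_lfunE colsym_nat; last exact: rep_incl_equivariant.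
  by rewrite comp_lfunE i_e colsym_polytabloid linearZ /= i_e.
transitivity (i mu (f (colsym t (specht F n lam) (e t)))); first by rewrite E !linearZ.
rewrite -(comp_lfunE f) (colsym_nat t f_eq) comp_lfunE -(comp_lfunE (i mu)).
by rewrite colsym_nat ?comp_lfunE //; apply: rep_incl_equivariant.
Qed.

Lemma hom_specht_eq0 : (forall t, f (e t) = 0) -> f = 0.
Proof.
move=> f0; apply/lfunP => v; rewrite zero_lfunE.
suff : i lam v \in (i lam @: lker f)%VS.
  by case/memv_imgP => u + /rep_incl_inj ->; rewrite memv_ker => /eqP.
have : i lam v \in specht_space F n lam by rewrite rep_inclE subvsP.
apply/subvP/span_subvP => _ /mapP[t _ ->].
by rewrite -i_e memv_img // memv_ker f0.
Qed.

Lemma hom_specht_dominated j : f != 0 -> (below mu j <= below lam j)%N.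
Proof.
apply: contra_neqT => ndom; apply: hom_specht_eq0 => t.
apply/(rep_incl_inj (stU := @specht_stable F n mu)); rewrite linear0 -/(i mu).
have Si : i mu (f (e t)) \in specht_space F n mu by rewrite rep_inclE subvsP.
have := image_colsym t; rewrite (colsym_expand t Si) big_pred0 => [/eqP|r].
  by rewrite scaler_eq0 (negPf (natr_neq0 charF (col_stab_gt0 t))) => /eqP.
apply/asboolP => -[r_shaped r_inj]; case/negP: ndom.
exact: (shaped_dominated r_inj).
Qed.

Lemma hom_specht_image t : mu = lam ->
  exists c, i mu (f (e t)) = c *: (polytabloid F t : M).
Proof.
move=> mulam; have Si : i mu (f (e t)) \in specht_space F n mu by rewrite rep_inclE
  subvsP.
suff /vlineP[c cE] : colsym t M (i mu (f (e t))) \in <[(polytabloid F t : M)]>%VS.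
  exists (#|col_stab t|%:R^-1 * c); rewrite -scalerA -cE -image_colsym scalerA.
  by rewrite mulVf ?scale1r // natr_neq0 // col_stab_gt0.
rewrite (colsym_expand t Si) memv_suml // => r /asboolP[+ r_inj].
move=> r_shaped; have : shaped lam r by rewrite -mulam.
case/(shaped_column_perm r_inj) => s st ->; apply: memvZ.
have -> : ket F (tabloid_act s (rows_of t)) = ract M s (ket F (rows_of t)).
  by rewrite lin_pmap_ket.
by rewrite -comp_lfunE colsym_ract // scale_lfunE colsym_ket memvZ ?memv_line.
Qed.

End HomFromSpecht.

(* An endomorphism commutes with the column antisymmetrizer of t, whose image is
   spanned by the polytabloid of t, and all polytabloids are conjugate. *)
Lemma specht_scalar lam (f : 'End(specht F n lam)) :
  equivariant f -> exists c, f = c *: \1%VF.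
Proof.
move=> f_eq; have [t] := tableau_ex lam;
  pose e t' : specht F n lam := vsproj _ (polytabloid F (t' : tableau n lam)).
have Ee : rep_incl (@specht_stable F n lam) (e t) = polytabloid F t.
  by rewrite rep_inclE vsprojK // polytabloid_in.
have [c cE] := hom_specht_image f_eq t (erefl lam); exists c; apply/eqP;
  rewrite -subr_eq0.
have g_eq : equivariant (f - c *: \1%VF : 'End(specht F n lam)).
  move=> x; rewrite comp_lfunDl comp_lfunDr comp_lfunNl comp_lfunNr f_eq.
  by rewrite -comp_lfunZl -comp_lfunZr comp_lfun1l comp_lfun1r.
apply/eqP/hom_specht_eq0 => t'.
have [s sE] := polytabloid_orbit t t'.
have -> : vsproj (specht_space F n lam) (polytabloid F t') =
    ract (specht F n lam) s (vsproj _ (polytabloid F t)).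
  apply: val_inj; rewrite [RHS](subrep_actE (@specht_stable F n lam)).
  by rewrite [LHS]vsprojK ?vsprojK ?sE ?polytabloid_in // -sE polytabloid_in.
rewrite -comp_lfunE g_eq comp_lfunE; set v := (X in ract _ _ X).
suff -> : v = 0 by rewrite linear0.
apply/(rep_incl_inj (stU := @specht_stable F n lam)).
rewrite linear0 /v add_lfunE opp_lfunE scale_lfunE id_lfunE linearB linearZ /= cE.
apply/eqP; rewrite subr_eq0; apply/eqP; congr (_ *: _); symmetry.
exact: Ee.
Qed.

Lemma cdot_specht_self lam :
  cdot (chi (specht F n lam)) (chi (specht F n lam)) = 1.
Proof.
rewrite -(pairing_group charF) pairing_dim.
suff -> : homsp (group_sys charF (symg n)) (specht F n lam) (specht F n lam) =
  <[\1%VF]>%VS.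
  have [t] := tableau_ex lam.
  rewrite dim_vline; case: eqP => // /lfunP/(_ (vsproj _ (polytabloid F t))).
  rewrite id_lfunE zero_lfunE => /(congr1 (@vsval _ _ _)).
  by rewrite vsprojK ?polytabloid_in //= => /eqP; rewrite (negPf (polytabloid_neq0 t)).
apply/vspaceP => f; apply/homspP/vlineP; first exact: specht_scalar.
by case=> c -> x; rewrite -comp_lfunZl -comp_lfunZr comp_lfun1l comp_lfun1r.
Qed.

Lemma cdot_specht_neq lam mu : lam != mu ->
  cdot (chi (specht F n lam)) (chi (specht F n mu)) = 0.
Proof.
apply: contra_neqP => /eqP dot0; apply: below_inj => j; apply/eqP; rewrite eqn_leq.
have dom (la la' : intpart n) : cdot (chi (specht F n la)) (chi (specht F n la')) !=
  0 ->
    (below la' j <= below la j)%N.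
  rewrite -(pairing_group charF) pairing_dim => dim0.
  have /homspP f_eq := (memv_pick (homsp (group_sys charF (symg n)) (specht F n la)
    (specht F n la'))).
  apply: (hom_specht_dominated f_eq); rewrite vpick0.
  by apply: contraNneq dim0 => ->; rewrite dimv0.
by rewrite !dom // cdotC.
Qed.

End Specht.

(** * Cycle types and completeness *)

Section CycleType.
Variable T : finType.
Implicit Types s t : {perm T}.

Lemma iter_porbit_mod s x i : iter (i %% #|porbit s x|) s x = iter i s x.
Proof.
rewrite [in RHS](divn_eq i #|porbit s x|) addnC iterD; congr (iter _ _ _).
by elim: (i %/ _)%N => // k IH; rewrite mulSn iterD -IH iter_porbit.
Qed.

Lemma eq_iter_porbit s x i j :
  (iter i s x == iter j s x) = (i == j %[mod #|porbit s x|]).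
Proof.
have N_gt0 : (0 < #|porbit s x|)%N by rewrite lt0n card_porbit_neq0.
rewrite -(iter_porbit_mod s x i) -(iter_porbit_mod s x j).
rewrite -!(@nth_traject _ _ _ #|porbit s x|) ?ltn_pmod //.
by rewrite nth_uniq ?size_traject ?ltn_pmod // uniq_traject_porbit.
Qed.

Definition porbits_of s d := [set O in porbits s | #|O| == d].

Lemma porbit_matching s t : (forall d, #|porbits_of s d| = #|porbits_of t d|) ->
  exists beta : {set T} -> {set T},
    {in porbits s, forall O, beta O \in porbits t /\ #|beta O| = #|O|} /\
    {in porbits s &, injective beta}.
Proof.
move=> eq_st.
pose beta (O : {set T}) := nth O (enum (porbits_of t #|O|)) (index O (enum
  (porbits_of s #|O|))).
have beta_of O : O \in porbits s -> beta O \in porbits_of t #|O|.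
  move=> sO; rewrite -mem_enum mem_nth // -cardE -eq_st [#|porbits_of _ _|]cardE
    index_mem mem_enum.
  by rewrite inE sO eqxx.
have betaP : {in porbits s, forall O, beta O \in porbits t /\ #|beta O| = #|O|}.
  by move=> O /beta_of; rewrite inE => /andP[-> /eqP->].
exists beta; split=> // O O' sO sO' E.
have dE : #|O'| = #|O| by rewrite -(betaP O sO).2 -(betaP O' sO').2 E.
have idx (X : {set T}) : X \in porbits s -> #|X| = #|O| ->
    (index X (enum (porbits_of s #|O|)) < size (enum (porbits_of t #|O|)))%N.
  by move=> sX XO; rewrite -cardE -eq_st [#|porbits_of _ _|]cardE index_mem mem_enum
    inE sX XO eqxx.
move/eqP: E; rewrite /beta dE (set_nth_default O' O) ?idx //.
rewrite nth_uniq ?idx ?enum_uniq // => /eqP/(congr1 (nth O (enum (porbits_of s #|O|)))).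
by rewrite !nth_index ?mem_enum ?inE ?sO ?sO' ?dE ?eqxx.
Qed.

(* Choose a base point in each orbit and match the iterates of the base points. *)
Lemma porbits_conj s t : (forall d, #|porbits_of s d| = #|porbits_of t d|) ->
  exists c : {perm T}, forall x, c (s x) = t (c x).
Proof.
move=> /porbit_matching[beta [betaP beta_inj]].
have sO x : porbit s x \in porbits s by apply: imset_f.
pose base (O : {set T}) x := odflt x [pick y in O].
have baseP (O : {set T}) x : O != set0 -> base O x \in O.
  by move=> /set0Pn[y Oy]; rewrite /base; case: pickP => // /(_ y); rewrite Oy.
have base_irr (O : {set T}) x y : O != set0 -> base O x = base O y.
  by move=> /set0Pn[z Oz]; rewrite /base; case: pickP => // /(_ z); rewrite Oz.
have porbit0 u x : porbit u x != set0 by apply/set0Pn; exists x; apply: porbit_id.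
have beta0 x : beta (porbit s x) != set0.
  by rewrite -card_gt0 (betaP _ (sO x)).2 lt0n card_porbit_neq0.
pose b x := base (porbit s x) x; pose y x := base (beta (porbit s x)) x.
have bP x : porbit s (b x) = porbit s x by apply/eqP; rewrite eq_porbit_mem baseP.
have yP x : porbit t (y x) = beta (porbit s x).
  have /imsetP[z _ zE] := (betaP _ (sO x)).1.
  by apply/eqP; rewrite zE eq_porbit_mem -zE baseP.
have /choice[j jP] : forall x, exists j, x = iter j s (b x).
  move=> x; have /porbitP[i xE] : x \in porbit s (b x) by rewrite bP porbit_id.
  by exists i; rewrite {1}xE permX.
have N_eq x : #|porbit t (y x)| = #|porbit s (b x)| by rewrite yP bP (betaP _ (sO x)).2.
have s_eq x : porbit s (s x) = porbit s x by rewrite -[RHS](porbit_perm s 1) expg1.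
pose c x := iter (j x) t (y x).
have c_inj : injective c.
  move=> x x' cE; have tE : porbit t (y x) = porbit t (y x').
    by rewrite -(porbit_perm t (j x)) -(porbit_perm t (j x') (y x')) !permX -/(c x) cE.
  have OE : porbit s x = porbit s x' by apply: beta_inj; rewrite ?sO // -!yP.
  have bE : b x = b x' by rewrite /b -OE; apply: base_irr.
  have yE : y x = y x' by rewrite /y -OE; apply: base_irr.
  move/eqP: cE; rewrite /c -yE eq_iter_porbit N_eq -eq_iter_porbit => /eqP E.
  by rewrite (jP x) E bE -jP.
exists (perm c_inj) => x; rewrite !permE /c.
have bE : b (s x) = b x by rewrite /b s_eq; apply: base_irr.
have yE : y (s x) = y x by rewrite /y s_eq; apply: base_irr.
rewrite yE -iterS; apply/eqP; rewrite eq_iter_porbit N_eq -eq_iter_porbit iterS.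
by rewrite -jP -bE -jP.
Qed.

End CycleType.

Lemma intpart_of_seq n (l : seq nat) : all (leq 1) l -> sumn l = n ->
  exists lam : intpart n, forall d, (0 < d)%N -> count_mem d lam = count_mem d l.
Proof.
move=> l_pos l_sum; pose l1 := sort geq l; pose l2 := l1 ++ nseq (n - size l) 0%N.
have size_l : (size l <= n)%N.
  rewrite -l_sum; elim: l l_pos {l_sum l1 l2} => //= d l IH /andP[d_gt0 /IH].
  by move=> /(leq_add d_gt0); rewrite add1n.
have size_l2 : size l2 = n by rewrite size_cat size_sort size_nseq subnKC.
have sum_l2 : sumn l2 = n.
  by rewrite sumn_cat sumn_nseq mul0n addn0 -l_sum; apply/perm_sumn/permEl/perm_sort.
have l2_le d : d \in l2 -> (d <= n)%N.
  move=> /perm_to_rem/perm_sumn; rewrite sum_l2 => -> /=; exact: leq_addr.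
have l2_size : size (map (@inord n) l2) == n by rewrite size_map size_l2.
have l2E : map val (map (@inord n) l2) = l2.
  by rewrite -map_comp map_id_in // => d /l2_le dn; rewrite /= inordK.
have l2_sorted : sorted geq l2.
  have geq_trans : transitive geq by move=> a b c ab /leq_trans; apply.
  rewrite sorted_pairwise // pairwise_cat; apply/and3P; split.
  - by apply/allrelP => a b _ /nseqP[-> _].
  - by rewrite -sorted_pairwise //; apply: sort_sorted => a b; apply: leq_total.
  - by elim: (n - _)%N => //= k ->; rewrite andbT; apply/allP => d /nseqP[->].
suff lP : sorted geq (map val (Tuple l2_size)) && (sumn (map val (Tuple l2_size)) == n).
  exists (IntPart lP) => d d_gt0; rewrite /parts /= l2E count_cat count_nseq /=.
  rewrite eq_sym (negPf (lt0n_neq0 d_gt0)) mul0n addn0.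
  by apply/seq.permP; rewrite perm_sort.
by rewrite /= l2E l2_sorted sum_l2 /=.
Qed.

Lemma cycle_type_ex n (s : {perm 'I_n}) : exists lam : intpart n,
  forall d, (0 < d)%N -> count_mem d lam = #|porbits_of s d|.
Proof.
have [||lam lamP] := @intpart_of_seq n (map (fun O : {set 'I_n} =>
  #|O|) (enum (porbits s))).
- by rewrite all_map; apply/allP => O; rewrite mem_enum => /imsetP[x _ ->] /=;
    rewrite lt0n card_porbit_neq0.
- rewrite sumnE big_map big_enum /= -[RHS]card_ord -sum1_card.
  rewrite [RHS](partition_big_imset (porbit s)); apply: eq_bigr => O /imsetP[x _ ->].
  rewrite sum1dep_card; apply: eq_card => y; rewrite inE -eq_porbit_mem eq_sym.
  by rewrite [RHS]inE.
exists lam => d d_gt0; rewrite lamP // count_map -sum1_count big_enum_cond -sum1_card.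
by apply: eq_bigl => O; rewrite !inE.
Qed.

Lemma cycle_type_conj n (s t : symg n) (lam : intpart n) :
  (forall d, (0 < d)%N -> count_mem d lam = #|porbits_of (sperm s) d|) ->
  (forall d, (0 < d)%N -> count_mem d lam = #|porbits_of (sperm t) d|) ->
  exists c : symg n, t = (c * s * c^-1)%g.
Proof.
move=> s_type t_type.
have [[|d]|c cE] := @porbits_conj _ (sperm s) (sperm t).
- rewrite !eq_card0 // => O; apply/negP; rewrite !inE => /andP[/imsetP[x _ ->]];
    by rewrite (negPf (card_porbit_neq0 _ _)).
- by rewrite -s_type // -t_type.
exists (c : symg n); apply/permP => x.
by rewrite -(spermKV (c : symg n) x) [LHS]/= -cE !spermM !spermVK.
Qed.

Section Completeness.
Variables (F : fieldType) (n : nat).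
Hypothesis charF : [pchar F] =i pred0.

(* The values of the irreducible characters on cycle types form a square matrix,
   so row orthogonality A * B = 1 yields column orthogonality B * A = 1. *)
Lemma class_expand (phi : symg n -> F) :
  (forall x y, phi (x * y * x^-1)%g = phi y) ->
  forall g, \sum_(lam : intpart n)
    cdot phi (chi (specht F n lam)) * chi (specht F n lam) g = phi g.
Proof.
move=> phiJ; have /choice[ct ctP] : forall s : symg n, exists lam : intpart n,
    forall d, (0 < d)%N -> count_mem d lam = #|porbits_of (sperm s) d|.
  by move=> s; apply: cycle_type_ex.
have ct_class (psi : symg n -> F) : (forall x y, psi (x * y * x^-1)%g = psi y) ->
    forall s t, ct s = ct t -> psi s = psi t.
  move=> psiJ s t E; have [|c ->] := @cycle_type_conj n s t (ct s) (ctP s).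
    by rewrite E; apply: ctP.
  by rewrite psiJ.
pose rp mu : symg n := odflt 1%g [pick g | ct g == mu].
have rpP (psi : symg n -> F) : (forall x y, psi (x * y * x^-1)%g = psi y) ->
    forall g, psi (rp (ct g)) = psi g.
  move=> psiJ g; apply: ct_class => //; rewrite /rp.
  by case: pickP => [h /eqP//|/(_ g)]; rewrite eqxx.
pose X (lam : intpart n) := chi (specht F n lam).
have XJ lam x y : X lam (x * y * x^-1)%g = X lam y by apply: chiJ.
pose N := #|{: intpart n}|; pose la (i : 'I_N) : intpart n := enum_val i.
pose A : 'M[F]_N := \matrix_(i, j)
  (#|(symg n : finGroupType)|%:R^-1 * \sum_(h | ct h == la j) X (la i) h^-1%g).
pose B : 'M[F]_N := \matrix_(i, j) X (la j) (rp (la i)).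
have class_sum (psi : symg n -> F) i : (forall x y, psi (x * y * x^-1)%g = psi y) ->
    \sum_j A i j * psi (rp (la j)) = cdot (X (la i)) psi.
  move=> psiJ; rewrite !cdotE (partition_big ct predT) //= mulr_sumr.
  rewrite [RHS](reindex la) /=; last by apply: onW_bij; apply: enum_val_bij.
  apply: eq_bigr => j _; rewrite mxE -mulrA mulr_suml; congr (_ * _).
  by apply: eq_bigr => h /eqP <-; rewrite rpP.
have AB : A *m B = 1%:M.
  apply/matrixP => i j; rewrite !mxE.
  under eq_bigr => k _ do rewrite [B k j]mxE.
  rewrite class_sum //; have [->|ij] := eqVneq i j; first exact: cdot_specht_self.
  by apply: cdot_specht_neq => //; rewrite (inj_eq enum_val_inj).
have BA := mulmx1C AB.
move=> g; rewrite (reindex la) /=; last by apply: onW_bij; apply: enum_val_bij.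
rewrite -(rpP phi) //; pose k : 'I_N := enum_rank (ct g).
have laK : la k = ct g by apply: enum_rankK.
transitivity (\sum_j (B *m A) k j * phi (rp (la j))).
  under [RHS]eq_bigr => j _ do rewrite mxE mulr_suml.
  rewrite exchange_big; apply: eq_bigr => i _ /=.
  under [RHS]eq_bigr => j _ do rewrite -mulrA.
  rewrite -mulr_sumr class_sum // cdotC mulrC mxE laK; congr (_ * _).
  by rewrite rpP.
rewrite BA (bigD1 k) //= mxE eqxx mul1r big1 ?addr0 ?laK // => j jk.
by rewrite mxE eq_sym (negPf jk) mul0r.
Qed.

End Completeness.

(** * Littlewood-Richardson and Kronecker coefficients *)

Section Coefficients.
Variable F : fieldType.
Hypothesis charF : [pchar F] =i pred0.
Local Notation X n lam := (chi (specht F n lam)).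
Local Notation cardS n := (#|(symg n : finGroupType)|%:R : F).

Lemma cdot_prod (G H : finGroupType) (phi psi : G * H -> F) :
  cdot phi psi =
  #|G|%:R^-1 * \sum_x #|H|%:R^-1 * \sum_y phi (x^-1, y^-1)%g * psi (x, y).
Proof.
rewrite !cdotE card_prod natrM invfM -mulrA -mulr_sumr; congr (_ * (_ * _)).
by rewrite pair_bigA; apply: eq_bigr => -[x y] _.
Qed.

Lemma eq_cdotl (G : finGroupType) (phi phi' psi : G -> F) :
  phi =1 phi' -> cdot phi psi = cdot phi' psi.
Proof. by rewrite !cdotE => E; congr (_ * _); apply: eq_bigr => g _; rewrite E. Qed.

Lemma lrcoef_cdot a b (alpha beta : seq nat) (lam : intpart (a + b)) :
  (lrcoef F a b alpha beta lam)%:R =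
  cdot (fun h => X a alpha h.1 * X b beta h.2) (fun h => X (a + b) lam (young h)).
Proof.
rewrite mult_young_ind //; last exact: cdot_specht_self.
by apply: eq_cdotl => -[x y]; apply: chi_outer.
Qed.

Lemma kronecker_cdot b (beta delta : seq nat) (eps : intpart b) :
  (kronecker F b beta delta eps)%:R =
  cdot (fun y => X b beta y * X b delta y) (X b eps).
Proof.
rewrite [LHS](mult_cdot charF); last exact: cdot_specht_self.
by apply: eq_cdotl => x; apply: chi_inner.
Qed.

Lemma class_expand_dual n (phi : symg n -> F) :
  (forall x y, phi (x * y * x^-1)%g = phi y) ->
  forall g, \sum_(lam : intpart n) X n lam g * cdot (X n lam) phi = phi g.
Proof.
move=> phiJ g; rewrite -[RHS](class_expand charF phiJ).
by apply: eq_bigr => lam _; rewrite mulrC cdotC.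
Qed.

Lemma chi_young_expand a b (lam : intpart (a + b)) x y :
  \sum_(alpha : intpart a) \sum_(beta : intpart b)
    (lrcoef F a b alpha beta lam)%:R * (X a alpha x * X b beta y) =
  X (a + b) lam (young (x, y)).
Proof.
have youngJ u v x' y' : X (a + b) lam (young (u * x' * u^-1, v * y' * v^-1)%g) =
    X (a + b) lam (young (x', y')).
  by rewrite -[RHS](chiJ _ (young (u, v))) -youngV -!youngM.
transitivity (\sum_(alpha : intpart a) X a alpha x *
    cdot (X a alpha) (fun x' => X (a + b) lam (young (x', y)))).
  apply: eq_bigr => alpha _.
  under eq_bigr => beta _ do rewrite lrcoef_cdot cdot_prod mulrCA.
  rewrite -mulr_sumr; congr (_ * _).
  under eq_bigr => beta _ do rewrite -mulrA mulr_suml.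
  rewrite -mulr_sumr exchange_big cdotE; congr (_ * _); apply: eq_bigr => x' _ /=.
  rewrite -(class_expand_dual (n := b) (phi := fun y' =>
    X (a + b) lam (young (x', y')))).
    rewrite mulr_sumr; apply: eq_bigr => beta _; rewrite !cdotE.
    under eq_bigr => y' _ do rewrite -mulrA.
    by rewrite -mulr_sumr mulrCA -mulrA; congr (_ * _); apply: mulrC.
  by move=> v y'; rewrite -(youngJ 1%g v x' y') mul1g invg1 mulg1.
apply: class_expand_dual => u x'.
by rewrite -(youngJ u 1%g x' y) mul1g invg1 mulg1.
Qed.

Lemma sum_kronecker_lrcoef a b (alpha : seq nat) (beta delta : seq nat)
    (kappa : intpart (a + b)) :
  \sum_(eps : intpart b)
    (kronecker F b beta delta eps)%:R * (lrcoef F a b alpha eps kappa)%:R =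
  (cardS a)^-1 * (cardS b)^-1 * \sum_x \sum_y
    X a alpha x^-1%g * (X b beta y^-1%g * X b delta y^-1%g) *
    X (a + b) kappa (young (x, y)).
Proof.
under eq_bigr => eps _ do rewrite lrcoef_cdot cdot_prod mulrCA mulr_sumr.
rewrite -mulr_sumr exchange_big -mulrA; congr (_ * _); rewrite mulr_sumr.
apply: eq_bigr => x _ /=.
under eq_bigr => eps _ do rewrite mulrCA mulr_sumr.
rewrite -mulr_sumr exchange_big; congr (_ * _); apply: eq_bigr => y _ /=.
rewrite -(class_expand charF (phi := fun y => X b beta y * X b delta y)); last first.
  by move=> u v; rewrite !chiJ.
rewrite mulr_sumr mulr_suml; apply: eq_bigr => eps _ /=.
by rewrite kronecker_cdot -!mulrA; apply: mulrCA.
Qed.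

Lemma sum_chi_lrcoef m c (gamma : seq nat) (nu : intpart (m + c)) u :
  \sum_(kappa : intpart m) X m kappa u * (lrcoef F m c kappa gamma nu)%:R =
  (cardS c)^-1 * \sum_z X c gamma z^-1%g * X (m + c) nu (young (u, z)).
Proof.
transitivity ((cardS c)^-1 * \sum_z X c gamma z^-1%g *
    \sum_(kappa : intpart m) X m kappa u * cdot (X m kappa) (fun w =>
      X (m + c) nu (young (w, z)))).
  under [in RHS]eq_bigr => z _ do rewrite mulr_sumr.
  rewrite exchange_big mulr_sumr; apply: eq_bigr => kappa _ /=.
  rewrite lrcoef_cdot cdot_prod mulrCA -mulr_sumr.
  under eq_bigr => z _ do rewrite mulrCA.
  rewrite -mulr_sumr [RHS]mulrCA [LHS]mulrCA; congr (_ * _).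
  under [in RHS]eq_bigr => z _ do rewrite cdotE mulrCA mulr_sumr.
  rewrite -mulr_sumr [RHS]mulrCA exchange_big; congr (_ * (_ * _)).
  apply: eq_bigr => z _; apply: eq_bigr => w _ /=.
  by rewrite [RHS]mulrA; congr (_ * _); apply: mulrC.
congr (_ * _); apply: eq_bigr => z _; congr (_ * _).
apply: (class_expand_dual (phi := fun w => X (m + c) nu (young (w, z)))) => v w.
rewrite -[RHS](chiJ _ (young (v, 1%g))) -youngV -!youngM; congr (chi _ (young _)).
by apply/eqP; rewrite -pair_eqE /pair_eq /= invg1 mul1g mulg1 !eqxx.
Qed.

Lemma sum_kronecker_lrcoef2 a b c (alpha beta gamma delta : seq nat)
    (nu : intpart (a + b + c)) :
  \sum_(eps : intpart b) \sum_(kappa : intpart (a + b))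
    (kronecker F b beta delta eps)%:R * (lrcoef F a b alpha eps kappa)%:R *
    (lrcoef F (a + b) c kappa gamma nu)%:R =
  (cardS a)^-1 * (cardS b)^-1 * (cardS c)^-1 * \sum_x \sum_y \sum_z
    X a alpha x^-1%g * X b beta y^-1%g * (X c gamma z^-1%g * X b delta y^-1%g) *
    X (a + b + c) nu (young (young (x, y), z)).
Proof.
rewrite exchange_big /=.
under eq_bigr => kappa _ do rewrite -mulr_suml sum_kronecker_lrcoef -!mulrA.
rewrite -!mulr_sumr -!mulrA; congr (_ * (_ * _)).
under [LHS]eq_bigr => kappa _ do rewrite mulr_suml.
rewrite exchange_big mulr_sumr; apply: eq_bigr => x _ /=.
under [LHS]eq_bigr => kappa _ do rewrite mulr_suml.
rewrite exchange_big mulr_sumr; apply: eq_bigr => y _ /=.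
under [LHS]eq_bigr => kappa _ do rewrite -mulrA.
rewrite -mulr_sumr sum_chi_lrcoef mulrCA; congr (_ * _).
rewrite mulr_sumr; apply: eq_bigr => z _; rewrite !mulrA; congr (_ * _).
by rewrite -!mulrA; congr (_ * (_ * _)); apply: mulrC.
Qed.

Lemma coefficient_sum a b c (lam : intpart (a + b)) (mu : intpart (c + b))
    (nu : intpart (a + b + c)) :
  (\sum_(alpha : intpart a) \sum_(beta : intpart b) \sum_(gamma : intpart c)
   \sum_(delta : intpart b) \sum_(eps : intpart b) \sum_(kappa : intpart (a + b))
     lrcoef F a b alpha beta lam * lrcoef F c b gamma delta mu *
     kronecker F b beta delta eps * lrcoef F a b alpha eps kappa *
     lrcoef F (a + b) c kappa gamma nu)%N%:R =
  (cardS a)^-1 * (cardS b)^-1 * (cardS c)^-1 * \sum_x \sum_y \sum_z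
    X (a + b) lam (young (x^-1, y^-1)%g) * X (c + b) mu (young (z^-1, y^-1)%g) *
    X (a + b + c) nu (young (young (x, y), z)) :> F.
Proof.
pose w : F := (cardS a)^-1 * (cardS b)^-1 * (cardS c)^-1.
transitivity (\sum_(alpha : intpart a) \sum_(beta : intpart b)
    \sum_(gamma : intpart c) \sum_(delta : intpart b) w * \sum_x \sum_y \sum_z
    ((lrcoef F a b alpha beta lam)%:R * (X a alpha x^-1%g * X b beta y^-1%g)) *
    ((lrcoef F c b gamma delta mu)%:R * (X c gamma z^-1%g * X b delta y^-1%g)) *
    X (a + b + c) nu (young (young (x, y), z))).
  do 4! [rewrite natr_sum; apply: eq_bigr => ? _].
  under eq_bigr => eps _.
    under eq_bigr => kappa _ do rewrite -!mulnA mulnA.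
    rewrite -big_distrr /=. over.
  rewrite -big_distrr natrM /= natr_sum.
  under eq_bigr => eps _.
    rewrite natr_sum; under eq_bigr => kappa _ do rewrite mulnA !natrM.
    over.
  rewrite /= sum_kronecker_lrcoef2 -/w mulrCA natrM; congr (_ * _).
  rewrite mulr_sumr; apply: eq_bigr => x _; rewrite mulr_sumr; apply: eq_bigr => y _.
  rewrite mulr_sumr; apply: eq_bigr => z _.
  by rewrite [LHS]mulrA; congr (_ * _); apply: mulrACA.
under eq_bigr => alpha _ do under eq_bigr => beta _ do rewrite pair_bigA /=.
rewrite pair_bigA /= pair_bigA /= -mulr_sumr; congr (_ * _).
rewrite exchange_big; apply: eq_bigr => x _ /=.
rewrite exchange_big; apply: eq_bigr => y _ /=.
rewrite exchange_big; apply: eq_bigr => z _ /=.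
rewrite -mulr_suml; congr (_ * _); rewrite -!chi_young_expand !pair_bigA /=.
by rewrite big_distrlr /= pair_bigA.
Qed.

End Coefficients.

(** * The symmetric inverse semigroup *)

Section Moebius.
Variables (R : pzRingType) (V : lmodType R) (T : finType).
Implicit Types (A B C : {set T}).

Lemma moebius_toggle A (x : T) (g : {set T} -> V) :
  x \in A -> (forall B, g (x |: B) = g (B :\ x)) ->
  \sum_(B : {set T} | B \subset A) (-1) ^+ #|A :\: B| *: g B = 0.
Proof.
move=> Ax gx; rewrite (bigID (fun B : {set T} => x \in B)) /=.
rewrite (reindex_onto (fun B => x |: B) (fun B => B :\ x)) /=; last first.
  by move=> B /andP[_ xB]; rewrite setD1K.
rewrite (eq_bigl (fun B : {set T} => (B \subset A) && (x \notin B))); last first.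
  move=> B; rewrite subUset sub1set Ax setU11 andbT /=; congr (_ && _).
  apply/eqP/idP => [<-|xB]; first by rewrite setD11.
  by rewrite setU1K.
rewrite -big_split big1 // => B /andP[_ xB] /=.
have -> : g (x |: B) = g B.
  by rewrite gx; congr g; apply/setDidPl; rewrite disjoint_sym disjoints1.
have -> : A :\: B = x |: (A :\: (x |: B)).
  apply/setP => y; rewrite !inE negb_or; have [->|] := eqVneq y x; last by [].
  by rewrite Ax xB.
rewrite cardsU1 !inE eqxx /= exprD expr1 mulN1r scaleNr; apply: subrr.
Qed.

Lemma moebius_cover A C (v : V) : C \subset A ->
  \sum_(B : {set T} | B \subset A) (-1) ^+ #|A :\: B| *: ((C \subset B)%:R *: v) =
  (C == A)%:R *: v.
Proof.
move=> CA; have [->|neq] := eqVneq C A.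
  rewrite (bigD1 A) //= setDv cards0 expr0 !scale1r subxx big1 ?addr0 ?scale1r //.
  by move=> B /andP[BA nBA]; rewrite eqEsubset BA /= in nBA;
    rewrite (negPf nBA) scale0r scaler0.
have /subsetPn[x Ax xC] : ~~ (A \subset C) by apply: contra neq => AC;
  rewrite eqEsubset CA.
rewrite scale0r; apply: (moebius_toggle Ax) => B; congr (_%:R *: _).
congr nat_of_bool; apply/subsetP/subsetP => sub y Cy; have := sub y Cy.
  by rewrite !inE => /orP[/eqP yx|->]; rewrite ?andbT;
    [rewrite -yx Cy in xC | apply: contraNneq xC => <-].
by rewrite !inE => /andP[_ ->]; rewrite orbT.
Qed.

End Moebius.

Section IsnAlgebra.
Variable n : nat.
Implicit Types (p q s : isn n) (A B D : {set 'I_n}).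

Lemma isn_eqP p q : p =1 q -> p = q.
Proof. by move=> E; apply/val_inj/ffunP. Qed.

Lemma isn_idem_proof A : pinj [ffun x => if x \in A then Some x else None].
Proof.
by apply: pinjI => x y z; rewrite !ffunE; do 2![case: ifP] => // _ _ [->] [->].
Qed.
Definition isn_idem A : isn n := Isn (isn_idem_proof A).

Lemma isn_idemE A x : isn_idem A x = if x \in A then Some x else None.
Proof. by rewrite [LHS]ffunE. Qed.

Lemma isn_inv_proof p : pinj [ffun y => [pick x | p x == Some y]].
Proof.
apply: pinjI => x y z; rewrite !ffunE.
case: pickP => // u /eqP pu [<-]; case: pickP => // v /eqP pv [uv].
by move: pv; rewrite uv pu => -[].
Qed.
Definition isn_inv p : isn n := Isn (isn_inv_proof p).

Lemma isn_invE p x y : (isn_inv p y == Some x) = (p x == Some y).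
Proof.
rewrite [isn_inv p y]ffunE; case: pickP => [u /eqP pu|/(_ x) -> //].
by apply/eqP/eqP => [[<-]//|px]; rewrite (isnP px pu).
Qed.

Definition isn_im p : {set 'I_n} := isn_dom (isn_inv p).

Lemma isn_imP p y : reflect (exists x, p x = Some y) (y \in isn_im p).
Proof.
rewrite inE; apply: (iffP idP) => [|[x /eqP]].
  by case E: (isn_inv p y) => [x|] // _; exists x; apply/eqP; rewrite -isn_invE E.
by rewrite -isn_invE => /eqP->.
Qed.

Lemma isn_domP p x : reflect (exists y, p x = Some y) (x \in isn_dom p).
Proof.
rewrite inE; case: (p x) => [y|] /=; constructor; first by exists y.
by case.
Qed.

Lemma isn_idemM A B : (isn_idem A * isn_idem B = isn_idem (A :&: B))%g.
Proof.
apply: isn_eqP => x; rewrite isnM !isn_idemE inE.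
by case: (x \in B); rewrite ?andbF //= isn_idemE andbT.
Qed.

Lemma isn_idemT : isn_idem setT = 1%g.
Proof. by apply: isn_eqP => x; rewrite isn_idemE inE isn1. Qed.

Lemma isn_dom_idem p A : isn_dom p \subset A -> (p * isn_idem A = p)%g.
Proof.
move=> pA; apply: isn_eqP => x; rewrite isnM isn_idemE; case: ifP => //= xA.
by case E: (p x) => //; move: xA; rewrite (subsetP pA) // inE E.
Qed.

Lemma isn_idem_im p A : isn_im p \subset A -> (isn_idem A * p = p)%g.
Proof.
move=> pA; apply: isn_eqP => x; rewrite isnM; case E: (p x) => [y|] //=.
by rewrite isn_idemE (subsetP pA) //; apply/isn_imP; exists x.
Qed.

Lemma isn_invM p q : isn_inv (p * q)%g = (isn_inv q * isn_inv p)%g.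
Proof.
apply: isn_eqP => z; apply/eqP; rewrite eq_sym [X in X == _]isnM.
case E: (isn_inv p z) => [y|]; rewrite [obind _ _]/=.
  case E': (isn_inv q y) => [x|].
    rewrite eq_sym isn_invE isnM; move/eqP: E'; rewrite isn_invE => /eqP ->.
    by rewrite [obind _ _]/= -isn_invE E.
  case E2: (isn_inv (p * q)%g z) => [x|] //; move/eqP: E2; rewrite isn_invE isnM.
  case E3: (q x) => [y'|] //; rewrite [obind _ _]/= -isn_invE E => /eqP[yy'].
  by move/eqP: E3; rewrite -isn_invE -yy' E'.
case E2: (isn_inv (p * q)%g z) => [x|] //; move/eqP: E2; rewrite isn_invE isnM.
by case: (q x) => [y'|] //; rewrite [obind _ _]/= -isn_invE E.
Qed.

Lemma isn_invK : involutive isn_inv.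
Proof.
move=> p; apply: isn_eqP => x; case E: (p x) => [y|].
  by apply/eqP; rewrite !isn_invE E.
case E': (isn_inv (isn_inv p) x) => [y|] //; move/eqP: E'.
by rewrite !isn_invE E.
Qed.

Lemma isn_mulV p : (p * isn_inv p = isn_idem (isn_im p))%g.
Proof.
apply: isn_eqP => y; rewrite isnM isn_idemE inE.
case E: (isn_inv p y) => [x|] //=; apply/eqP; by rewrite -isn_invE E.
Qed.

Lemma isn_im_inv p : isn_im (isn_inv p) = isn_dom p.
Proof. by rewrite /isn_im isn_invK. Qed.

Lemma isn_mulVl p : (isn_inv p * p = isn_idem (isn_dom p))%g.
Proof. by rewrite -{2}(isn_invK p) isn_mulV isn_im_inv. Qed.

Lemma isn_imM p q : isn_im (p * q)%g \subset isn_im p.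
Proof. by rewrite /isn_im isn_invM isn_domM. Qed.

Lemma isn_domM_eq p q : (isn_dom (p * q)%g == isn_dom q) = (isn_im q \subset isn_dom p).
Proof.
apply/eqP/subsetP => [E y /isn_imP[x qx]|sub].
  have : x \in isn_dom q by apply/isn_domP; exists y.
  by rewrite -E => /isn_domP[z]; rewrite isnM qx /= => pz; apply/isn_domP; exists z.
apply/setP => x; apply/isn_domP/isn_domP => -[y].
  by rewrite isnM; case: (q x) => // z _; exists z.
move=> qx; have /isn_domP[z pz] : y \in isn_dom p by apply/sub/isn_imP; exists x.
by exists z; rewrite isnM qx.
Qed.

Lemma card_isn_im p : #|isn_im p| = #|isn_dom p|.
Proof.
have le q : (#|isn_im q| <= #|isn_dom q|)%N.
  pose g x := odflt x (q x).
  apply: leq_trans (leq_imset_card g _); apply/subset_leq_card/subsetP => y.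
  case/isn_imP => x qx; apply/imsetP; exists x; last by rewrite /g qx.
  by apply/isn_domP; exists y.
by apply/eqP; rewrite eqn_leq le -(isn_im_inv p); apply: le (isn_inv p).
Qed.

End IsnAlgebra.

Section Embedding.
Variable n : nat.

Definition injs (k m : nat) : Type := {f : {ffun 'I_k -> 'I_m} | injectiveb f}.
HB.instance Definition _ k m := SubType.on (injs k m).
HB.instance Definition _ k m := Finite.on (injs k m).
Definition Injs k m (f : {ffun 'I_k -> 'I_m}) (f_inj : injectiveb f) : injs k m :=
  exist (fun g : {ffun 'I_k -> 'I_m} => is_true (injectiveb g)) f f_inj.
Definition injs_fun k m (f : injs k m) : 'I_k -> 'I_m := val f.
Coercion injs_fun : injs >-> Funclass.

Lemma injs_inj k m (f : injs k m) : injective f.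
Proof. exact/injectiveP/(valP f). Qed.

Lemma injsP k m (f g : injs k m) : f =1 g -> f = g.
Proof. by move=> E; apply/val_inj/ffunP. Qed.

Definition initial k : {set 'I_n} := [set x : 'I_n | x < k]%N.

Lemma card_initial k : (k <= n)%N -> #|initial k| = k.
Proof.
by move=> kn; rewrite -sum1dep_card -(big_ord_widen _ (fun=>
  1%N)) // sum1_card card_ord.
Qed.

Section Emb.
Variables (k m : nat) (hm : (m <= n)%N).
Implicit Type f : injs k m.

Lemma isn_emb_proof f :
  pinj [ffun x : 'I_n => omap (fun i : 'I_k => widen_ord hm (f i)) (insub (x : nat))].
Proof.
apply: pinjI => x y z; rewrite !ffunE.
case: insubP => [i _ ix|] //= [<-]; case: insubP => [j _ jy|] //= [].
move=> /ord_inj/injs_inj ji; apply: val_inj.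
by rewrite /= -ix -jy ji.
Qed.
Definition isn_emb f : isn n := Isn (isn_emb_proof f).

Lemma isn_emb_lt f (x : 'I_n) (hx : (x < k)%N) :
  isn_emb f x = Some (widen_ord hm (f (Ordinal hx))).
Proof. by rewrite [LHS]ffunE insubT. Qed.

Lemma isn_emb_ord f (x : 'I_n) (i : 'I_k) :
  x = i :> nat -> isn_emb f x = Some (widen_ord hm (f i)).
Proof.
move=> xi; have hx : (x < k)%N by rewrite xi.
by rewrite (isn_emb_lt _ hx); congr (Some (widen_ord hm (f _))); apply: val_inj.
Qed.

Lemma isn_emb_ge f (x : 'I_n) : ~~ (x < k)%N -> isn_emb f x = None.
Proof. by move=> hx; rewrite [LHS]ffunE insubN. Qed.

Lemma isn_dom_emb f : isn_dom (isn_emb f) = initial k.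
Proof.
apply/setP => x; rewrite !inE; case: (boolP (x < k)%N) => hx.
  by rewrite isn_emb_lt.
by rewrite isn_emb_ge.
Qed.

Hypothesis hk : (k <= n)%N.

Lemma isn_im_emb f : isn_im (isn_emb f) = [set widen_ord hm (f i) | i : 'I_k].
Proof.
apply/setP => y; apply/isn_imP/imsetP => [[x]|[i _ ->]].
  case: (boolP (x < k)%N) => hx; last by rewrite isn_emb_ge.
  by rewrite isn_emb_lt => -[<-]; exists (Ordinal hx).
by exists (widen_ord hk i); apply: isn_emb_ord.
Qed.

Lemma isn_emb_inj : injective isn_emb.
Proof.
move=> f g E; apply: injsP => i.
have := congr1 (fun p : isn n => p (widen_ord hk i)) E.
by rewrite !(@isn_emb_ord _ _ i) // => -[] /ord_inj.
Qed.

Lemma isn_embP (p : isn n) :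
  isn_dom p = initial k -> isn_im p \subset initial m -> exists f, p = isn_emb f.
Proof.
move=> pk pm; have /choice[g gP] (i : 'I_k) : exists j : 'I_m, p (widen_ord hk i) =
  Some (widen_ord hm j).
  have /isn_domP[y py] : widen_ord hk i \in isn_dom p by rewrite pk inE /=.
  have : y \in initial m by apply/(subsetP pm)/isn_imP; exists (widen_ord hk i).
  rewrite inE => ym.
  by exists (Ordinal ym); rewrite py; congr Some; apply: val_inj.
have g_inj : injectiveb [ffun i => g i].
  apply/injectiveP => i j; rewrite !ffunE => E; have := gP i; rewrite E => pE.
  by have /(congr1 val)/= := isnP pE (gP j); apply: val_inj.
exists (Injs g_inj); apply: isn_eqP => x; case: (boolP (x < k)%N) => hx.
  by rewrite isn_emb_lt /injs_fun /= ffunE -gP; congr (p _); apply: val_inj.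
rewrite isn_emb_ge //; case E: (p x) => [y|] //.
have : x \in isn_dom p by apply/isn_domP; exists y.
by rewrite pk inE (negPf hx).
Qed.

End Emb.

Lemma card_isn_im_dom (A : {set 'I_n}) :
  #|[set p : isn n | (isn_im p == A) && (isn_dom p == initial #|A|)]| = (#|A| `!)%N.
Proof.
set k := #|A|; have hk : (k <= n)%N by rewrite -[leqRHS]card_ord max_card.
pose Q := [set f : injs k n | [forall i, injs_fun f i \in A]].
have imE (f : injs k n) : f \in Q -> isn_im (isn_emb (leqnn n) f) = A.
  rewrite inE => /forallP fA; apply/eqP; rewrite eqEcard.
  rewrite card_isn_im isn_dom_emb card_initial // leqnn andbT isn_im_emb //.
  apply/subsetP => _ /imsetP[i _ ->].
  by have -> : widen_ord (leqnn n) (f i) = f i by apply: val_inj.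
have -> : [set p : isn n | (isn_im p == A) && (isn_dom p == initial k)] =
    [set isn_emb (leqnn n) f | f in Q].
  apply/setP => p; rewrite inE; apply/andP/imsetP => [[/eqP pA /eqP pk]|[f fQ ->]].
    have [|f pE] := @isn_embP k n (leqnn n) hk p pk.
      by apply/subsetP => x _; rewrite inE.
    exists f => //; rewrite inE; apply/forallP => i; rewrite -pA pE isn_im_emb //.
    by apply/imsetP; exists i => //; apply: val_inj.
  by rewrite imE // isn_dom_emb !eqxx.
rewrite card_imset; last exact: isn_emb_inj.
transitivity (#|A| ^_ #|'I_k|)%N; last by rewrite card_ord ffactnn.
rewrite -card_inj_ffuns_on -[LHS](card_imset _ val_inj).
apply: eq_card => f; rewrite !inE; apply/imsetP/andP => [[g + ->]|[/ffun_onP fA f_inj]].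
  by rewrite inE => /forallP gA; split; [apply/ffun_onP | exact: (valP g)].
by exists (Injs f_inj) => //; rewrite inE; apply/forallP.
Qed.

End Embedding.

Section IsnSystem.
Variables (F : fieldType) (n : nat).
Hypothesis charF : [pchar F] =i pred0.
Implicit Types (V W : rep F (isn n)) (p q s : isn n) (A B D : {set 'I_n}).

(* The projector of V onto the vectors v with e_A v = v and e_B v = 0 for every
   proper subset B of A, where e_B is the partial identity on B. *)
Definition moebius V A : 'End(V) :=
  \sum_(B : {set 'I_n} | B \subset A) (-1) ^+ #|A :\: B| *: ract V (isn_idem B).

Lemma moebius_nat V W (f : 'Hom(V, W)) A : equivariant f -> (f \o moebius V A =
  moebius W A \o f)%VF.
Proof.
move=> fE; rewrite comp_lfun_sumr comp_lfun_suml; apply: eq_bigr => B _.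
by rewrite -comp_lfunZr -comp_lfunZl fE.
Qed.

Lemma idem_moebius V A D :
  (ract V (isn_idem D) \o moebius V A)%VF = if A \subset D then moebius V A else 0.
Proof.
have E : (ract V (isn_idem D) \o moebius V A)%VF =
  \sum_(B : {set 'I_n} | B \subset A) (-1) ^+ #|A :\: B| *: ract V (isn_idem (D :&: B)).
  rewrite comp_lfun_sumr; apply: eq_bigr => B _.
  by rewrite -comp_lfunZr -ractM isn_idemM.
rewrite {}E; case: ifP => [AD|/negbT/subsetPn[x Ax xD]].
  by apply: eq_bigr => B BA; rewrite (setIidPr (subset_trans BA AD)).
apply: (moebius_toggle Ax) => B; congr (ract V (isn_idem _)).
by apply/setP => y; rewrite !inE; have [->|] := eqVneq y x; rewrite // (negPf xD).
Qed.

Lemma moebius_idem V A D :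
  (moebius V A \o ract V (isn_idem D))%VF = if A \subset D then moebius V A else 0.
Proof.
rewrite -idem_moebius comp_lfun_sumr comp_lfun_suml; apply: eq_bigr => B _.
by rewrite -comp_lfunZr -comp_lfunZl -!ractM !isn_idemM setIC.
Qed.

Lemma moebiusK V A : (moebius V A \o moebius V A)%VF = moebius V A.
Proof.
rewrite {1}/moebius comp_lfun_suml (bigD1 A) //= setDv cards0 expr0 scale1r
  idem_moebius subxx.
rewrite big1 ?addr0 // => B /andP[BA nBA].
rewrite -comp_lfunZl idem_moebius; case: ifP => [AB|_]; last by rewrite scaler0.
by case/eqP: nBA; apply/eqP; rewrite eqEsubset BA.
Qed.

Lemma sum_moebius V : \sum_A moebius V A = \1%VF.
Proof.
rewrite /moebius (exchange_big_dep predT) //= (bigD1 setT) //=.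
rewrite (big_pred1 setT) => [|A]; last by rewrite subTset.
rewrite setDv cards0 expr0 scale1r isn_idemT ract1 big1 ?addr0 // => B BT.
have /subsetPn[x _ xB] : ~~ (setT \subset B) by rewrite subTset.
rewrite -scaler_suml.
have -> : \sum_(A : {set 'I_n} | B \subset A) (-1) ^+ #|A :\: B| = 0 :> F^o.
  rewrite (reindex_inj (can_inj (@setCK _))) /=.
  transitivity (\sum_(A : {set 'I_n} | A \subset ~: B) (-1) ^+ #|~: B :\: A| *: (1 :
    F^o)).
    apply: eq_big => [A|A _]; first by rewrite -setCS setCK.
    rewrite [RHS]mulr1; congr ((-1) ^+ #|pred_of_set _|).
    by apply/setP => y; rewrite !inE andbC.
  by apply: (moebius_toggle (x := x)); rewrite ?inE.
by rewrite scale0r.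
Qed.

Definition isn_img p B : {set 'I_n} := isn_im (p * isn_idem B)%g.

Lemma isn_imgP p B y : reflect (exists2 x, x \in B & p x = Some y) (y \in isn_img p B).
Proof.
apply: (iffP (isn_imP _ _)) => -[x].
  by rewrite isnM isn_idemE; case: ifP => // Bx /= px; exists x.
by move=> Bx px; exists x; rewrite isnM isn_idemE Bx.
Qed.

Lemma isn_imgK p B : B \subset isn_dom p -> isn_img (isn_inv p) (isn_img p B) = B.
Proof.
move=> Bp; apply/setP => x; apply/isn_imgP/idP => [[y /isn_imgP[z Bz pz]]|Bx].
  by move/eqP; rewrite isn_invE => /eqP px; rewrite (isnP px pz).
have /isn_domP[y px] := subsetP Bp x Bx.
exists y; first by apply/isn_imgP; exists x.
by apply/eqP; rewrite isn_invE px.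
Qed.

Lemma isn_img_im p B : isn_img p B \subset isn_im p.
Proof. exact: isn_imM. Qed.

Lemma isn_idem_conj p B : (p * isn_idem B * isn_inv p = isn_idem (isn_img p B))%g.
Proof.
have -> : (p * isn_idem B * isn_inv p =
    (p * isn_idem B) * isn_inv (p * isn_idem B))%g.
  have idemV : isn_inv (isn_idem B) = isn_idem B.
    apply: isn_eqP => x; apply/eqP; rewrite isn_idemE; case: ifP => Bx.
      by rewrite isn_invE isn_idemE Bx.
    case E: (isn_inv (isn_idem B) x) => [y|] //; move/eqP: E.
    by rewrite isn_invE isn_idemE; case: ifP => // By /eqP[yx]; rewrite -yx By in Bx.
  by rewrite isn_invM idemV !mulgA -[(p * _ * isn_idem B)%g]mulgA isn_idemM setIid.
exact: isn_mulV.
Qed.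

Lemma moebius_conj V p :
  (ract V p \o moebius V (isn_dom p) \o ract V (isn_inv p))%VF = moebius V (isn_im p).
Proof.
rewrite comp_lfun_sumr comp_lfun_suml.
rewrite [RHS](reindex_onto (isn_img p) (isn_img (isn_inv p))) /=; last first.
  by move=> B Bp; have := @isn_imgK (isn_inv p) B Bp; rewrite isn_invK.
apply: eq_big => [B|B Bp].
  rewrite isn_img_im; apply/idP/eqP => [/isn_imgK//|<-].
  by rewrite -(isn_im_inv p) isn_img_im.
rewrite -comp_lfunZr -comp_lfunZl -!ractM isn_idem_conj; congr ((-1) ^+ _ *: _).
have cardI (C : {set 'I_n}) : C \subset isn_dom p -> #|isn_img p C| = #|C|.
  move=> Cp; rewrite card_isn_im; congr #|pred_of_set _|.
  apply/setP => x; apply/isn_domP/idP => [[y]|Cx].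
    by rewrite isnM isn_idemE; case: ifP.
  by have /isn_domP[y px] := subsetP Cp x Cx; exists y; rewrite isnM isn_idemE Cx.
by rewrite !cardsD !(setIidPr _) ?isn_img_im ?cardI // card_isn_im.
Qed.

Lemma ract_moebius V s p :
  (ract V s \o (ract V p \o moebius V (isn_dom p)))%VF =
  if isn_im p \subset isn_dom s then (ract V (s * p)%g \o moebius V (isn_dom (s *
    p)%g))%VF
  else 0.
Proof.
rewrite comp_lfunA -ractM; case: ifP => [ps|nps].
  by have /eqP-> : isn_dom (s * p)%g == isn_dom p by rewrite isn_domM_eq.
rewrite -{1}(isn_dom_idem (p := (s * p)%g) (subxx _)) ractM -comp_lfunA idem_moebius.
case: ifP => [sub|]; last by rewrite comp_lfun0r.
by rewrite -isn_domM_eq eqEsubset isn_domM sub in nps.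
Qed.

(* Of the p in IS_n only those in the chosen left cells L_k contribute; the
   weight 1 / k! compensates for the k! elements of L_k with a given image. *)
Definition isn_weight p : F :=
  (isn_dom p == initial n #|isn_dom p|)%:R / (#|isn_dom p|`!)%:R.

Definition isn_left V p : 'End(V) :=
  isn_weight p *: (ract V p \o moebius V (isn_dom p))%VF.
Definition isn_right V p : 'End(V) := (moebius V (isn_dom p) \o ract V (isn_inv p))%VF.

Lemma isn_left_nat V W (f : 'Hom(V, W)) p : equivariant f ->
  (f \o isn_left V p = isn_left W p \o f)%VF.
Proof.
move=> fE; rewrite /isn_left -comp_lfunZr -comp_lfunZl comp_lfunA fE.
by rewrite -!comp_lfunA moebius_nat.
Qed.

Lemma isn_right_nat V W (f : 'Hom(V, W)) p : equivariant f ->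
  (f \o isn_right V p = isn_right W p \o f)%VF.
Proof. by move=> fE; rewrite /isn_right comp_lfunA moebius_nat // -!comp_lfunA fE. Qed.

Lemma isn_right_ract V p s :
  (isn_right V p \o ract V s)%VF =
  if isn_im p \subset isn_im s then
    (moebius V (isn_dom p) \o ract V (isn_inv p * s)%g)%VF else 0.
Proof.
rewrite /isn_right -comp_lfunA -ractM; case: ifP => // nps.
rewrite -(isn_idem_im (p := (isn_inv p * s)%g) (subxx _)) ractM comp_lfunA moebius_idem.
case: ifP => [sub|]; last by rewrite comp_lfun0l.
move: sub; rewrite /isn_im isn_invM isn_invK => sub.
by rewrite -[isn_im s]/(isn_dom _) -isn_domM_eq eqEsubset isn_domM sub in nps.
Qed.

Lemma isn_sep_comm V W (f : 'Hom(V, W)) :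
  equivariant (\sum_p (isn_left W p \o f \o isn_right V p))%VF.
Proof.
move=> s; rewrite comp_lfun_suml comp_lfun_sumr.
transitivity (\sum_(p | isn_im p \subset isn_im s)
  (isn_left W p \o f \o (moebius V (isn_dom p) \o ract V (isn_inv p * s)%g)))%VF.
  rewrite [RHS]big_mkcond; apply: eq_bigr => p _; rewrite -comp_lfunA isn_right_ract.
  by case: ifP => // _; rewrite comp_lfun0r.
transitivity (\sum_(p | isn_im p \subset isn_dom s)
  (isn_weight p *: (ract W (s * p)%g \o moebius W (isn_dom (s * p)%g)) \o f \o
    isn_right V p))%VF; last first.
  rewrite big_mkcond; apply: eq_bigr => p _;
    rewrite !comp_lfunA -comp_lfunZr ract_moebius.
  by case: ifP => // _; rewrite scaler0 !comp_lfun0l.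
rewrite (reindex_onto (fun p => s * p)%g (fun q => isn_inv s * q)%g) /=; last first.
  by move=> q sq; rewrite mulgA isn_mulV isn_idem_im.
apply: eq_big => [p|p].
  rewrite isn_imM /=; apply/eqP/idP => [<-|ps].
    by rewrite -(isn_im_inv s) isn_imM.
  by rewrite mulgA isn_mulVl isn_idem_im.
case/andP=> _ /eqP pE.
have ps : isn_im p \subset isn_dom s by rewrite -pE -(isn_im_inv s) isn_imM.
have /eqP dE : isn_dom (s * p)%g == isn_dom p by rewrite isn_domM_eq.
rewrite /isn_left /isn_weight dE; congr (_ \o _)%VF; rewrite /isn_right.
rewrite isn_invM -mulgA isn_mulVl isn_dom_idem //.
Qed.

Lemma isn_sep_one V : (\sum_p (isn_left V p \o isn_right V p))%VF = \1%VF.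
Proof.
rewrite -(sum_moebius V) (partition_big (@isn_im n) predT) //=; apply: eq_bigr => A _.
transitivity (\sum_(p | isn_im p == A) isn_weight p *: moebius V A).
  apply: eq_bigr => p /eqP <-; rewrite -comp_lfunZl; congr (_ *: _).
  by rewrite comp_lfunA -[(_ \o _ \o moebius V _)%VF]comp_lfunA moebiusK moebius_conj.
rewrite -scaler_suml -[RHS]scale1r; congr (_ *: _).
transitivity (\sum_(p in [set p : isn n | (isn_im p == A) && (isn_dom p == initial n
  #|A|)])
    (#|A|`!)%:R^-1 : F).
  rewrite [LHS]big_mkcond [RHS]big_mkcond; apply: eq_bigr => p _; rewrite inE.
  case: eqP => //= pA; rewrite /isn_weight -card_isn_im pA.
  by case: eqP => _; rewrite ?mul1r ?mul0r.
rewrite sumr_const card_isn_im_dom -[LHS]mulr_natr mulVf // natr_neq0 //.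
exact: fact_gt0.
Qed.

Definition isn_sys : sepsys F (isn n) :=
  Sepsys isn_left_nat isn_right_nat isn_sep_comm isn_sep_one.

Lemma lftrace_moebius_eq0 V p : isn_dom p != isn_im p ->
  lftrace (ract V p \o moebius V (isn_dom p))%VF = 0.
Proof.
move=> dp; rewrite -{1}(isn_idem_im (p := p) (subxx _)) ractM -comp_lfunA lftraceC.
rewrite -comp_lfunA moebius_idem; case: ifP => [sub|_].
  by case/eqP: dp; apply/eqP; rewrite eqEcard sub card_isn_im leqnn.
by rewrite comp_lfun0r -(scale0r (0 : 'End(V))) lftraceZ mul0r.
Qed.

End IsnSystem.

(** * Characters of the symmetric inverse semigroup *)

Lemma isnM_some n (p q : isn n) x y : q x = Some y -> (p * q)%g x = p y.
Proof. by rewrite isnM => ->. Qed.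

Lemma isnM_none n (p q : isn n) x : q x = None -> (p * q)%g x = None.
Proof. by rewrite isnM => ->. Qed.

Section SymInIsn.
Variables (n m : nat) (hm : (m <= n)%N).
Implicit Types (s t : symg m).

Lemma injs_of_perm_proof (s : symg m) : injectiveb [ffun i => s i].
Proof. by apply/injectiveP => i j; rewrite !ffunE => /perm_inj. Qed.
Definition injs_of_perm s : injs m m := Injs (injs_of_perm_proof s).

Lemma injs_of_permE s i : injs_of_perm s i = s i.
Proof. by rewrite /injs_fun ffunE. Qed.

Lemma isn_of_symE s : isn_of_sym hm s = isn_emb hm (injs_of_perm s).
Proof.
apply: isn_eqP => x; case: (boolP (x < m)%N) => hx.
  by rewrite isn_of_sym_lt isn_emb_lt injs_of_permE.
by rewrite isn_of_sym_ge // isn_emb_ge.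
Qed.

Lemma isn_of_sym_ord s (x : 'I_n) (i : 'I_m) :
  x = i :> nat -> isn_of_sym hm s x = Some (widen_ord hm (s i)).
Proof. by move=> xi; rewrite isn_of_symE (isn_emb_ord _ _ xi) injs_of_permE. Qed.

Lemma isn_emb_im_initial k (f : injs k m) : (k <= n)%N ->
  isn_im (isn_emb hm f) \subset initial n m.
Proof.
move=> hk; rewrite isn_im_emb //; apply/subsetP => _ /imsetP[i _ ->].
by rewrite inE /=.
Qed.

Lemma isn_dom_sym s : isn_dom (isn_of_sym hm s) = initial n m.
Proof. by rewrite isn_of_symE isn_dom_emb. Qed.

Lemma isn_im_sym s : isn_im (isn_of_sym hm s) = initial n m.
Proof.
apply/eqP; rewrite eqEcard card_isn_im isn_dom_sym leqnn andbT isn_of_symE.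
exact: isn_emb_im_initial.
Qed.

Lemma isn_of_sym_inj : injective (isn_of_sym hm).
Proof.
move=> s t; rewrite !isn_of_symE => /isn_emb_inj-/(_ hm) E; apply/permP => i.
by rewrite -[LHS]injs_of_permE E injs_of_permE.
Qed.

Lemma isn_of_symP (p : isn n) : isn_dom p = initial n m -> isn_im p = initial n m ->
  exists s, p = isn_of_sym hm s.
Proof.
move=> pd pm; have [|f ->] := isn_embP hm hm pd; first by rewrite pm.
exists (perm (@injs_inj _ _ f) : symg m); rewrite isn_of_symE; congr isn_emb.
by apply: injsP => i; rewrite injs_of_permE /sperm permE.
Qed.

Lemma isn_inv_sym s : isn_inv (isn_of_sym hm s) = isn_of_sym hm s^-1%g.
Proof.
have sV : (isn_of_sym hm s * isn_of_sym hm s^-1)%g = isn_idem (initial n m).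
  apply: isn_eqP => x; rewrite isnM isn_idemE inE; case: ifPn => hx; last first.
    by rewrite isn_of_sym_ge.
  rewrite isn_of_sym_lt [obind _ _]/=.
  rewrite (@isn_of_sym_ord _ _ ((s^-1)%g (Ordinal hx))) // spermKV; congr Some.
  exact: val_inj.
rewrite -[LHS](isn_dom_idem (A := initial n m)); last by rewrite -(isn_im_sym s).
by rewrite -sV mulgA isn_mulVl isn_dom_sym isn_idem_im // isn_im_sym.
Qed.

End SymInIsn.

Section IsnCharacters.
Variables (F : fieldType) (n : nat).
Hypothesis charF : [pchar F] =i pred0.

(* The character of the S_m-module formed by the vectors of V supported on the
   initial segment of size m. *)
Definition comp_chi (V : rep F (isn n)) m (hm : (m <= n)%N) (s : symg m) : F :=
  lftrace (ract V (isn_of_sym hm s) \o moebius V (initial n m))%VF.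

Lemma comp_chiE V m (hm : (m <= n)%N) s : comp_chi V hm s =
  \sum_(B : {set 'I_n} | B \subset initial n m)
    (-1) ^+ #|initial n m :\: B| * chi V (isn_of_sym hm s * isn_idem B)%g.
Proof.
rewrite /comp_chi comp_lfun_sumr lftrace_sum; apply: eq_bigr => B _.
by rewrite -comp_lfunZr lftraceZ chiE ractM.
Qed.

Lemma pairing_isn (V W : rep F (isn n)) :
  pairing (isn_sys n charF) V W =
  \sum_(k < n.+1) (k`!)%:R^-1 *
    \sum_(s : symg k) comp_chi V (leq_ord k) s^-1%g * comp_chi W (leq_ord k) s.
Proof.
pose c (p : isn n) : 'I_n.+1 := inord #|isn_dom p|.
rewrite /pairing (partition_big c predT) //=; apply: eq_bigr => k _.
pose G p := lftrace (isn_right V p) * lftrace (isn_left W p).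
transitivity (\sum_(p in [set isn_of_sym (leq_ord k) s | s : symg k]) G p).
  rewrite [LHS]big_mkcond [RHS]big_mkcond; apply: eq_bigr => p _ /=.
  case: ifPn => [/eqP pk|]; last first.
    case: imsetP => // -[s _ ->]; rewrite /c isn_dom_sym card_initial ?leq_ord //.
    by rewrite inord_val eqxx.
  case: imsetP => // np; rewrite /isn_left lftraceZ /isn_weight.
  have dk : #|isn_dom p| = k.
    by rewrite -pk inordK // ltnS -[leqRHS]card_ord max_card.
  case: eqP => [dp|_]; last by rewrite mul0r !mul0r mulr0.
  rewrite lftrace_moebius_eq0 ?mulr0 //; apply/eqP => pd; apply: np.
  rewrite dk in dp; have [|s ->] := isn_of_symP (leq_ord k) dp.
    by rewrite -pd dp.
  by exists s.
rewrite big_imset /=; last by move=> s t _ _; apply: isn_of_sym_inj.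
rewrite mulr_sumr; apply: eq_bigr => s _.
rewrite /G /isn_left /isn_right lftraceZ lftraceC isn_inv_sym /isn_weight isn_dom_sym.
by rewrite card_initial ?leq_ord // eqxx mul1r mulrCA.
Qed.

Lemma moebius_coverF (A C : {set 'I_n}) : C \subset A ->
  \sum_(B : {set 'I_n} | B \subset A) (-1) ^+ #|A :\: B| * (C \subset B)%:R = (C ==
    A)%:R :> F.
Proof.
move=> CA; have := moebius_cover (1 : F^o) CA; rewrite [RHS]mulr1 => <-.
by apply: eq_bigr => B _; rewrite [X in _ *: X]mulr1.
Qed.

Section Simple.
Variables (k : nat) (hk : (k <= n)%N) (lam : seq nat).

Definition fixed_by k m (s : symg m) (h : symg k) (f : injs k m) :=
  [forall i, s (f (h i)) == f i].

Lemma chi_isn_simple x :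
  chi (isn_simple F hk lam) x = (k`!)%:R^-1 *
  \sum_(h : symg k) #|[pred a : lcell n k | x * (val a * isn_of_sym hk h^-1%g) == val
    a]%g|%:R *
    chi (specht F k lam) h.
Proof.
rewrite chi_bal_tens //; congr (_%:R^-1 * _).
  exact: (card_Sn k).
apply: eq_bigr => h _; congr (_ * _).
rewrite -lin_pmap_comp lftrace_pmap; congr _%:R; apply: eq_card => a; rewrite !inE /=.
rewrite /cell_left_map; apply/eqP/eqP => [|E].
  by case: insubP => // b _ bE [ba]; rewrite -bE ba.
by rewrite -[RHS]valK; congr insub.
Qed.

Lemma card_fixed_cells m (hm : (m <= n)%N) (s : symg m) (h : symg k) (B : {set 'I_n}) :
  #|[pred a : lcell n k |
      (isn_of_sym hm s * isn_idem B) * (val a * isn_of_sym hk h) == val a]%g| =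
  #|[pred f : injs k m | (isn_im (isn_emb hm f) \subset B) && fixed_by s h f]|.
Proof.
have cellP (f : injs k m) : lcell_pred k (isn_emb hm f) by apply/eqP;
  apply: isn_dom_emb.
pose cell f : lcell n k := exist (fun p : isn n =>
  is_true (lcell_pred k p)) _ (cellP f).
have cell_inj : injective cell by move=> f g /(congr1 val)/isn_emb_inj; apply.
rewrite -[RHS](card_imset _ cell_inj); apply: eq_card => a; rewrite inE.
have evalE (f : injs k m) (i : 'I_k) :
    (isn_of_sym hm s * isn_idem B * (isn_emb hm f * isn_of_sym hk h))%g (widen_ord hk
      i) =
    if widen_ord hm (f (h i)) \in B then Some (widen_ord hm (s (f (h i)))) else None.
  have hE : isn_of_sym hk h (widen_ord hk i) = Some (widen_ord hk (h i)).
    exact: isn_of_sym_ord.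
  have fE : isn_emb hm f (widen_ord hk (h i)) = Some (widen_ord hm (f (h i))).
    exact: isn_emb_ord.
  have sE : isn_of_sym hm s (widen_ord hm (f (h i))) = Some (widen_ord hm (s (f (h
    i)))).
    exact: isn_of_sym_ord.
  rewrite (@isnM_some _ _ _ _ (widen_ord hm (f (h i))));
    last by rewrite (isnM_some _ hE).
  have := isn_idemE B (widen_ord hm (f (h i))).
  by case: ifP => _ => [/(isnM_some _)->|/(isnM_none _)->].
apply/eqP/imsetP => [aE|[f + ->]].
  have /eqP ad := valP a.
  have [|f fE] := isn_embP hm hk ad.
    rewrite -aE; apply: subset_trans (isn_imM _ _) _;
      apply: subset_trans (isn_imM _ _) _.
    by rewrite isn_im_sym.
  rewrite fE in aE; have pt i := congr1 (fun p : isn n => p (widen_ord hk i)) aE.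
  have fB i : widen_ord hm (f (h i)) \in B.
    have := pt i; rewrite /= evalE (@isn_emb_ord _ _ _ _ _ _ i) //.
    by case: ifP.
  exists f; last exact: val_inj.
  rewrite inE; apply/andP; split.
    rewrite isn_im_emb //; apply/subsetP => _ /imsetP[i _ ->].
    by have := fB (h^-1%g i); rewrite spermKV.
  apply/forallP => i; have := pt i; rewrite /= evalE fB (@isn_emb_ord _ _ _ _ _ _ i) //.
  by move=> [/ord_inj->].
rewrite inE => /andP[fB /forallP ffix]; apply: isn_eqP => x.
case: (boolP (x < k)%N) => hx; last first.
  by rewrite isnM_none ?isnM_none ?isn_of_sym_ge // [RHS]isn_emb_ge.
have -> : x = widen_ord hk (Ordinal hx) by apply: val_inj.
rewrite [val (cell f)]/= evalE (subsetP fB); last by rewrite isn_im_emb //;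
  apply/imsetP; exists (h (Ordinal hx)).
by rewrite (@isn_emb_ord _ _ _ _ _ _ (Ordinal hx)) // (eqP (ffix _)).
Qed.

Lemma chi_isn_simple_idem m (hm : (m <= n)%N) (s : symg m) (B : {set 'I_n}) :
  chi (isn_simple F hk lam) (isn_of_sym hm s * isn_idem B)%g =
  (k`!)%:R^-1 * \sum_(h : symg k) \sum_(f : injs k m | fixed_by s h^-1%g f)
    (isn_im (isn_emb hm f) \subset B)%:R * chi (specht F k lam) h.
Proof.
rewrite chi_isn_simple; congr (_ * _); apply: eq_bigr => h _.
rewrite card_fixed_cells -sum1_card natr_sum mulr_suml.
rewrite [LHS]big_mkcond [RHS]big_mkcond; apply: eq_bigr => f _; rewrite inE.
by case: (_ \subset _); case: fixed_by => //=; rewrite mul0r.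
Qed.

Lemma comp_chi_simple m (hm : (m <= n)%N) (s : symg m) :
  comp_chi (isn_simple F hk lam) hm s =
  (k`!)%:R^-1 * \sum_(h : symg k)
    \sum_(f : injs k m | fixed_by s h^-1%g f && (isn_im (isn_emb hm f) == initial n m))
      chi (specht F k lam) h.
Proof.
rewrite comp_chiE; under eq_bigr => B _ do rewrite chi_isn_simple_idem mulrCA mulr_sumr.
rewrite -mulr_sumr exchange_big; congr (_ * _); apply: eq_bigr => h _ /=.
under eq_bigr => B _ do rewrite mulr_sumr.
rewrite exchange_big big_mkcondr; apply: eq_bigr => f _ /=.
under eq_bigr => B _ do rewrite mulrA.
rewrite -mulr_suml moebius_coverF; last exact: isn_emb_im_initial.
by case: eqP => _; rewrite ?mul1r ?mul0r.
Qed.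

Lemma comp_chi_simple_neq m (hm : (m <= n)%N) (s : symg m) :
  m != k -> comp_chi (isn_simple F hk lam) hm s = 0.
Proof.
move=> mk; rewrite comp_chi_simple big1 ?mulr0 // => h _; rewrite big_pred0 // => f.
apply/negP => /andP[_ /eqP im_f]; case/eqP: mk.
by rewrite -(card_initial hm) -im_f card_isn_im isn_dom_emb card_initial.
Qed.

Lemma comp_chi_simple_eq (hk' : (k <= n)%N) (s : symg k) :
  comp_chi (isn_simple F hk lam) hk' s = chi (specht F k lam) s.
Proof.
have bij_perm : bijective (@injs_of_perm k).
  exists (fun f => perm (@injs_inj _ _ f) : symg k) => [t|f].
    by apply/permP => i; rewrite permE injs_of_permE.
  by apply: injsP => i; rewrite injs_of_permE /sperm permE.
rewrite comp_chi_simple.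
transitivity ((k`!)%:R^-1 * \sum_(h : symg k) \sum_(t : symg k | h == (t^-1 * s * t)%g)
    chi (specht F k lam) h).
  congr (_ * _); apply: eq_bigr => h _; rewrite (reindex _ (onW_bij _ bij_perm)) /=.
  apply: eq_bigl => t; rewrite -isn_of_symE isn_im_sym eqxx andbT.
  apply/forallP/eqP => [H|-> i].
    suff E : (s * t = t * h)%g by rewrite -mulgA E mulKg.
    apply/permP => i; have := H (h i).
    by rewrite !injs_of_permE spermVK [X in _ -> X = _]spermM [X in _ -> _ = X]spermM
      => /eqP.
  have E : (s * t * (t^-1 * s * t)^-1)%g = t by rewrite !invMg invgK -mulgA !mulKVg.
  by rewrite !injs_of_permE -[X in _ == sperm X i]E !spermM.
rewrite (exchange_big_dep predT) //=.
rewrite (eq_bigr (fun=> chi (specht F k lam) s)) => [|t _].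
  rewrite sumr_const -[X in _ * X]mulr_natl [X in _ * (X%:R * _)](card_Sn k) mulKf //.
  by rewrite natr_neq0 // fact_gt0.
by rewrite big_pred1_eq -{2}(invgK t) chiJ.
Qed.

End Simple.

Definition jointly_onto k l m (f : injs k m) (g : injs l m) :=
  [forall x, (x \in codom f) || (x \in codom g)].

Lemma comp_chi_inner_simple k l m (hk : (k <= n)%N) (hl : (l <= n)%N) (hm : (m <= n)%N)
    (lam mu : seq nat) (s : symg m) :
  comp_chi (inner_tens (isn_simple F hk lam) (isn_simple F hl mu)) hm s =
  (k`!)%:R^-1 * (l`!)%:R^-1 * \sum_(h : symg k) \sum_(h' : symg l)
    \sum_(f : injs k m | fixed_by s h^-1%g f) \sum_(g : injs l m | fixed_by s h'^-1%g g)
      (jointly_onto f g)%:R * (chi (specht F k lam) h * chi (specht F l mu) h').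
Proof.
rewrite comp_chiE.
transitivity (\sum_(B : {set 'I_n} | B \subset initial n m)
    (k`!)%:R^-1 * (l`!)%:R^-1 * \sum_(h : symg k) \sum_(h' : symg l)
    \sum_(f : injs k m | fixed_by s h^-1%g f) \sum_(g : injs l m | fixed_by s h'^-1%g g)
    ((-1) ^+ #|initial n m :\: B| *
      (isn_im (isn_emb hm f) :|: isn_im (isn_emb hm g) \subset B)%:R) *
      (chi (specht F k lam) h * chi (specht F l mu) h')).
  apply: eq_bigr => B _; rewrite chi_inner !chi_isn_simple_idem.
  rewrite [X in _ * X]mulrACA [LHS]mulrCA; congr (_ * _).
  rewrite big_distrlr mulr_sumr; apply: eq_bigr => h _ /=.
  rewrite mulr_sumr; apply: eq_bigr => h' _.
  rewrite big_distrlr mulr_sumr; apply: eq_bigr => f _ /=.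
  rewrite mulr_sumr; apply: eq_bigr => g _.
  rewrite -mulrA; congr (_ * _); rewrite mulrACA; congr (_ * _).
  by rewrite subUset -natrM mulnb.
rewrite -mulr_sumr exchange_big; congr (_ * _); apply: eq_bigr => h _ /=.
rewrite exchange_big; apply: eq_bigr => h' _ /=.
rewrite exchange_big; apply: eq_bigr => f _ /=.
rewrite exchange_big; apply: eq_bigr => g _ /=.
rewrite -mulr_suml moebius_coverF; last by rewrite subUset !isn_emb_im_initial.
congr (_%:R * _); congr nat_of_bool; rewrite !isn_im_emb //.
apply/eqP/forallP => [E x|onto].
  have : widen_ord hm x \in initial n m by rewrite inE /=.
  rewrite -E inE => /orP[] /imsetP[i _ /(congr1 val)/= xi]; apply/orP; [left|right];
    by apply/codomP; exists i; apply: val_inj.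
apply/setP => y; rewrite [RHS]inE; apply/idP/idP.
  by rewrite inE => /orP[] /imsetP[i _ ->] /=.
move=> ym; have yE : y = widen_ord hm (Ordinal ym) by apply: val_inj.
rewrite inE; have /orP[/codomP[i iE]|/codomP[i iE]] := onto (Ordinal ym);
  apply/orP; [left|right]; by apply/imsetP; exists i; rewrite // yE iE.
Qed.

Lemma pairing_simple (V : rep F (isn n)) m (hm : (m <= n)%N) (nu : seq nat) :
  pairing (isn_sys n charF) (isn_simple F hm nu) V =
  (m`!)%:R^-1 * \sum_(s : symg m) chi (specht F m nu) s^-1%g * comp_chi V hm s.
Proof.
have m_lt : (m < n.+1)%N by [].
rewrite pairing_isn (bigD1 (Ordinal m_lt)) //= [X in _ + X]big1 ?addr0 => [|k km].
  congr (_ * _); apply: eq_bigr => s _; rewrite comp_chi_simple_eq;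
    congr (_ * comp_chi V _ _).
  exact: bool_irrelevance.
rewrite big1 ?mulr0 // => s _; rewrite comp_chi_simple_neq ?mul0r //.
Qed.

Lemma pairing_simple_self m (hm : (m <= n)%N) (nu : intpart m) :
  pairing (isn_sys n charF) (isn_simple F hm nu) (isn_simple F hm nu) =
  cdot (chi (specht F m nu)) (chi (specht F m nu)).
Proof.
rewrite pairing_simple cdotE; congr (_%:R^-1 * _);
  first by rewrite -[RHS]/#|{perm 'I_m}| card_Sn.
by apply: eq_bigr => s _; rewrite comp_chi_simple_eq.
Qed.

End IsnCharacters.

Section OrbitAverage.
Variables (F : fieldType) (G : finGroupType) (T : finType) (act : G -> T -> T).
Hypothesis charF : [pchar F] =i pred0.
Hypothesis act1 : forall x, act 1%g x = x.
Hypothesis actM : forall g h x, act (g * h)%g x = act g (act h x).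
Variables (J : pred T) (x0 : T) (phi : G -> F).
Hypothesis J_orbit : forall x, J x <-> exists u, x = act u x0.
Hypothesis phiJ : forall u g, phi (u * g * u^-1)%g = phi g.

Lemma act_inj g : injective (act g).
Proof. by move=> x y /(congr1 (act g^-1%g)); rewrite -!actM mulVg !act1. Qed.

(* Count pairs (u, g) such that g fixes u x0. *)
Lemma orbit_average :
  #|G|%:R^-1 * \sum_g \sum_(x | J x && (act g x == x)) phi g =
  #|[pred g | act g x0 == x0]|%:R^-1 * \sum_(g | act g x0 == x0) phi g.
Proof.
pose fixsum x := \sum_(g | act g x == x) phi g.
set N := #|[pred g | act g x0 == x0]|.
have N0 : N%:R != 0 :> F.
  by apply: natr_neq0 => //; apply/card_gt0P; exists 1%g; rewrite inE act1.
have fixsumJ u : fixsum (act u x0) = fixsum x0.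
  rewrite /fixsum (reindex_inj (h := fun g => (u * g * u^-1)%g)) /=; last first.
    by move=> g h /mulIg/mulgI.
  apply: eq_big => [g|g _]; last exact: phiJ.
  by rewrite -actM mulgKV actM (inj_eq (@act_inj u)).
have card_trans x : J x -> #|[pred u | act u x0 == x]| = N.
  move=> /J_orbit[u ->]; rewrite /N -[RHS](card_imset _ (@mulgI _ u)).
  apply: eq_card => g; rewrite [LHS]inE; apply/idP/imsetP => [/eqP E|[h + ->]].
    by exists (u^-1 * g)%g; rewrite ?mulKVg // inE actM E -actM mulVg act1.
  by rewrite inE actM (inj_eq (@act_inj u)).
have total : #|G|%:R * fixsum x0 = N%:R * \sum_(x | J x) fixsum x.
  transitivity (\sum_(u : G) fixsum (act u x0)).
    by rewrite (eq_bigr _ (fun u _ => fixsumJ u)) sumr_const mulr_natl.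
  rewrite (partition_big (act^~ x0) J) /=; last by move=> u _; apply/J_orbit; exists u.
  rewrite mulr_sumr; apply: eq_bigr => x Jx.
  rewrite (eq_bigr (fun=> fixsum x)) => [|u /eqP -> //].
  by rewrite sumr_const card_trans // mulr_natl.
rewrite -/(fixsum x0); apply: (mulfI (card_group_neq0 charF G)).
rewrite mulVKf ?card_group_neq0 // mulrCA total mulKf //.
rewrite (exchange_big_dep J) /=; last by move=> g x _ /andP[].
by apply: eq_bigr => x Jx; apply: eq_bigl => g; rewrite Jx.
Qed.

End OrbitAverage.

(** * Counting pairs of injections *)

Section InjectionAction.
Variables k m : nat.
Implicit Types (s : symg m) (h : symg k) (f : injs k m).

Lemma inj_act_proof s h f : injectiveb [ffun i => s (f (h^-1%g i))].
Proof.
by apply/injectiveP => i j; rewrite !ffunE => /perm_inj/injs_inj/perm_inj.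
Qed.
Definition inj_act s h f : injs k m := Injs (inj_act_proof s h f).

Lemma inj_actE s h f i : inj_act s h f i = s (f (h^-1%g i)).
Proof. by rewrite /injs_fun ffunE. Qed.

Lemma inj_act1 f : inj_act 1%g 1%g f = f.
Proof. by apply: injsP => i; rewrite inj_actE invg1 !sperm1. Qed.

Lemma inj_actM s t h u f : inj_act (s * t)%g (h * u)%g f = inj_act s h (inj_act t u f).
Proof. by apply: injsP => i; rewrite !inj_actE invMg !spermM. Qed.

Lemma fixed_byE s h f : fixed_by s h^-1%g f = (inj_act s h f == f).
Proof.
apply/forallP/eqP => [E|E i]; first by apply: injsP => i; rewrite inj_actE (eqP (E i)).
by rewrite -{2}E inj_actE.
Qed.

Lemma inj_act_fixP s h f : reflect (forall i, s (f i) = f (h i)) (inj_act s h f == f).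
Proof.
rewrite -fixed_byE; apply: (iffP forallP) => E i; last by rewrite E spermKV.
by have /eqP := E (h i); rewrite spermVK.
Qed.

Lemma codom_inj_act s h f x : (x \in codom (inj_act s h f)) = (s^-1%g x \in codom f).
Proof.
apply/codomP/codomP => -[i E].
  by exists (h^-1%g i); rewrite E inj_actE spermVK.
by exists (h i); rewrite inj_actE spermVK -E spermKV.
Qed.

End InjectionAction.

Section Stabilizer.
Variables a b c : nat.

Lemma lshift_injb m n : injectiveb [ffun i : 'I_m => lshift n i].
Proof. by apply/injectiveP => i j; rewrite !ffunE => /lshift_inj. Qed.
Definition left_inj : injs (a + b) (a + b + c) := Injs (lshift_injb (a + b) c).

Lemma left_injE i : left_inj i = lshift c i.
Proof. by rewrite /injs_fun ffunE. Qed.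

Definition right_fun (i : 'I_(c + b)) : 'I_(a + b + c) :=
  match fintype.split i with
  | inl z => rshift (a + b) z
  | inr y => lshift c (rshift a y)
  end.

Lemma right_funl z : right_fun (lshift b z) = rshift (a + b) z.
Proof. by rewrite /right_fun (unsplitK (inl _)). Qed.
Lemma right_funr y : right_fun (rshift c y) = lshift c (rshift a y).
Proof. by rewrite /right_fun (unsplitK (inr _)). Qed.

Lemma right_injb : injectiveb [ffun i => right_fun i].
Proof.
apply/injectiveP => i j; rewrite !ffunE.
case: (split_ordP i) => [z ->|y ->]; case: (split_ordP j) => [z' ->|y' ->];
  rewrite ?right_funl ?right_funr.
- by move/rshift_inj->.
- by move/eqP; rewrite eq_rlshift.
- by move/eqP; rewrite eq_lrshift.
by move/lshift_inj/rshift_inj->.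
Qed.
Definition right_inj : injs (c + b) (a + b + c) := Injs right_injb.

Lemma right_injE i : right_inj i = right_fun i.
Proof. by rewrite /injs_fun ffunE. Qed.

Lemma left_right_onto : jointly_onto left_inj right_inj.
Proof.
apply/forallP => x; case: (split_ordP x) => [i ->|z ->]; apply/orP; [left|right].
  by apply/codomP; exists i; rewrite left_injE.
by apply/codomP; exists (lshift b z); rewrite right_injE right_funl.
Qed.

Lemma young_lshift p q (h : symg p * symg q) i :
  young h (lshift q i) = lshift q (h.1 i).
Proof. by rewrite /sperm permE /young_fun (unsplitK (inl _)). Qed.
Lemma young_rshift p q (h : symg p * symg q) i :
  young h (rshift p i) = rshift p (h.2 i).
Proof. by rewrite /sperm permE /young_fun (unsplitK (inr _)). Qed.

Lemma young_injective p q : injective (@young p q).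
Proof.
move=> [x y] [x' y'] E; congr (_, _); apply/permP => i.
  apply: (@lshift_inj p q).
  by rewrite -(young_lshift (x, y)) E young_lshift.
apply: (@rshift_inj p q).
by rewrite -(young_rshift (x, y)) E young_rshift.
Qed.

Lemma youngP p q (h : symg (p + q)) (y : 'I_q -> 'I_q) :
  (forall j, h (rshift p j) = rshift p (y j)) -> exists u, h = young u.
Proof.
move=> hy; have y_inj : injective y.
  move=> i j E; apply: (@rshift_inj p q); apply: (@perm_inj _ (sperm h)).
  by rewrite !hy E.
have /choice[x hx] : forall i, exists i', h (lshift q i) = lshift q i'.
  move=> i; case: (split_ordP (h (lshift q i))) => [i' ->|j E]; first by exists i'.
  have [j' jE] : exists j', j = y j'.
    by exists (invF y_inj j); rewrite f_invF.
  move: E; rewrite jE -hy => /perm_inj/eqP; by rewrite eq_lrshift.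
have x_inj : injective x.
  move=> i j E; apply: (@lshift_inj p q); apply: (@perm_inj _ (sperm h)).
  by rewrite !hx E.
exists (perm x_inj : symg p, perm y_inj : symg q); apply/permP => i.
case: (split_ordP i) => [i' ->|j ->].
  by rewrite [RHS]young_lshift [LHS]hx /= /sperm permE.
by rewrite [RHS]young_rshift [LHS]hy /= /sperm permE.
Qed.

(* The stabilizer of the base pair [(left_inj, right_inj)], whose images overlap
   in the middle block of size b, is S_a x S_b x S_c. *)
Definition stab_emb (u : symg a * symg b * symg c) :
    symg (a + b + c) * (symg (a + b) * symg (c + b)) :=
  (young (young u.1, u.2), (young u.1, young (u.2, u.1.2))).

Definition pair_act k l m (g : symg m * (symg k * symg l)) (x : injs k m * injs l m) :
    injs k m * injs l m :=
  (inj_act g.1 g.2.1 x.1, inj_act g.1 g.2.2 x.2).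

Lemma stab_emb_inj : injective stab_emb.
Proof.
move=> [[x y] z] [[x' y'] z'] [/young_injective[/young_injective[-> ->] ->] _ _].
by [].
Qed.

Lemma stab_embP g :
  reflect (exists u, g = stab_emb u)
    (pair_act g (left_inj, right_inj) == (left_inj, right_inj)).
Proof.
case: g => s [h h']; apply: (iffP idP) => [|[[[x y] z] [-> -> ->]]]; last first.
  rewrite -pair_eqE; apply/andP; split; apply/inj_act_fixP => i /=.
    by rewrite !left_injE young_lshift.
  rewrite !right_injE; case: (split_ordP i) => [j ->|j ->].
    by rewrite right_funl young_lshift young_rshift right_funl.
  by rewrite right_funr young_rshift young_lshift young_rshift right_funr.
rewrite -pair_eqE => /andP[/inj_act_fixP /= fh /inj_act_fixP /= gh'].
have overlap j : exists y, h (rshift a j) = rshift a y /\ h' (rshift c j) = rshift c y.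
  have E : lshift c (h (rshift a j)) = right_fun (h' (rshift c j)).
    by rewrite -left_injE -fh -right_injE -gh' left_injE right_injE right_funr.
  move: E; case: (split_ordP (h' (rshift c j))) => [z ->|y ->].
    by move/eqP; rewrite right_funl eq_lrshift.
  by rewrite right_funr => /lshift_inj hE; exists y.
have /choice[y yP] := overlap.
have [[x1 y1] hE] := youngP (fun j => (yP j).1).
have [[z1 y2] h'E] := youngP (fun j => (yP j).2).
have y12 : y1 = y2.
  apply/permP => j; apply: (@rshift_inj a b).
  rewrite -(young_rshift (x1, y1)) -hE (yP j).1; congr rshift.
  by apply: (@rshift_inj c b); rewrite -(young_rshift (z1, y2)) -h'E (yP j).2.
exists (x1, y1, z1); rewrite /stab_emb /= -hE y12 -h'E; congr (_, _).
apply/permP => x; case: (split_ordP x) => [i ->|z ->].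
  by rewrite [RHS]young_lshift /= -[LHS]/(s _) -left_injE fh left_injE.
rewrite [RHS]young_rshift /= -[LHS]/(s _) -right_funl -right_injE gh' right_injE.
by rewrite h'E young_lshift right_funl.
Qed.

End Stabilizer.

Section Transitivity.
Variables k l m : nat.
Implicit Types (f : injs k m) (g : injs l m).

Definition color f g (x : 'I_m) : bool * bool := (x \in codom f, x \in codom g).

Lemma card_color f g f' g' c : jointly_onto f g -> jointly_onto f' g' ->
  #|[pred x | color f g x == c]| = #|[pred x | color f' g' x == c]|.
Proof.
pose A f := [set x | x \in codom f]; pose B g := [set x | x \in codom g].
have cardA f1 : #|A f1| = k.
  by rewrite cardsE card_codom ?card_ord //; apply: injs_inj.
have cardB g1 : #|B g1| = l.
  by rewrite cardsE card_codom ?card_ord //; apply: injs_inj.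
have cardI f1 g1 : jointly_onto f1 g1 -> #|A f1 :&: B g1| = (k + l - m)%N.
  move=> /forallP onto; rewrite -(cardA f1) -(cardB g1) -cardsUI.
  suff -> : A f1 :|: B g1 = setT by rewrite cardsT card_ord addKn.
  by apply/setP => x; rewrite !inE onto.
suff cE f1 g1 : jointly_onto f1 g1 -> #|[pred x | color f1 g1 x == c]| =
    (if c.1 then if c.2 then k + l - m else k - (k + l - m)
     else if c.2 then l - (k + l - m) else 0)%N.
  by move=> fg fg'; rewrite !cE.
move=> onto; case: c => -[] [] /=.
- by rewrite -(cardI f1 g1) //; apply: eq_card => x; rewrite !inE -pair_eqE /= !eqb_id.
- rewrite -(cardI f1 g1) // -{1}(cardA f1) -cardsD; apply: eq_card => x.
  by rewrite !inE -pair_eqE /pair_eq /= eqb_id eqbF_neg andbC.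
- rewrite -(cardI f1 g1) // -{1}(cardB g1) setIC -cardsD; apply: eq_card => x.
  by rewrite !inE -pair_eqE /pair_eq /= eqb_id eqbF_neg.
apply: eq_card0 => x; rewrite !inE -pair_eqE /pair_eq /= !eqbF_neg -negb_or.
by move/forallP: onto => ->.
Qed.

Lemma inj_act_transitive f g f' g' : jointly_onto f g -> jointly_onto f' g' ->
  exists u, (f', g') = pair_act u (f, g).
Proof.
move=> fg fg'; have /tuple_permP[p pE] :
    perm_eq [tuple color f' g' i | i < m] [tuple color f g i | i < m].
  apply/allP => c _; apply/eqP; rewrite /= !count_map.
  have countE (P : pred 'I_m) : count P (enum 'I_m) = #|P|.
    by rewrite -sum1_count big_enum_cond sum1_card.
  by rewrite -!enumT !countE; apply: card_color.
have colorE i : color f' g' i = color f g (p i).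
  have /(congr1 (fun s => nth (color f' g' i) s i)) := pE.
  by rewrite -!tnth_nth !tnth_mktuple.
pose s : symg m := (p^-1)%g.
have lift n (f0 f1 : injs n m) : (forall i, (i \in codom f1) = (p i \in codom f0)) ->
    exists h, f1 = inj_act s h f0.
  move=> cE; have [t tE] : exists t : {perm 'I_n}, forall i, f1 i = s (f0 (t i)).
    apply: (perm_of_codom (g := fun i => s (f0 i))); first exact: injs_inj.
    move=> i; have := codom_f f1 i; rewrite cE => /codomP[j jE].
    by exists j; rewrite -jE /s /sperm permK.
  exists ((t : symg n)^-1)%g; apply: injsP => i; rewrite inj_actE invgK; exact: tE.
have [h ->] := lift _ f f' (fun i => congr1 fst (colorE i)).
have [h' ->] := lift _ g g' (fun i => congr1 snd (colorE i)).
by exists (s, (h, h')).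
Qed.

Lemma jointly_onto_act u f g : jointly_onto (pair_act u (f, g)).1 (pair_act u (f,
  g)).2 = jointly_onto f g.
Proof.
apply/forallP/forallP => onto x; have := onto ((u.1)%g x); have := onto ((u.1^-1)%g x).
  by rewrite !codom_inj_act spermVK.
by rewrite !codom_inj_act.
Qed.

End Transitivity.

Section Multiplicity.
Variables (F : fieldType) (n : nat).
Hypothesis charF : [pchar F] =i pred0.
Local Notation X n lam := (chi (specht F n lam)).

Lemma card_symg k : #|(symg k : finGroupType)| = k`!.
Proof. exact: card_Sn. Qed.

Definition class_weight k l m (lam mu nu : seq nat) (g : symg m * (symg k * symg l))
  : F :=
  X m nu (g.1^-1)%g * (X k lam g.2.1 * X l mu g.2.2).

Lemma pairing_inner_simple k l m (hk : (k <= n)%N) (hl : (l <= n)%N) (hm : (m <= n)%N)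
    (lam mu nu : seq nat) :
  pairing (isn_sys n charF) (isn_simple F hm nu)
    (inner_tens (isn_simple F hk lam) (isn_simple F hl mu)) =
  #|((symg m * (symg k * symg l))%type : finGroupType)|%:R^-1 *
  \sum_(g : symg m * (symg k * symg l))
    \sum_(x : injs k m * injs l m | jointly_onto x.1 x.2 && (pair_act g x == x))
      class_weight lam mu nu g.
Proof.
rewrite pairing_simple !card_prod !card_symg !natrM !invfM -mulrA; congr (_ * _).
rewrite -(pair_bigA _ (fun s hh => \sum_(x | _ && (pair_act (s, hh) x == x))
  class_weight lam mu nu (s, hh))).
rewrite mulr_sumr; apply: eq_bigr => s _ /=.
rewrite -(pair_bigA _ (fun h h' => \sum_(x | _ && (pair_act (s, (h, h')) x == x))
  class_weight lam mu nu (s, (h, h')))).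
rewrite comp_chi_inner_simple // mulrCA; congr (_ * _).
rewrite mulr_sumr; apply: eq_bigr => h _; rewrite mulr_sumr; apply: eq_bigr => h' _ /=.
rewrite pair_big /= mulr_sumr [LHS]big_mkcond [RHS]big_mkcond.
apply: eq_bigr => -[f g] _ /=; rewrite -pair_eqE /pair_eq /= !fixed_byE.
by case: (inj_act s h f == f) (inj_act s h' g == g) (jointly_onto f g) => -[] [];
  rewrite /= ?mul0r ?mulr0 ?mul1r.
Qed.

Lemma pairing_inner_simple_eq0 k l m (hk : (k <= n)%N) (hl : (l <= n)%N) (hm : (m <=
  n)%N)
    (lam mu nu : seq nat) : (m < maxn k l)%N || (k + l < m)%N ->
  pairing (isn_sys n charF) (isn_simple F hm nu)
    (inner_tens (isn_simple F hk lam) (isn_simple F hl mu)) = 0.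
Proof.
move=> out; rewrite pairing_inner_simple big1 ?mulr0 // => u _;
  rewrite big1 // => -[f g].
case/andP=> /= onto _; exfalso; move: out.
have le_km p (e : injs p m) : (p <= m)%N.
  by have := leq_card _ (@injs_inj _ _ e); rewrite !card_ord.
rewrite ltnNge geq_max (le_km _ f) (le_km _ g) /= ltnNge => /negP[].
rewrite -[leqLHS]card_ord -[k]card_ord -[l in leqRHS]card_ord.
rewrite -(card_codom (@injs_inj _ _ f)) -(card_codom (@injs_inj _ _ g)) -cardUI.
apply: leq_trans (leq_addr _ _); apply/subset_leq_card/subsetP => x _.
by move/forallP: onto => /(_ x).
Qed.

Lemma class_weightJ k l m lam mu nu u g :
  @class_weight k l m lam mu nu (u * g * u^-1)%g = class_weight lam mu nu g.
Proof.
case: u g => s [h h'] [t [w w']]; rewrite /class_weight /=.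
by rewrite !chiJ !invMg invgK mulgA chiJ.
Qed.

Lemma pairing_inner_simple_sum a b c k l m (hk : (k <= n)%N) (hl : (l <= n)%N) (hm :
  (m <= n)%N)
    (lam mu nu : seq nat) : k = (a + b)%N -> l = (c + b)%N -> m = (a + b + c)%N ->
  pairing (isn_sys n charF) (isn_simple F hm nu)
    (inner_tens (isn_simple F hk lam) (isn_simple F hl mu)) =
  (a`!)%:R^-1 * (b`!)%:R^-1 * (c`!)%:R^-1 *
  \sum_(x : symg a) \sum_(y : symg b) \sum_(z : symg c)
    X (a + b) lam (young (x^-1, y^-1)%g) * X (c + b) mu (young (z^-1, y^-1)%g) *
    X (a + b + c) nu (young (young (x, y), z)).
Proof.
move=> Ek El Em; subst k l m; rewrite pairing_inner_simple.
pose x0 := (left_inj a b c, right_inj a b c).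
rewrite (@orbit_average _ _ _ (@pair_act (a + b) (c + b) (a + b + c)) charF _ _
  (fun x => jointly_onto x.1 x.2) x0).
- pose stab := [set stab_emb u | u : symg a * symg b * symg c].
  have stabE g : (pair_act g x0 == x0) = (g \in stab).
    by apply/stab_embP/imsetP => [[u ->]|[u _ ->]]; exists u.
  rewrite (eq_bigl _ _ stabE) (eq_card (B := stab)) => [|g]; last by rewrite inE stabE.
  rewrite big_imset /=; last by move=> u v _ _; apply: stab_emb_inj.
  rewrite card_imset; last exact: stab_emb_inj.
  rewrite !card_prod !card_symg !natrM !invfM; congr (_ * _).
  rewrite (reindex_inj invg_inj) /= [RHS]pair_bigA [RHS]pair_bigA /=.
  apply: eq_bigr => -[[x y] z] _ /=; rewrite /class_weight /=.
  have -> : ((young (young ((x, y)^-1), z^-1))^-1 = young (young (x, y), z))%g.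
    by rewrite -youngV; congr (young (_, _)); rewrite ?invgK // youngV invgK.
  by rewrite mulrC.
- by move=> [f g]; rewrite /pair_act !inj_act1.
- by move=> u v [f g]; rewrite /pair_act !inj_actM.
- move=> [f g]; split=> [onto|[u E]].
    by apply: inj_act_transitive onto; apply: left_right_onto.
  by rewrite E jointly_onto_act left_right_onto.
exact: class_weightJ.
Qed.

Lemma mult_inner_simple k l m (hk : (k <= n)%N) (hl : (l <= n)%N) (hm : (m <= n)%N)
    (lam mu : seq nat) (nu : intpart m) :
  (mult (inner_tens (isn_simple F hk lam) (isn_simple F hl mu)) (isn_simple F hm
    nu))%:R =
  pairing (isn_sys n charF) (isn_simple F hm nu)
    (inner_tens (isn_simple F hk lam) (isn_simple F hl mu)).
Proof. by rewrite (mult_pairing (S := isn_sys n charF)) // pairing_simple_self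
  cdot_specht_self. Qed.

End Multiplicity.

Theorem theorem1 (F : closedFieldType) (charF : [pchar F]%R =i pred0)
    (n k l m : nat) (hk : (k <= n)%N) (hl : (l <= n)%N) (hm : (m <= n)%N)
    (lam : intpart k) (mu : intpart l) (nu : intpart m) :
  let kcoef : nat :=
    mult (inner_tens (isn_simple F hk lam) (isn_simple F hl mu))
         (isn_simple F hm nu) in
  ((m < maxn k l)%N || (k + l < m)%N -> kcoef = 0%N) /\
  ((maxn k l <= m)%N && (m <= k + l)%N ->
   let b := (k + l - m)%N in
   let a := (k - b)%N in
   let c := (l - b)%N in
   kcoef =
     (\sum_(alpha : intpart a) \sum_(beta : intpart b) \sum_(gamma : intpart c)
      \sum_(delta : intpart b) \sum_(eps : intpart b)
      \sum_(kappa : intpart (a + b))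
        lrcoef F a b alpha beta lam * lrcoef F c b gamma delta mu *
        kronecker F b beta delta eps * lrcoef F a b alpha eps kappa *
        lrcoef F (a + b) c kappa gamma nu)%N).
Proof.
move=> kcoef; split=> [out|/andP[ge_m le_m] b a c]; apply: (natr_inj charF).
  by rewrite /kcoef mult_inner_simple pairing_inner_simple_eq0.
have [Ek El Em] : [/\ k = (a + b)%N, l = (c + b)%N & m = (a + b + c)%N].
  move: ge_m; rewrite geq_max => /andP[km lm].
  have bk : (b <= k)%N by rewrite /b leq_subLR addnC leq_add2r.
  have bl : (b <= l)%N by rewrite /b leq_subLR leq_add2r.
  have abk : (a + b)%N = k by rewrite /a subnK.
  split; rewrite ?abk // /c; first by rewrite subnK.
  by rewrite addnBA // /b subKn.
rewrite /kcoef mult_inner_simple (pairing_inner_simple_sum _ _ _ _ _ _ _ Ek El Em).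
clear kcoef ge_m le_m; clearbody a c; clearbody b; subst k l m.
by rewrite coefficient_sum // !card_symg.
Qed.
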